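(* Let $g\in C^{\omega}(\mathbb{R})$ be a real-analytic function such that $$g(v)>0,\qquad \frac{d g}{d v}(v)\ge 0,\qquad \frac{d^2}{dv^2}\big(v^2 g(v^2)\big)>0\qquad\text{for all } v>0,\qquad \lim_{v\to\infty} v\,g(v^2)=\infty .$$ Then there exists $\beta>0$ such that the toy model with this $g$ and this $\beta$ has a unique toy steady tip growth solution.
   Context: Toy model: for a real-analytic $g:\mathbb{R}\to\mathbb{R}$ with $g(v)>0$ for $v>0$ and a parameter $\beta$, the toy model is the planar ODE (independent variable $s$, prime denotes $d/ds$) $$\rho'=\frac32\,\frac{1-\rho^2}{r}\left(-1+\frac{\sqrt{1-\rho^2}\,\big(\beta r^2 g(r^2)+\rho\big)}{r}\right),\qquad r'=\rho,$$ on the phase space $M_0=(-1,1)\times\mathbb{R}_{>0}$. Consider solutions $(\rho,r)$ defined on an interval of the form $(0,s_{\max})$. Conditions: (S1) $\lim_{s\to0^+}\rho(s)=1$, $\lim_{s\to0^+}r(s)=0$, and $\lim_{s\to0^+}\sqrt{1-\rho(s)^2}/r(s)=\eta_0$ for some $\eta_0>0$. (S2) there exist $s_0>0$ and a real-analytic $G:(-a,a)\to\mathbb{R}_{>0}$ with $a=r(s_0)^2$ such that $\rho(s)=G(r(s)^2)$ for all $s\in(0,s_0)$. (S3) the solution is defined on $(0,\infty)$ and $\rho'(s)<0$, $\rho(s)>0$ for all $s>0$. (S4) $\lim_{s\to\infty}\rho(s)=0$ and $\lim_{s\to\infty}r(s)=r_\infty$ for some $r_\infty>0$. A toy steady tip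 growth solution is a solution of the toy model satisfying (S1)–(S4). *)

(* Defs.v *)
From Stdlib Require Import Reals Lra.
Open Scope R_scope.

Definition analytic_at (f : R -> R) (x0 : R) : Prop :=
  exists (c : nat -> R) (rad : R), 0 < rad /\
    forall x, Rabs (x - x0) < rad -> Pser c (x - x0) (f x).

Definition analytic_on (f : R -> R) (a b : R) : Prop :=
  forall x, a < x < b -> analytic_at f x.

Definition analytic (f : R -> R) : Prop := forall x, analytic_at f x.

Definition second_derivative_at (h : R -> R) (v l : R) : Prop :=
  exists (d : R -> R) (eps : R), 0 < eps /\
    (forall w, Rabs (w - v) < eps -> derivable_pt_lim h w (d w)) /\
    derivable_pt_lim d v l.

Definition lim_right0 (f : R -> R) (L : R) : Prop :=
  forall eps, 0 < eps -> exists delta, 0 < delta /\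
    forall s, 0 < s < delta -> Rabs (f s - L) < eps.

Definition lim_infty (f : R -> R) (L : R) : Prop :=
  forall eps, 0 < eps -> exists S, forall s, S < s -> Rabs (f s - L) < eps.

Definition rho_rhs (g : R -> R) (beta rho r : R) : R :=
  3 / 2 * ((1 - rho ^ 2) / r) *
    (-1 + sqrt (1 - rho ^ 2) * (beta * r ^ 2 * g (r ^ 2) + rho) / r).

Definition toy_solution_on_pos (g : R -> R) (beta : R) (rho r : R -> R) : Prop :=
  forall s, 0 < s ->
    (-1 < rho s < 1) /\ 0 < r s /\
    derivable_pt_lim rho s (rho_rhs g beta (rho s) (r s)) /\
    derivable_pt_lim r s (rho s).

Definition toy_steady_tip_growth (g : R -> R) (beta : R) (rho r : R -> R) : Prop :=
  toy_solution_on_pos g beta rho r /\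
  (lim_right0 rho 1 /\ lim_right0 r 0 /\
   exists eta0, 0 < eta0 /\
     lim_right0 (fun s => sqrt (1 - rho s ^ 2) / r s) eta0) /\
  (exists (s0 : R) (G : R -> R), 0 < s0 /\
     let a := r s0 ^ 2 in
     analytic_on G (- a) a /\
     (forall x, - a < x < a -> 0 < G x) /\
     (forall s, 0 < s < s0 -> rho s = G (r s ^ 2))) /\
  (forall s, 0 < s ->
     (forall l, derivable_pt_lim rho s l -> l < 0) /\ 0 < rho s) /\
  (lim_infty rho 0 /\ exists r_inf, 0 < r_inf /\ lim_infty r r_inf).

(* Main.v *)
(* With w = r / sqrt (1 - rho^2) and Q = beta r^2 g(r^2), the toy model reads
     r dw/dr = - w/2 + 3/2 (Q + rho),   rho' < 0 iff E := -1 + (Q + rho)/w < 0.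
   In the variable u = r^2 the equation for eta = 1/w is singular at u = 0, but has
   exactly one bounded solution, eta(0) = 1/3, which is analytic (method of
   majorants); it carries every solution with (S1), whence uniqueness and (S2).
   For existence, shoot in beta: follow this solution until either rho or E
   vanishes. Both cannot vanish at once (equilibrium), and by the convexity
   hypothesis E vanishes transversally, so that the values of beta for which rho
   vanishes first, or E does, form two disjoint open sets. Both are nonempty
   (beta small, resp. beta large), so some beta is in neither; then rho > 0 and E < 0
   forever, which is (S3), and (S4) follows as E < 0 bounds r. *)
Require Import Defs.
From Stdlib Require Import Reals Lra Lia Factorial.
From Coquelicot Require Import Coquelicot.
Open Scope R_scope.

(** * Calculus on the line *)

(** The field is singular at [r = 0] and at [|rho| = 1], so no flow is at hand to shoot with. Near
    the axis the curve [rho = G (r^2)] replaces it, on an interval [u < eps] common to all [beta] in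
    [[0, B]]; so all trajectories can start at one radius [r0]. Beyond, the arguments of the field
    are clamped to a box, which gives a globally Lipschitz field, global trajectories and continuity
    in [beta]. As long as [rho >= 0] and E <= 0 the clamps are inactive: [r] and [rho] are monotone,
    and [r < R1] because the growth of [v g(v^2)] would make E positive at [R1]. The ends [b] and
    [B] of the range of [beta] rest on the bounds [3 rho <= w <= 3 + 3/5 Q], valid while [rho > 0]
    and E < 0. The value [w = 3] on the axis balances [- w/2 + 3/2 rho] at [rho = 1]; 3/5 solves
    [5/2 x = 3/2], the response of [w] to a forcing [Q] proportional to [r^2]. Linearised about the
    curve, a perturbation of [w] behaves like [r^(-1/2)], so at most one solution is bounded. The
    translation in [s] that remains is fixed by [r -> 0] at [s = 0]. *)

Lemma dl_eq f x l l' : derivable_pt_lim f x l -> l = l' -> derivable_pt_lim f x l'.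
Proof. intros H <-; exact H. Qed.

Lemma dl_const c x : derivable_pt_lim (fun _ => c) x 0.
Proof. apply derivable_pt_lim_const. Qed.

Lemma dl_id x : derivable_pt_lim (fun y => y) x 1.
Proof. apply derivable_pt_lim_id. Qed.

Lemma dl_plus f h x a b :
  derivable_pt_lim f x a -> derivable_pt_lim h x b ->
  derivable_pt_lim (fun y => f y + h y) x (a + b).
Proof. intros; now apply derivable_pt_lim_plus. Qed.

Lemma dl_minus f h x a b :
  derivable_pt_lim f x a -> derivable_pt_lim h x b ->
  derivable_pt_lim (fun y => f y - h y) x (a - b).
Proof. intros; now apply derivable_pt_lim_minus. Qed.

Lemma dl_opp f x a :
  derivable_pt_lim f x a -> derivable_pt_lim (fun y => - f y) x (- a).
Proof. intros; now apply derivable_pt_lim_opp. Qed.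

Lemma dl_mult f h x a b :
  derivable_pt_lim f x a -> derivable_pt_lim h x b ->
  derivable_pt_lim (fun y => f y * h y) x (a * h x + f x * b).
Proof. intros; now apply derivable_pt_lim_mult. Qed.

Lemma dl_comp f h x a b :
  derivable_pt_lim f x a -> derivable_pt_lim h (f x) b ->
  derivable_pt_lim (fun y => h (f y)) x (b * a).
Proof. intros; now apply (derivable_pt_lim_comp f h). Qed.

Lemma dl_div f h x a b :
  derivable_pt_lim f x a -> derivable_pt_lim h x b -> h x <> 0 ->
  derivable_pt_lim (fun y => f y / h y) x ((a * h x - b * f x) / (h x) ^ 2).
Proof.
intros; apply (dl_eq _ _ ((a * h x - b * f x) / Rsqr (h x))).
  now apply derivable_pt_lim_div.
unfold Rsqr; now field.
Qed.

Lemma dl_inv h x b :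
  derivable_pt_lim h x b -> h x <> 0 ->
  derivable_pt_lim (fun y => / h y) x (- b / (h x) ^ 2).
Proof.
intros H H0; apply (dl_eq _ _ ((0 * h x - b * 1) / h x ^ 2)).
- intros e He; destruct (dl_div _ _ _ _ _ (dl_const 1 x) H H0 e He) as [d Hd].
  exists d; intros k k0 kd; specialize (Hd k k0 kd); unfold Rdiv in *.
  now rewrite !Rmult_1_l in *.
- now field.
Qed.

Lemma dl_pow f x a n :
  derivable_pt_lim f x a ->
  derivable_pt_lim (fun y => f y ^ n) x (INR n * f x ^ pred n * a).
Proof.
intros H; exact (dl_comp f (fun z => z ^ n) x a _ H (derivable_pt_lim_pow (f x) n)).
Qed.

Lemma dl_sqrt f x a :
  derivable_pt_lim f x a -> 0 < f x ->
  derivable_pt_lim (fun y => sqrt (f y)) x (/ (2 * sqrt (f x)) * a).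
Proof. intros H H0; apply (dl_comp f sqrt); [easy|now apply derivable_pt_lim_sqrt]. Qed.

Lemma dl_exp f x a :
  derivable_pt_lim f x a ->
  derivable_pt_lim (fun y => exp (f y)) x (exp (f x) * a).
Proof. intros H; apply (dl_comp f exp); [easy|apply derivable_pt_lim_exp]. Qed.

Ltac dl_step :=
  match goal with
  | |- derivable_pt_lim (fun _ => ?c) _ _ => apply dl_const
  | |- derivable_pt_lim (fun y => y) _ _ => apply dl_id
  | H : derivable_pt_lim ?f ?x _ |- derivable_pt_lim ?f ?x _ => exact H
  | H : derivable_pt_lim ?f ?x _ |- derivable_pt_lim (fun y => ?f y) ?x _ => exact H
  | |- derivable_pt_lim (Rmult ?c) _ _ => change (Rmult c) with (fun y => c * y)
  | |- derivable_pt_lim (Rplus ?c) _ _ => change (Rplus c) with (fun y => c + y)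
  | |- derivable_pt_lim (Rminus ?c) _ _ => change (Rminus c) with (fun y => c - y)
  | |- derivable_pt_lim (fun y => _ + _) _ _ => eapply dl_plus
  | |- derivable_pt_lim (fun y => _ - _) _ _ => eapply dl_minus
  | |- derivable_pt_lim (fun y => - _) _ _ => eapply dl_opp
  | |- derivable_pt_lim (fun y => _ * _) _ _ => eapply dl_mult
  | |- derivable_pt_lim (fun y => _ / _) _ _ => eapply dl_div
  | |- derivable_pt_lim (fun y => / _) _ _ => eapply dl_inv
  | |- derivable_pt_lim (fun y => _ ^ _) _ _ => eapply dl_pow
  | |- derivable_pt_lim (fun y => sqrt _) _ _ => eapply dl_sqrt
  | |- derivable_pt_lim (fun y => exp _) _ _ => eapply dl_exp
  | H : derivable_pt_lim ?f _ _ |- derivable_pt_lim (fun y => ?f _) _ _ =>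
      eapply (dl_comp _ f); [|exact H]
  end.
Ltac dl := repeat dl_step.

Lemma dl_ext_loc f h x l d : 0 < d ->
  (forall y, Rabs (y - x) < d -> f y = h y) ->
  derivable_pt_lim f x l -> derivable_pt_lim h x l.
Proof.
intros Hd He H; apply is_derive_Reals.
apply (is_derive_ext_loc f); [|now apply is_derive_Reals].
exists (mkposreal d Hd); intros y Hy; now apply He.
Qed.

Lemma dl_unique f x a b :
  derivable_pt_lim f x a -> derivable_pt_lim f x b -> a = b.
Proof. apply uniqueness_limite. Qed.

Lemma dl_cont f x l : derivable_pt_lim f x l -> continuity_pt f x.
Proof. intros H; apply derivable_continuous_pt; now exists l. Qed.

(** Serves where the arc near the axis is continued by the flow: both pieces solve the same
    equation, so their derivatives agree at the junction. *)
Lemma dl_glue f h x l : f x = h x ->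
  derivable_pt_lim f x l -> derivable_pt_lim h x l ->
  derivable_pt_lim (fun y => if Rle_dec y x then f y else h y) x l.
Proof.
intros E Hf Hh e He.
destruct (Hf e He) as [d1 H1], (Hh e He) as [d2 H2].
exists (mkposreal _ (Rmin_stable_in_posreal d1 d2)); simpl; intros k k0 kd.
assert (k1 := Rlt_le_trans _ _ _ kd (Rmin_l _ _)).
assert (k2 := Rlt_le_trans _ _ _ kd (Rmin_r _ _)).
destruct (Rle_dec x x) as [_|n]; [|lra].
destruct (Rle_dec (x + k) x); [now apply H1|rewrite E; now apply H2].
Qed.

Lemma dl_nonpos_decr f df a b : a <= b ->
  (forall x, a <= x <= b -> derivable_pt_lim f x (df x)) ->
  (forall x, a <= x <= b -> df x <= 0) -> f b <= f a.
Proof.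
intros [ab| ->] H Hn; [|lra].
destruct (MVT_cor2 f df a b ab H) as [c [Hc c1]].
assert (df c <= 0) by (apply Hn; lra). nra.
Qed.

Lemma dl_nonneg_incr f df a b : a <= b ->
  (forall x, a <= x <= b -> derivable_pt_lim f x (df x)) ->
  (forall x, a <= x <= b -> 0 <= df x) -> f a <= f b.
Proof.
intros [ab| ->] H Hn; [|lra].
destruct (MVT_cor2 f df a b ab H) as [c [Hc c1]].
assert (0 <= df c) by (apply Hn; lra). nra.
Qed.

Lemma dl_zero_const f df a b : a <= b ->
  (forall x, a <= x <= b -> derivable_pt_lim f x (df x)) ->
  (forall x, a <= x <= b -> df x = 0) -> f a = f b.
Proof.
intros ab H Hn; apply Rle_antisym.
- apply (dl_nonneg_incr f df); auto; intros x Hx; rewrite (Hn x); auto; lra.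
- apply (dl_nonpos_decr f df); auto; intros x Hx; rewrite (Hn x); auto; lra.
Qed.

Lemma dl_neg_right f x l : derivable_pt_lim f x l -> l < 0 ->
  exists d, 0 < d /\ forall h, 0 < h < d -> f (x + h) < f x.
Proof.
intros H Hl; destruct (H (- l)) as [d Hd]; [lra|].
exists d; split; [apply cond_pos|]; intros h Hh.
assert (A : h <> 0) by lra.
assert (B : Rabs h < d) by (rewrite Rabs_pos_eq; lra).
specialize (Hd h A B); apply Rabs_def2 in Hd.
assert (C : (f (x + h) - f x) / h < 0) by lra.
assert (f (x + h) - f x = (f (x + h) - f x) / h * h) by (field; lra).
nra.
Qed.

Lemma dl_neg_left f x l : derivable_pt_lim f x l -> l < 0 ->
  exists d, 0 < d /\ forall h, 0 < h < d -> f x < f (x - h).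
Proof.
intros H Hl; destruct (H (- l)) as [d Hd]; [lra|].
exists d; split; [apply cond_pos|]; intros h Hh.
assert (A : - h <> 0) by lra.
assert (B : Rabs (- h) < d) by (rewrite Rabs_Ropp, Rabs_pos_eq; lra).
specialize (Hd (- h) A B); apply Rabs_def2 in Hd.
replace (x + - h) with (x - h) in Hd by ring.
assert (C : (f (x - h) - f x) / - h < 0) by lra.
assert (f (x - h) - f x = (f (x - h) - f x) / - h * - h) by (field; lra).
nra.
Qed.

Lemma cont_eps f x e : continuity_pt f x -> 0 < e ->
  exists d, 0 < d /\ forall y, Rabs (y - x) < d -> Rabs (f y - f x) < e.
Proof.
intros H He; destruct (H e He) as [d [d0 Hd]]; exists d; split; auto.
intros y Hy; destruct (Req_dec y x) as [->|n].
  unfold Rminus; rewrite Rplus_opp_r, Rabs_R0; lra.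
apply (Hd y); repeat split; auto.
Qed.

Lemma cont_nonneg_left f a b : a < b -> continuity_pt f b ->
  (forall x, a <= x < b -> 0 <= f x) -> 0 <= f b.
Proof.
intros ab Hc H; destruct (Rle_or_lt 0 (f b)) as [|n]; auto.
destruct (cont_eps f b (- f b) Hc) as [d [d0 Hd]]; [lra|].
set (y := Rmax a (b - d / 2)).
assert (a <= y) by apply Rmax_l. assert (b - d / 2 <= y) by apply Rmax_r.
assert (y < b) by (unfold y; apply Rmax_lub_lt; lra).
assert (Hy : Rabs (y - b) < d) by (rewrite Rabs_left; lra).
specialize (Hd y Hy); apply Rabs_def2 in Hd.
specialize (H y); lra.
Qed.

Lemma cont_nonneg_at_0 f : continuity_pt f 0 -> (forall x, 0 < x -> 0 <= f x) ->
  forall x, 0 <= x -> 0 <= f x.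
Proof.
intros C H x [x0|<-]; [auto|].
destruct (Rle_or_lt 0 (f 0)) as [|n]; auto; exfalso.
destruct (cont_eps f 0 (- f 0) C) as [d [d0 Hd]]; [lra|].
specialize (Hd (d / 2)); rewrite Rminus_0_r, Rabs_pos_eq in Hd by lra.
specialize (Hd ltac:(lra)); apply Rabs_def2 in Hd; specialize (H (d / 2)); lra.
Qed.

Lemma Rmin_cont f h t : continuity_pt f t -> continuity_pt h t ->
  continuity_pt (fun s => Rmin (f s) (h s)) t.
Proof.
intros Cf Ch e He.
destruct (cont_eps f t e Cf He) as [d1 [d10 H1]]; destruct (cont_eps h t e Ch He) as [d2 [d20 H2]].
exists (Rmin d1 d2); split; [now apply Rmin_glb_lt|]; intros s [_ Hs]; simpl in *; unfold Rdist in *.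
specialize (H1 s (Rlt_le_trans _ _ _ Hs (Rmin_l _ _))).
specialize (H2 s (Rlt_le_trans _ _ _ Hs (Rmin_r _ _))).
apply Rabs_def2 in H1; apply Rabs_def2 in H2.
unfold Rmin; do 2 destruct Rle_dec; apply Rabs_def1; lra.
Qed.

(** The zero is the supremum of the points up to which [f] has stayed positive. *)
Lemma first_zero f a b : a <= b ->
  (forall x, a <= x <= b -> continuity_pt f x) -> 0 < f a -> f b <= 0 ->
  exists c, a < c <= b /\ f c = 0 /\ forall x, a <= x < c -> 0 < f x.
Proof.
intros ab Hc Ha Hb.
set (S := fun x => a <= x <= b /\ forall y, a <= y <= x -> 0 < f y).
assert (Sa : S a) by (split; [lra|]; intros y Hy; replace y with a by lra; auto).
destruct (completeness S) as [c [Hub Hl]].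
- exists b; intros x [Hx _]; lra.
- now exists a.
- assert (ac : a <= c) by now apply Hub.
  assert (cb : c <= b) by (apply Hl; intros x [Hx _]; lra).
  assert (P : forall x, a <= x < c -> 0 < f x).
  { intros x Hx; destruct (Rlt_or_le 0 (f x)) as [|n]; auto; exfalso.
    assert (c <= x); [|lra]. apply Hl; intros z [Hz Hz'].
    destruct (Rle_or_lt z x) as [|m]; auto.
    specialize (Hz' x); lra. }
  assert (C := Hc c (conj ac cb)).
  assert (f c <= 0).
  { destruct (Rle_or_lt (f c) 0) as [|n]; auto; exfalso.
    destruct (Req_dec c b) as [->|cb']; [lra|].
    destruct (cont_eps f c (f c) C n) as [d [d0 Hd]].
    set (z := Rmin b (c + d / 2)).
    assert (z <= b) by apply Rmin_l. assert (z <= c + d / 2) by apply Rmin_r.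
    assert (c < z) by (unfold z; apply Rmin_glb_lt; lra).
    assert (z <= c); [|lra]. apply Hub; split; [lra|].
    intros y Hy; destruct (Rlt_or_le y c); [apply P; lra|].
    assert (Hy' : Rabs (y - c) < d) by (rewrite Rabs_pos_eq; lra).
    specialize (Hd y Hy'); apply Rabs_def2 in Hd; lra. }
  assert (a < c) by (destruct (Req_dec a c) as [e|]; [rewrite e in Ha; lra|lra]).
  exists c; repeat split; auto; try lra.
  apply Rle_antisym; auto.
  apply (cont_nonneg_left f a); auto. intros x Hx; left; now apply P.
Qed.

(* Look at the minimum of [f] on [a, b]: were it negative, [f] would be
   increasing there, so that smaller values would occur just to the left. *)
Lemma barrier f df a b : a <= b ->
  (forall x, a <= x <= b -> derivable_pt_lim f x (df x)) -> 0 <= f a ->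
  (forall x, a < x <= b -> f x < 0 -> 0 < df x) ->
  forall x, a <= x <= b -> 0 <= f x.
Proof.
intros ab Hd Ha Hb.
destruct (continuity_ab_min f a b ab) as [m [Hm mab]].
  intros c Hc; apply (dl_cont _ _ _ (Hd c Hc)).
intros x Hx; apply Rle_trans with (f m); [|now apply Hm].
destruct (Rle_or_lt 0 (f m)) as [|n]; auto; exfalso.
assert (a < m) by (destruct (Req_dec a m) as [e|]; [rewrite e in Ha; lra|lra]).
assert (D := Hb m (conj H (proj2 mab)) n).
destruct (dl_neg_left (fun y => - f y) m (- df m)) as [d [d0 D']].
- apply dl_opp; apply Hd; lra.
- lra.
- set (h := Rmin (d / 2) (m - a)).
  assert (h <= d / 2) by apply Rmin_l. assert (h <= m - a) by apply Rmin_r.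
  assert (0 < h) by (apply Rmin_glb_lt; lra).
  specialize (D' h); specialize (Hm (m - h)); lra.
Qed.

(** At its first zero [f] would come down from positive values, against a positive derivative. The
    sign of [df] is asked for only on the zero set. *)
Lemma barrier_strict f df a b : a <= b ->
  (forall x, a <= x <= b -> derivable_pt_lim f x (df x)) -> 0 < f a ->
  (forall x, a < x <= b -> f x = 0 -> 0 < df x) ->
  forall x, a <= x <= b -> 0 < f x.
Proof.
intros ab Hd Ha Hb x Hx.
destruct (Rlt_or_le 0 (f x)) as [|n]; auto; exfalso.
destruct (first_zero f a x) as [c [Hc [fc P]]]; auto; try lra.
  intros y Hy; apply (dl_cont _ _ (df y)), Hd; lra.
assert (D : 0 < df c) by (apply Hb; lra).
destruct (dl_neg_left (fun y => - f y) c (- df c)) as [d [d0 D']].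
- apply dl_opp; apply Hd; lra.
- lra.
- set (h := Rmin (d / 2) (c - a)).
  assert (h <= d / 2) by apply Rmin_l. assert (h <= c - a) by apply Rmin_r.
  assert (0 < h) by (apply Rmin_glb_lt; lra).
  specialize (D' h); specialize (P (c - h)); lra.
Qed.

(** Integrating factor: [e t * exp (- (k * t)) - m * t] is nonincreasing, as the exponential is at
    most 1. *)
Lemma gronwall e de k m T : 0 <= k -> 0 <= m ->
  (forall t, 0 <= t <= T -> derivable_pt_lim e t (de t)) ->
  (forall t, 0 <= t <= T -> de t <= k * e t + m) ->
  forall t, 0 <= t <= T -> e t <= (e 0 + m * t) * exp (k * t).
Proof.
intros k0 m0 Hd Hb t Ht.
set (f := fun t => e t * exp (- (k * t)) - m * t).
assert (A : f t <= f 0).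
{ apply (dl_nonpos_decr f (fun t => (de t - k * e t) * exp (- (k * t)) - m)); [lra| |].
  - intros x Hx; assert (Dx : derivable_pt_lim e x (de x)) by (apply Hd; lra).
    unfold f; eapply dl_eq; [dl|simpl; ring].
  - intros x Hx; specialize (Hb x).
    assert (exp (- (k * x)) <= 1).
    { rewrite <- exp_0; destruct (Req_dec (k * x) 0) as [e0|]; [rewrite e0, Ropp_0; lra|].
      left; apply exp_increasing; nra. }
    assert (0 < exp (- (k * x))) by apply exp_pos. nra. }
unfold f in A.
rewrite Rmult_0_r, Ropp_0, exp_0, Rmult_0_r in A.
assert (E : exp (- (k * t)) * exp (k * t) = 1) by (rewrite <- exp_plus, <- exp_0; f_equal; ring).
assert (0 < exp (k * t)) by apply exp_pos.
replace (e t) with (e t * exp (- (k * t)) * exp (k * t)) by (rewrite Rmult_assoc, E; ring).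
apply Rmult_le_compat_r; lra.
Qed.

(** A quantity that decays at most exponentially cannot reach zero in finite time; meant for the
    squared distance from an equilibrium. *)
Lemma backward_zero e de k a b : a <= b ->
  (forall t, a <= t <= b -> derivable_pt_lim e t (de t)) ->
  (forall t, a <= t <= b -> - k * e t <= de t) -> e b <= 0 -> e a <= 0.
Proof.
intros ab Hd Hb H.
set (f := fun t => e t * exp (k * t)).
assert (A : f a <= f b).
{ apply (dl_nonneg_incr f (fun t => (de t + k * e t) * exp (k * t))); auto.
  - intros x Hx; assert (Dx := Hd x Hx); unfold f.
    eapply dl_eq; [dl|simpl; ring].
  - intros x Hx; specialize (Hb x Hx); assert (0 < exp (k * x)) by apply exp_pos; nra. }
unfold f in A. assert (0 < exp (k * a)) by apply exp_pos.
assert (0 < exp (k * b)) by apply exp_pos. nra.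
Qed.

Lemma lip_of_deriv f df a b M :
  (forall x, a <= x <= b -> derivable_pt_lim f x (df x)) ->
  (forall x, a <= x <= b -> Rabs (df x) <= M) ->
  forall x y, a <= x <= b -> a <= y <= b -> Rabs (f x - f y) <= M * Rabs (x - y).
Proof.
intros Hd HM.
assert (W : forall x y, a <= x <= b -> a <= y <= b -> x < y ->
  Rabs (f x - f y) <= M * Rabs (x - y)).
{ intros x y Hx Hy xy.
  destruct (MVT_cor2 f df x y xy) as [c [Hc c1]]; [intros; apply Hd; lra|].
  rewrite Rabs_minus_sym, Hc, Rabs_mult, (Rabs_minus_sym x).
  apply Rmult_le_compat_r; [apply Rabs_pos|apply HM; lra]. }
intros x y Hx Hy; destruct (Rtotal_order x y) as [l|[->|l]]; auto.
- unfold Rminus; rewrite !Rplus_opp_r, Rabs_R0; lra.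
- rewrite Rabs_minus_sym, (Rabs_minus_sym x); auto.
Qed.

(** * Analytic functions and power series *)

Lemma CV_radius_geom a A K x : 0 < K ->
  (forall n, Rabs (a n) <= A * K ^ n) -> Rabs x < / K ->
  Rbar_lt (Rabs x) (CV_radius a).
Proof.
intros K0 Ha Hx.
apply Rbar_lt_le_trans with (Finite (/ K)); [exact Hx|].
destruct (CV_radius_bounded a) as [H _]; apply H.
exists A; intros n; rewrite Rabs_mult, <- RPow_abs, (Rabs_pos_eq (/ K)).
- specialize (Ha n); assert (0 < / K) by now apply Rinv_0_lt_compat.
  assert (P : 0 < (/ K) ^ n) by now apply pow_lt.
  apply Rle_trans with (A * K ^ n * (/ K) ^ n); [apply Rmult_le_compat_r; lra|].
  rewrite Rmult_assoc, <- Rpow_mult_distr, Rinv_r, pow1; lra.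
- left; now apply Rinv_0_lt_compat.
Qed.

(** At half the guaranteed radius the terms are dominated by [A / 2^n], whence the factor 2. *)
Lemma PSeries_geom_bound a A K x : 0 < K ->
  (forall n, Rabs (a n) <= A * K ^ n) -> Rabs x <= / (2 * K) ->
  Rabs (PSeries a x) <= 2 * A.
Proof.
intros K0 Ha Hx.
assert (A0 : 0 <= A) by (specialize (Ha 0%nat); simpl in Ha; assert (B := Rabs_pos (a 0%nat)); lra).
assert (G : is_series (fun n => A * (/ 2) ^ n) (2 * A)).
{ replace (2 * A) with (A * / (1 - / 2)) by field.
  apply (is_series_scal (V := R_NormedModule) A (fun n => (/ 2) ^ n)), is_series_geom.
  rewrite Rabs_pos_eq; lra. }
assert (B : forall n, 0 <= Rabs (a n * x ^ n) <= A * (/ 2) ^ n).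
{ intros n; split; [apply Rabs_pos|].
  rewrite Rabs_mult, <- RPow_abs.
  apply Rle_trans with (A * K ^ n * (/ (2 * K)) ^ n).
  - apply Rmult_le_compat; auto using Rabs_pos, pow_le.
    apply pow_incr; split; auto using Rabs_pos.
  - rewrite Rmult_assoc, <- Rpow_mult_distr; right; do 2 f_equal; field; lra. }
unfold PSeries; eapply Rle_trans; [apply Series_Rabs|].
- apply @ex_series_le with (b := fun n => A * (/ 2) ^ n); [|now exists (2 * A)].
  intros n; unfold norm; simpl; unfold abs; simpl; rewrite Rabs_Rabsolu; apply B.
- rewrite <- (is_series_unique _ _ G); apply Series_le; [exact B|now exists (2 * A)].
Qed.

(** The ratio is a binomial coefficient; the induction is Pascal's rule. *)
Lemma fact_ratio_le k n :
  INR (fact (k + n)) / (INR (fact k) * INR (fact n)) <= 2 ^ (k + n).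
Proof.
remember (k + n)%nat as N eqn:E; revert k n E.
induction N as [|N IH]; intros k n E.
- replace k with 0%nat by lia; replace n with 0%nat by lia; simpl; lra.
- assert (P := INR_fact_lt_0).
  assert (Q : 1 <= 2 ^ N) by (apply pow_R1_Rle; lra).
  destruct k as [|k]; [simpl in E; subst n; replace (INR (fact 0)) with 1 by reflexivity|].
    specialize (P (S N)); simpl pow; field_simplify (INR (fact (S N)) / (1 * INR (fact (S N)))); lra.
  destruct n as [|n].
    replace (S k) with (S N) by lia; replace (INR (fact 0)) with 1 by reflexivity.
    specialize (P (S N)); simpl pow; field_simplify (INR (fact (S N)) / (INR (fact (S N)) * 1)); lra.
  assert (H1 := IH k (S n)); assert (H2 := IH (S k) n).
  specialize (H1 ltac:(lia)); specialize (H2 ltac:(lia)).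
  assert (HN : INR (S N) = INR (S k) + INR (S n)) by (rewrite <- plus_INR; f_equal; lia).
  rewrite fact_simpl, mult_INR, HN.
  replace ((INR (S k) + INR (S n)) * INR (fact N) / (INR (fact (S k)) * INR (fact (S n))))
    with (INR (fact N) / (INR (fact k) * INR (fact (S n))) + INR (fact N) / (INR (fact (S k)) * INR (fact n))).
    simpl pow; lra.
  rewrite (fact_simpl k), (fact_simpl n), !mult_INR.
  assert (Pk := P k); assert (Pn := P n).
  assert (0 < INR (S k)) by (apply lt_0_INR; lia).
  assert (0 < INR (S n)) by (apply lt_0_INR; lia).
  field; repeat split; lra.
Qed.

(** By the binomial bound the differentiated series has coefficients at most [n! A (2K)^n (2K)^k]:
    [2 K] takes the place of [K], and the radius shrinks accordingly. *)
Lemma Derive_n_PSeries_bound a A K n x : 0 < K ->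
  (forall n, Rabs (a n) <= A * K ^ n) -> Rabs x < / (4 * K) ->
  Rabs (Derive_n (PSeries a) n x) <= INR (fact n) * (2 * (A * (2 * K) ^ n)).
Proof.
intros K0 Ha Hx.
assert (A0 : 0 <= A) by (specialize (Ha 0%nat); simpl in Ha; assert (B := Rabs_pos (a 0%nat)); lra).
assert (K1 : / (4 * K) < / K) by (apply Rinv_lt_contravar; nra).
rewrite Derive_n_PSeries; [|apply (CV_radius_geom a A K); auto; lra].
replace (INR (fact n) * (2 * (A * (2 * K) ^ n))) with (2 * (INR (fact n) * A * (2 * K) ^ n)) by ring.
apply PSeries_geom_bound with (2 * K); [lra| |left; replace (2 * (2 * K)) with (4 * K) by ring; auto].
intros k; unfold PS_derive_n.
assert (Pk := INR_fact_lt_0 k). assert (Pn := INR_fact_lt_0 n).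
rewrite Rabs_mult, Rabs_pos_eq.
2: apply Rmult_le_pos; [apply pos_INR|left; now apply Rinv_0_lt_compat].
apply Rle_trans with (INR (fact n) * 2 ^ (k + n) * (A * K ^ (k + n))).
- apply Rmult_le_compat; auto using Rabs_pos.
    apply Rmult_le_pos; [apply pos_INR|left; now apply Rinv_0_lt_compat].
  assert (F := fact_ratio_le k n).
  replace (INR (fact (k + n)) / INR (fact k)) with
    (INR (fact n) * (INR (fact (k + n)) / (INR (fact k) * INR (fact n)))) by (field; lra).
  apply Rmult_le_compat_l; lra.
- right; rewrite !pow_add, !Rpow_mult_distr; ring.
Qed.

(** For [y < x] the function is reflected to [h t = f (- t)]; the signs [(-1)^m] of the derivatives
    and of the powers cancel. *)
Lemma Taylor_Lagrange_sym f n d x y : x <> y -> Rabs x < d -> Rabs y < d ->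
  (forall t k, Rabs t < d -> ex_derive_n f k t) ->
  exists z, Rabs z < d /\
    f y = sum_f_R0 (fun m => (y - x) ^ m / INR (fact m) * Derive_n f m x) n
          + (y - x) ^ S n / INR (fact (S n)) * Derive_n f (S n) z.
Proof.
intros xy Hx Hy Hf; apply Rabs_def2 in Hx; apply Rabs_def2 in Hy.
destruct (Rtotal_order x y) as [l|[e|l]]; [|easy|].
- destruct (Taylor_Lagrange f n x y l) as [z [Hz E]].
    intros; apply Hf, Rabs_def1; lra.
  exists z; split; [apply Rabs_def1; lra|exact E].
- set (h := fun t => f (- t)).
  assert (L : forall t, Rabs t < d -> locally (- t) (fun s : R_UniformSpace => forall m k, (k <= m)%nat -> ex_derive_n f k s)).
  { intros t Ht; rewrite <- Rabs_Ropp in Ht.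
    assert (P : 0 < d - Rabs (- t)) by lra.
    exists (mkposreal _ P); intros s Hs m k _; apply Hf.
    unfold ball in Hs; simpl in Hs; unfold AbsRing_ball, abs, minus, plus, opp in Hs; simpl in Hs.
    replace s with ((s + - - t) + - t) by ring.
    eapply Rle_lt_trans; [apply Rabs_triang|]; lra. }
  destruct (Taylor_Lagrange h n (- x) (- y)) as [z [Hz E]]; [lra| |].
    intros t Ht k Hk; apply ex_derive_n_comp_opp.
    destruct (L t) as [e He]; [apply Rabs_def1; lra|].
    exists e; intros s Hs; apply (He s Hs).
  assert (DE : forall m t, Rabs t < d -> Derive_n h m t = (-1) ^ m * Derive_n f m (- t)).
  { intros m t Ht; apply Derive_n_comp_opp.
    destruct (L t Ht) as [e He]; exists e; intros s Hs; apply (He s Hs). }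
  assert (S : forall m, (- y - - x) ^ m = (-1) ^ m * (y - x) ^ m)
    by (intros m; rewrite <- Rpow_mult_distr; f_equal; ring).
  assert (O : forall m, (-1) ^ m * (-1) ^ m = 1)
    by (intros m; rewrite <- Rpow_mult_distr; replace (-1 * -1) with 1 by ring; apply pow1).
  exists (- z); split; [apply Rabs_def1; lra|].
  unfold h at 1 in E; rewrite Ropp_involutive in E; rewrite E; clear E.
  f_equal.
  + apply sum_eq; intros m _; rewrite S, DE, Ropp_involutive; [|apply Rabs_def1; lra].
    transitivity ((-1) ^ m * (-1) ^ m * ((y - x) ^ m / INR (fact m) * Derive_n f m x));
      [unfold Rdiv; ring|rewrite O; ring].
  + rewrite S, DE; [|apply Rabs_def1; lra].
    transitivity ((-1) ^ Datatypes.S n * (-1) ^ Datatypes.S n *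
      ((y - x) ^ Datatypes.S n / INR (fact (Datatypes.S n)) * Derive_n f (Datatypes.S n) (- z)));
      [unfold Rdiv; ring|rewrite O; ring].
Qed.

(** (S2) asks for an expansion about every point of an interval, not only about 0. The Taylor
    remainder at [x0] is at most [2 A (2 K d)^(n+1)], and [d = / (4 K)] makes the ratio 1/2. *)
Lemma PSeries_analytic_at a A K x0 : 0 < K ->
  (forall n, Rabs (a n) <= A * K ^ n) -> Rabs x0 < / (4 * K) ->
  analytic_at (PSeries a) x0.
Proof.
intros K0 Ha Hx.
assert (A0 : 0 <= A) by (specialize (Ha 0%nat); simpl in Ha; assert (B := Rabs_pos (a 0%nat)); lra).
assert (K1 : / (4 * K) < / K) by (apply Rinv_lt_contravar; nra).
set (d := / (4 * K)) in *.
exists (fun n => Derive_n (PSeries a) n x0 / INR (fact n)), (d - Rabs x0).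
split; [lra|]; intros x Hxx.
assert (Ax : Rabs x < d).
{ replace x with ((x - x0) + x0) by ring.
  eapply Rle_lt_trans; [apply Rabs_triang|]; lra. }
assert (B : forall n, Rabs (sum_f_R0 (fun m => Derive_n (PSeries a) m x0 / INR (fact m) * (x - x0) ^ m) n
                     - PSeries a x) <= 2 * A * (/ 2) ^ S n).
{ intros n; destruct (Req_dec x0 x) as [e|ne].
  - subst x0; replace (sum_f_R0 _ n) with (PSeries a x).
      unfold Rminus; rewrite Rplus_opp_r, Rabs_R0.
      apply Rmult_le_pos; [lra|apply pow_le; lra].
    clear; induction n as [|n IH]; simpl sum_f_R0; [simpl; field|].
    rewrite <- IH; ring.
  - destruct (Taylor_Lagrange_sym (PSeries a) n d x0 x ne) as [z [Hz E]]; auto.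
      intros t k Ht; apply ex_derive_n_PSeries, (CV_radius_geom a A K); auto; lra.
    rewrite E.
    replace (sum_f_R0 _ n) with
      (sum_f_R0 (fun m => (x - x0) ^ m / INR (fact m) * Derive_n (PSeries a) m x0) n)
      by (apply sum_eq; intros; unfold Rdiv; ring).
    match goal with |- Rabs (?s - (?s + ?t)) <= _ => replace (s - (s + t)) with (- t) by ring end.
    rewrite Rabs_Ropp, Rabs_mult.
    assert (F := Derive_n_PSeries_bound a A K (S n) z K0 Ha Hz).
    assert (P := INR_fact_lt_0 (S n)).
    unfold Rdiv at 1; rewrite Rabs_mult, (Rabs_pos_eq (/ _)); [|left; now apply Rinv_0_lt_compat].
    rewrite <- RPow_abs.
    apply Rle_trans with (d ^ S n * / INR (fact (S n)) * (INR (fact (S n)) * (2 * (A * (2 * K) ^ S n)))).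
    + apply Rmult_le_compat; auto using Rabs_pos.
        apply Rmult_le_pos; [apply pow_le, Rabs_pos|left; now apply Rinv_0_lt_compat].
      apply Rmult_le_compat_r; [left; now apply Rinv_0_lt_compat|].
      apply pow_incr; split; [apply Rabs_pos|]; assert (Q := Rabs_pos x0); lra.
    + right; transitivity (2 * A * (d ^ S n * (2 * K) ^ S n)); [field; lra|].
      rewrite <- Rpow_mult_distr; do 2 f_equal; unfold d; field; lra. }
intros e He.
destruct (pow_lt_1_zero (/ 2)) with (y := e / (2 * A + 1)) as [N HN].
  rewrite Rabs_pos_eq; lra. apply Rdiv_lt_0_compat; lra.
exists N; intros n Hn; unfold Rdist.
eapply Rle_lt_trans; [apply B|].
assert (C := HN (S n) ltac:(lia)); rewrite Rabs_pos_eq in C by (apply pow_le; lra).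
assert (0 < (/ 2) ^ S n) by (apply pow_lt; lra).
apply Rle_lt_trans with ((2 * A + 1) * (/ 2) ^ S n); [nra|].
apply (Rmult_lt_compat_l (2 * A + 1)) in C; [|lra].
replace ((2 * A + 1) * (e / (2 * A + 1))) with e in C by (field; lra); auto.
Qed.

(** Were the radius at most [|x|], the terms at the midpoint of [|x|] and [d] would not tend to 0,
    although the series converges there. *)
Lemma Pser_CV_radius c d (f : R -> R) : 0 < d ->
  (forall x, Rabs x < d -> Pser c x (f x)) ->
  forall x, Rabs x < d -> Rbar_lt (Rabs x) (CV_radius c).
Proof.
intros d0 H x Hx.
destruct (Rbar_lt_le_dec (Rabs x) (CV_radius c)) as [|n]; auto; exfalso.
set (y := (Rabs x + d) / 2).
assert (Py : 0 <= y) by (unfold y; assert (Q := Rabs_pos x); lra).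
apply (CV_disk_outside c y).
- eapply Rbar_le_lt_trans; [exact n|].
  change (Rabs x < Rabs y); rewrite (Rabs_pos_eq y Py); unfold y; lra.
- assert (E : is_pseries c y (f y)).
    apply is_pseries_Reals, H; rewrite (Rabs_pos_eq y Py); unfold y; lra.
  apply is_pseries_R in E. apply ex_series_lim_0; eexists; exact E.
Qed.

Lemma analytic_at_derivable f x0 : analytic_at f x0 ->
  exists df, (exists d, 0 < d /\
    forall x, Rabs (x - x0) < d -> derivable_pt_lim f x (df x)) /\ analytic_at df x0.
Proof.
intros (c & d & d0 & H).
assert (Hc : forall x, Rabs x < d -> Rbar_lt (Rabs x) (CV_radius c)).
{ apply (Pser_CV_radius c d (fun x => f (x0 + x))); auto.
  intros x Hx; specialize (H (x0 + x)); replace (x0 + x - x0) with x in H by ring; now apply H. }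
exists (fun x => PSeries (PS_derive c) (x - x0)); split.
- exists d; split; auto; intros x Hx.
  apply (dl_ext_loc (fun y => PSeries c (y - x0)) f x _ (d - Rabs (x - x0))); [lra| |].
  + intros y Hy; apply is_pseries_unique, is_pseries_Reals, H.
    replace (y - x0) with ((y - x) + (x - x0)) by ring.
    eapply Rle_lt_trans; [apply Rabs_triang|]; lra.
  + eapply dl_eq.
      apply (dl_comp (fun y => y - x0) (PSeries c)); [dl|].
      now apply is_derive_Reals, is_derive_PSeries, Hc.
    ring.
- exists (PS_derive c), d; split; auto; intros x Hx.
  apply is_pseries_Reals, PSeries_correct, CV_radius_inside.
  rewrite CV_radius_derive; now apply Hc.
Qed.

Lemma analytic_C2 f : analytic f -> exists f1 f2,
  (forall x, derivable_pt_lim f x (f1 x)) /\ (forall x, derivable_pt_lim f1 x (f2 x)).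
Proof.
intros H; exists (Derive f), (Derive (Derive f)).
assert (D : forall x, ex_derive f x).
{ intros x; destruct (analytic_at_derivable f x (H x)) as (df & (d & d0 & Hd) & _).
  exists (df x); apply is_derive_Reals, Hd; rewrite Rminus_diag, Rabs_R0; auto. }
split; intros x; apply is_derive_Reals, Derive_correct; auto.
destruct (analytic_at_derivable f x (H x)) as (df & (d & d0 & Hd) & A).
destruct (analytic_at_derivable df x A) as (ddf & (d' & d0' & Hd') & _).
apply (ex_derive_ext_loc df).
- exists (mkposreal d d0); intros y Hy; symmetry; apply is_derive_unique, is_derive_Reals, Hd, Hy.
- exists (ddf x); apply is_derive_Reals, Hd'; rewrite Rminus_diag, Rabs_R0; auto.
Qed.

(** Cauchy's estimate at half the radius: the terms of the convergent series at [d / 2] are bounded,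
    so [K = 2 / d] will do. *)
Lemma Pser_coef_geom_bound c d (f : R -> R) : 0 < d ->
  (forall x, Rabs x < d -> Pser c x (f x)) ->
  exists M K, 0 < M /\ 0 < K /\ / K < d /\ forall n, Rabs (c n) <= M * K ^ n.
Proof.
intros d0 H; set (y := d / 2).
assert (y0 : 0 < y) by (unfold y; lra).
assert (E : is_pseries c y (f y)) by (apply is_pseries_Reals, H; rewrite Rabs_pos_eq; unfold y; lra).
apply is_pseries_R in E.
assert (L : is_lim_seq (fun n => c n * y ^ n) 0) by (apply ex_series_lim_0; eexists; exact E).
destruct (maj_by_pos (fun n => c n * y ^ n)) as [M [M0 HM]].
  exists 0; now apply is_lim_seq_Reals.
exists M, (/ y); repeat split; auto.
- now apply Rinv_0_lt_compat.
- rewrite Rinv_inv; unfold y; lra.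
- intros n; specialize (HM n); rewrite Rabs_mult, (Rabs_pos_eq (y ^ n)) in HM by (apply pow_le; lra).
  assert (P : 0 < y ^ n) by now apply pow_lt.
  rewrite pow_inv; apply (Rmult_le_reg_r (y ^ n)); auto.
  rewrite Rmult_assoc, Rinv_l; lra.
Qed.

(** * Picard's theorem for planar Lipschitz fields *)

Lemma antiderivative_RInt f : (forall x, continuity_pt f x) ->
  forall x, derivable_pt_lim (fun t => RInt f 0 t) x (f x).
Proof.
intros H x; apply is_derive_Reals, (is_derive_RInt f (fun t => RInt f 0 t) 0).
- apply filter_forall; intros y; apply (@RInt_correct R_CompleteNormedModule), ex_RInt_continuous.
  intros z _; now apply continuity_pt_filterlim.
- now apply continuity_pt_filterlim.
Qed.

Lemma deriv_domination f df h dh T : 0 <= T ->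
  (forall t, 0 <= t <= T -> derivable_pt_lim f t (df t)) ->
  (forall t, 0 <= t <= T -> derivable_pt_lim h t (dh t)) ->
  (forall t, 0 <= t <= T -> Rabs (df t) <= dh t) ->
  f 0 = 0 -> 0 <= h 0 -> Rabs (f T) <= h T.
Proof.
intros T0 Df Dh Hb f0 h0.
assert (Hb' : forall t, 0 <= t <= T -> - dh t <= df t <= dh t).
{ intros t Ht; specialize (Hb t Ht); now apply Rabs_le_between. }
assert (A : h 0 - f 0 <= h T - f T).
{ apply (dl_nonneg_incr (fun t => h t - f t) (fun t => dh t - df t)); auto.
  - intros x Hx; apply dl_minus; auto.
  - intros x Hx; specialize (Hb' x Hx); lra. }
assert (B : h 0 + f 0 <= h T + f T).
{ apply (dl_nonneg_incr (fun t => h t + f t) (fun t => dh t + df t)); auto.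
  - intros x Hx; apply dl_plus; auto.
  - intros x Hx; specialize (Hb' x Hx); lra. }
apply Rabs_le_between; lra.
Qed.

Lemma Rmax_0_cont t : continuity_pt (fun s => Rmax s 0) t.
Proof.
apply continuity_pt_filterlim.
intros P [e He]; exists e; intros y Hy; apply He.
unfold ball in *; simpl in *; unfold AbsRing_ball, abs, minus, plus, opp in *; simpl in *.
eapply Rle_lt_trans; [|exact Hy].
unfold Rmax; destruct (Rle_dec y 0), (Rle_dec t 0); unfold Rabs; repeat destruct Rcase_abs; lra.
Qed.

Lemma half_pow_small c e : 0 <= c -> 0 < e ->
  exists N, forall n, (N <= n)%nat -> c * (/ 2) ^ n < e.
Proof.
intros c0 e0; destruct (pow_lt_1_zero (/ 2)) with (y := e / (c + 1)) as [N HN].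
  { rewrite Rabs_pos_eq; lra. }
  { apply Rdiv_lt_0_compat; lra. }
exists N; intros n Hn; assert (C := HN n Hn); rewrite Rabs_pos_eq in C by (apply pow_le; lra).
assert (0 < (/ 2) ^ n) by (apply pow_lt; lra).
apply (Rmult_lt_compat_l (c + 1)) in C; [|lra].
replace ((c + 1) * (e / (c + 1))) with e in C by (field; lra); nra.
Qed.

Section Picard.

(** A point of the plane is a function on [bool], and distances are taken in the supremum norm. *)
Variables (F : bool -> (bool -> R) -> R) (L : R) (x0 : bool -> R).
Hypothesis L0 : 0 < L.
Hypothesis FL : forall i a b d, (forall j, Rabs (a j - b j) <= d) ->
  Rabs (F i a - F i b) <= L * d.

(* The time is truncated at 0, so that the iterates are defined (and affine)
   for negative times too: this makes derivatives at 0 two-sided. *)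
Fixpoint picard_iter (n : nat) (i : bool) (t : R) : R :=
  match n with
  | O => x0 i
  | S m => x0 i + RInt (fun s => F i (fun j => picard_iter m j (Rmax s 0))) 0 t
  end.

Lemma field_cont (x : bool -> R -> R) t :
  (forall j s, continuity_pt (x j) s) ->
  forall i, continuity_pt (fun s => F i (fun j => x j (Rmax s 0))) t.
Proof.
intros Hx i e He.
assert (P : 0 < e / (2 * L)) by (apply Rdiv_lt_0_compat; lra).
assert (C : forall j, continuity_pt (fun s => x j (Rmax s 0)) t).
{ intros j; apply (continuity_pt_comp (fun s => Rmax s 0) (x j)); auto using Rmax_0_cont. }
destruct (cont_eps _ _ _ (C true) P) as [d1 [d10 H1]].
destruct (cont_eps _ _ _ (C false) P) as [d2 [d20 H2]].
exists (Rmin d1 d2); split; [now apply Rmin_glb_lt|].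
intros s [_ Hs]; simpl in *; unfold Rdist in *.
apply Rle_lt_trans with (L * (e / (2 * L))).
- apply FL; intros [|]; left; [apply H1|apply H2]; eapply Rlt_le_trans; eauto; [apply Rmin_l|apply Rmin_r].
- replace (L * (e / (2 * L))) with (e / 2) by (field; lra); lra.
Qed.

Lemma picard_iter_deriv n i t :
  derivable_pt_lim (picard_iter (S n) i) t
    (F i (fun j => picard_iter n j (Rmax t 0))).
Proof.
revert i t; induction n as [|n IH]; intros i t.
- eapply dl_eq; [apply dl_plus; [apply dl_const|apply antiderivative_RInt]|apply Rplus_0_l].
  intros x; apply (field_cont (picard_iter 0)); intros j s; apply (dl_cont (fun _ => x0 j) s 0), dl_const.
- eapply dl_eq; [apply dl_plus; [apply dl_const|apply antiderivative_RInt]|apply Rplus_0_l].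
  intros x; apply (field_cont (picard_iter (S n))); intros j s; eapply dl_cont, IH.
Qed.

Lemma picard_iter_0 n i : picard_iter n i 0 = x0 i.
Proof. destruct n; simpl; auto; rewrite RInt_point; unfold zero; simpl; ring. Qed.

Let C0 := (Rabs (F true x0) + Rabs (F false x0)) / (2 * L).

(** Bielecki's weight: the integral of [L exp (2 L s)] up to [t] is at most half of [exp (2 L t)],
    so the iteration contracts by 1/2 on the whole half-line at once. *)
Lemma picard_iter_step n i t : 0 <= t ->
  Rabs (picard_iter (S n) i t - picard_iter n i t) <= C0 * (/ 2) ^ n * exp (2 * L * t).
Proof.
revert i t; induction n as [|n IH]; intros i t Ht.
- apply (deriv_domination (fun s => picard_iter 1 i s - picard_iter 0 i s)
    (fun s => F i (fun j => x0 j) - 0)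
    (fun s => C0 * (/ 2) ^ 0 * exp (2 * L * s)) (fun s => 2 * L * C0 * exp (2 * L * s))); auto.
  + intros s Hs; apply dl_minus; [apply (picard_iter_deriv 0)|apply (dl_const (x0 i))].
  + intros s Hs; eapply dl_eq; [dl|simpl; ring].
  + intros s Hs; rewrite Rminus_0_r.
    assert (1 <= exp (2 * L * s)) by (assert (E := exp_ineq1_le (2 * L * s)); nra).
    assert (E : Rabs (F i (fun j => x0 j)) <= 2 * L * C0).
    { unfold C0; replace (2 * L * _) with (Rabs (F true x0) + Rabs (F false x0)) by (field; lra).
      change (fun j => x0 j) with x0.
      assert (A := Rabs_pos (F true x0)); assert (B := Rabs_pos (F false x0)); destruct i; lra. }
    assert (A := Rabs_pos (F i (fun j => x0 j))). nra.
  + rewrite !picard_iter_0; ring.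
  + rewrite Rmult_0_r, exp_0; unfold C0; simpl; rewrite !Rmult_1_r.
    apply Rdiv_le_0_compat; [|lra].
    assert (A := Rabs_pos (F true x0)); assert (B := Rabs_pos (F false x0)); lra.
- apply (deriv_domination (fun s => picard_iter (S (S n)) i s - picard_iter (S n) i s)
    (fun s => F i (fun j => picard_iter (S n) j (Rmax s 0)) - F i (fun j => picard_iter n j (Rmax s 0)))
    (fun s => C0 * (/ 2) ^ S n * exp (2 * L * s)) (fun s => L * (C0 * (/ 2) ^ n * exp (2 * L * s)))); auto.
  + intros s Hs; apply dl_minus; apply picard_iter_deriv.
  + intros s Hs; eapply dl_eq; [dl|simpl; field].
  + intros s Hs; apply FL; intros j; rewrite Rmax_left by lra; apply IH; lra.
  + rewrite !picard_iter_0; ring.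
  + apply Rmult_le_pos; [|left; apply exp_pos]. apply Rmult_le_pos; [|apply pow_le; lra].
    unfold C0; apply Rdiv_le_0_compat; [|lra].
    assert (A := Rabs_pos (F true x0)); assert (B := Rabs_pos (F false x0)); lra.
Qed.

(** For negative times the field is frozen at time 0, where all iterates equal [x0]. *)
Lemma picard_iter_neg n i t : t <= 0 -> picard_iter (S n) i t = picard_iter 1 i t.
Proof.
intros Ht.
assert (E : picard_iter (S n) i t - picard_iter 1 i t = picard_iter (S n) i 0 - picard_iter 1 i 0).
{ apply (dl_zero_const (fun s => picard_iter (S n) i s - picard_iter 1 i s)
    (fun s => F i (fun j => picard_iter n j (Rmax s 0)) - F i (fun j => picard_iter 0 j (Rmax s 0)))); auto.
  - intros s Hs; apply dl_minus; apply picard_iter_deriv.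
  - intros s Hs; rewrite Rmax_right by lra.
    assert (A : Rabs (F i (fun j => picard_iter n j 0) - F i (fun j => picard_iter 0 j 0)) <= L * 0).
      apply FL; intros j; rewrite !picard_iter_0, Rminus_diag, Rabs_R0; lra.
    assert (B := Rabs_pos (F i (fun j => picard_iter n j 0) - F i (fun j => picard_iter 0 j 0))).
    apply Rabs_eq_0; lra. }
rewrite !picard_iter_0 in E; lra.
Qed.

Lemma picard_iter_cauchy n p i t :
  Rabs (picard_iter (S (n + p)) i t - picard_iter (S n) i t)
    <= C0 * exp (2 * L * Rmax t 0) * (/ 2) ^ n.
Proof.
assert (P : 0 <= C0).
{ unfold C0; apply Rdiv_le_0_compat; [|lra].
  assert (A := Rabs_pos (F true x0)); assert (B := Rabs_pos (F false x0)); lra. }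
assert (Q := exp_pos (2 * L * Rmax t 0)).
assert (Q' : 0 < (/ 2) ^ n) by (apply pow_lt; lra).
destruct (Rle_or_lt t 0) as [Ht|Ht].
- rewrite (picard_iter_neg (n + p)), (picard_iter_neg n), Rminus_diag, Rabs_R0 by auto.
  apply Rmult_le_pos; [apply Rmult_le_pos|]; lra.
- rewrite Rmax_left in * by lra.
  apply Rle_trans with (C0 * exp (2 * L * t) * ((/ 2) ^ n - (/ 2) ^ (n + p))).
  + induction p as [|p IH].
      rewrite Nat.add_0_r, !Rminus_diag, Rabs_R0; lra.
    replace (n + S p)%nat with (S (n + p)) by lia.
    replace (picard_iter (S (S (n + p))) i t - picard_iter (S n) i t) with
      ((picard_iter (S (S (n + p))) i t - picard_iter (S (n + p)) i t) +
       (picard_iter (S (n + p)) i t - picard_iter (S n) i t)) by ring.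
    eapply Rle_trans; [apply Rabs_triang|].
    assert (S1 := picard_iter_step (S (n + p)) i t (Rlt_le _ _ Ht)).
    simpl pow in *; lra.
  + assert (0 < (/ 2) ^ (n + p)) by (apply pow_lt; lra).
    apply Rmult_le_compat_l; [apply Rmult_le_pos; lra|lra].
Qed.

Theorem picard : exists x : bool -> R -> R, forall i, x i 0 = x0 i /\
  forall t, 0 <= t -> derivable_pt_lim (x i) t (F i (fun j => x j t)).
Proof.
assert (P : 0 <= C0).
{ unfold C0; apply Rdiv_le_0_compat; [|lra].
  assert (A := Rabs_pos (F true x0)); assert (B := Rabs_pos (F false x0)); lra. }
set (x := fun i t => real (Lim_seq (fun n => picard_iter (S n) i t))).
assert (Cv : forall i t, Un_cv (fun n => picard_iter (S n) i t) (x i t)).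
{ intros i t; apply is_lim_seq_Reals, Lim_seq_correct', ex_lim_seq_cauchy_corr.
  intros e; assert (Q := exp_pos (2 * L * Rmax t 0)).
  destruct (half_pow_small (C0 * exp (2 * L * Rmax t 0) * 2) e) as [N HN].
    apply Rmult_le_pos; [apply Rmult_le_pos|]; lra. apply cond_pos.
  assert (D : forall n, (N <= n)%nat -> Rabs (picard_iter (S n) i t - picard_iter (S N) i t) < e / 2).
  { intros n Hn; replace n with (N + (n - N))%nat by lia.
    eapply Rle_lt_trans; [apply picard_iter_cauchy|].
    specialize (HN N (le_n N)); lra. }
  exists N; intros n m Hn Hm.
  replace (_ - _) with ((picard_iter (S n) i t - picard_iter (S N) i t) -
    (picard_iter (S m) i t - picard_iter (S N) i t)) by ring.
  assert (D1 := D n Hn); assert (D2 := D m Hm).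
  apply Rabs_def2 in D1; apply Rabs_def2 in D2; apply Rabs_def1; lra. }
assert (Bd : forall n i t, Rabs (x i t - picard_iter (S n) i t) <= C0 * exp (2 * L * Rmax t 0) * (/ 2) ^ n).
{ intros n i t; assert (H := Cv i t); apply is_lim_seq_Reals in H.
  apply (is_lim_seq_incr_n _ n) in H.
  assert (H' : is_lim_seq (fun p => Rabs (picard_iter (S (n + p)) i t - picard_iter (S n) i t))
                 (Rabs (x i t - picard_iter (S n) i t))).
  { apply (is_lim_seq_abs _ (Finite (x i t - picard_iter (S n) i t))).
    apply is_lim_seq_minus'; [|apply is_lim_seq_const].
    apply is_lim_seq_ext with (2 := H); intros p; f_equal; lia. }
  apply (is_lim_seq_le _ (fun _ => C0 * exp (2 * L * Rmax t 0) * (/ 2) ^ n) _ _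
    (fun p => picard_iter_cauchy n p i t) H' (is_lim_seq_const _)). }
assert (X0 : forall i, x i 0 = x0 i).
{ intros i; unfold x; rewrite (Lim_seq_ext _ (fun _ => x0 i)); [now rewrite Lim_seq_const|].
  intros n; apply picard_iter_0. }
exists x; intros i; split; auto.
intros t Ht.
set (h := fun s => F i (fun j => x j (Rmax s 0))).
replace (F i (fun j => x j t)) with (h t) by (unfold h; now rewrite Rmax_left).
(* The derivatives of the iterates converge uniformly on the unit ball about [t], where the weight
   is at most [exp (2 L (t + 1))]; hence differentiation passes to the limit. *)
assert (U : CVU (fun n s => F i (fun j => picard_iter (S n) j (Rmax s 0)))
              h t (mkposreal 1 Rlt_0_1)).
{ intros e He; assert (Q := exp_pos (2 * L * (t + 1))).
  destruct (half_pow_small (L * (C0 * exp (2 * L * (t + 1)))) e) as [N HN]; auto.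
    apply Rmult_le_pos; [|apply Rmult_le_pos]; lra.
  exists N; intros n s Hn Hs; unfold Boule in Hs; simpl in Hs; apply Rabs_def2 in Hs.
  eapply Rle_lt_trans; [|exact (HN n Hn)].
  rewrite Rmult_assoc; apply FL; intros j; eapply Rle_trans; [apply Bd|].
  apply Rmult_le_compat_r; [apply pow_le; lra|].
  apply Rmult_le_compat_l; auto.
  assert (E : 2 * L * Rmax (Rmax s 0) 0 <= 2 * L * (t + 1)).
  { apply Rmult_le_compat_l; [lra|]; repeat apply Rmax_lub; lra. }
  destruct E as [E|E]; [left; now apply exp_increasing|rewrite E; lra]. }
apply (Ranalysis5.derivable_pt_lim_CVU (fun n => picard_iter (S (S n)) i)
  (fun n s => F i (fun j => picard_iter (S n) j (Rmax s 0))) (x i) h t t (mkposreal 1 Rlt_0_1)); auto.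
- unfold Boule; rewrite Rminus_diag, Rabs_R0; simpl; lra.
- intros y n _; apply picard_iter_deriv.
- intros y _; apply is_lim_seq_Reals, (is_lim_seq_incr_1 (fun n => picard_iter (S n) i y)), is_lim_seq_Reals, Cv.
- intros y Hy; eapply CVU_continuity; [exact U| |exact Hy].
  intros n s _; apply (field_cont (picard_iter (S n))); intros j z; eapply dl_cont, picard_iter_deriv.
Qed.

End Picard.

(** * Majorants for coefficient recursions *)

(** After [m] iterations of [Phi] the values below [m] no longer change; the diagonal of the
    iterates is the fixed point. *)
Lemma causal_fixpoint (T : Type) (t0 : T) (Phi : (nat -> T) -> nat -> T) :
  (forall X Y n, (forall k, (k < n)%nat -> X k = Y k) -> Phi X n = Phi Y n) ->
  exists X, forall n, X n = Phi X n.
Proof.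
intros H; set (Y := fun m => Nat.iter m Phi (fun _ => t0)).
assert (A : forall m n, (n < m)%nat -> Y (S m) n = Y m n).
{ induction m as [|m IH]; intros n Hn; [lia|].
  apply (H (Y (S m)) (Y m)); intros k Hk; apply IH; lia. }
assert (B : forall n m, (n < m)%nat -> Y m n = Y (S n) n).
{ intros n m Hm; induction Hm as [|m Hm IH]; auto; rewrite A; auto; lia. }
exists (fun n => Y (S n) n); intros n; apply (H (Y n)).
intros k Hk; now apply B.
Qed.

(** The denominator makes the weight stable under Cauchy products up to a constant, which [K ^ k]
    alone is not, since its self-convolution carries a factor [k + 1]. *)
Definition weight (K : R) (k : nat) : R := K ^ k / (INR k + 1) ^ 2.

(** Bounding only the first [n] coefficients makes this an induction hypothesis along a
    recursion. *)
Definition majorized (K : R) (n : nat) (A : R) (a : nat -> R) : Prop :=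
  forall k, (k < n)%nat -> Rabs (a k) <= A * weight K k.

Lemma weight_pos K k : 0 < K -> 0 < weight K k.
Proof.
intros HK; apply Rdiv_lt_0_compat; [now apply pow_lt|].
assert (A := pos_INR k); apply pow_lt; lra.
Qed.

Lemma weight_le K k : 0 < K -> weight K k <= K ^ k.
Proof.
intros HK; unfold weight; assert (A := pos_INR k).
assert (B : 0 < K ^ k) by now apply pow_lt.
apply Rle_div_l; nra.
Qed.

Lemma majorized_geom K n A a : 0 < K -> majorized K n A a -> 0 <= A ->
  forall k, (k < n)%nat -> Rabs (a k) <= A * K ^ k.
Proof.
intros HK H A0 k Hk; eapply Rle_trans; [now apply H|].
apply Rmult_le_compat_l; auto; now apply weight_le.
Qed.

Lemma majorized_le K n A B a : 0 < K -> A <= B -> majorized K n A a -> majorized K n B a.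
Proof.
intros HK AB H k Hk; eapply Rle_trans; [now apply H|].
assert (P := weight_pos K k HK); apply Rmult_le_compat_r; lra.
Qed.

Lemma majorized_plus K n A B a b : majorized K n A a -> majorized K n B b ->
  majorized K n (A + B) (fun k => a k + b k).
Proof.
intros Ha Hb k Hk; specialize (Ha k Hk); specialize (Hb k Hk).
eapply Rle_trans; [apply Rabs_triang|]; lra.
Qed.

Lemma majorized_scal K n A c a : majorized K n A a ->
  majorized K n (Rabs c * A) (fun k => c * a k).
Proof.
intros Ha k Hk; specialize (Ha k Hk); rewrite Rabs_mult, Rmult_assoc.
apply Rmult_le_compat_l; auto using Rabs_pos.
Qed.

Definition shift (a : nat -> R) (n : nat) : R :=
  match n with O => 0 | S m => a m end.

(** A shift costs the ratio of consecutive weights, at most [4 / K] since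
    [((k + 2) / (k + 1))^2 <= 4], and reaches one coefficient further. This is the smallness that
    closes the recursion. *)
Lemma majorized_shift K n A a : 0 < K -> 0 <= A -> majorized K n A a ->
  majorized K (S n) (4 * A / K) (shift a).
Proof.
intros HK A0 H [|k] Hk; simpl.
- rewrite Rabs_R0; apply Rmult_le_pos; [|left; now apply weight_pos].
  apply Rdiv_le_0_compat; lra.
- assert (B := H k ltac:(lia)); eapply Rle_trans; [exact B|].
  unfold weight; rewrite S_INR; simpl pow.
  assert (P := pos_INR k); assert (Q : 0 < K ^ k) by now apply pow_lt.
  replace (4 * A / K * (K * K ^ k / ((INR k + 1 + 1) * ((INR k + 1 + 1) * 1))))
    with (A * (K ^ k * (4 / (INR k + 1 + 1) ^ 2))) by (field; lra).
  replace (A * (K ^ k / ((INR k + 1) * ((INR k + 1) * 1))))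
    with (A * (K ^ k * (1 / (INR k + 1) ^ 2))) by (field; lra).
  apply Rmult_le_compat_l; auto; apply Rmult_le_compat_l; [lra|].
  apply Rle_div_l; [nra|].
  replace (4 / (INR k + 1 + 1) ^ 2 * (INR k + 1) ^ 2) with ((4 * (INR k + 1) ^ 2) / (INR k + 1 + 1) ^ 2)
    by (field; lra).
  apply Rle_div_r; nra.
Qed.

(** Telescoping, from [1/(x+2)^2 <= 1/(x+1) - 1/(x+2)]. *)
Lemma sum_inv_sq n : sum_f_R0 (fun i => / (INR i + 1) ^ 2) n <= 2 - / (INR n + 1).
Proof.
induction n as [|n IH]; [simpl; lra|].
rewrite tech5; eapply Rle_trans; [apply Rplus_le_compat_r, IH|].
rewrite S_INR; assert (P := pos_INR n); set (x := INR n) in *.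
assert (/ (x + 1) - / (x + 1 + 1) = / ((x + 1) * (x + 1 + 1))) by (field; lra).
assert (/ (x + 1 + 1) ^ 2 <= / ((x + 1) * (x + 1 + 1))) by (apply Rinv_le_contravar; nra).
lra.
Qed.

Lemma sum_f_R0_reverse f n : sum_f_R0 (fun i => f (n - i)%nat) n = sum_f_R0 f n.
Proof.
induction n as [|n IH]; [reflexivity|].
rewrite (decomp_sum _ (S n)) by lia; rewrite tech5; simpl pred.
rewrite <- IH, Rplus_comm; f_equal.
Qed.

(* From 1/(ab) = (1/a + 1/b)/(a+b) with a = i+1, b = k-i+1. *)
Lemma sum_inv_sq_conv k :
  sum_f_R0 (fun i => / (INR i + 1) ^ 2 * / (INR (k - i) + 1) ^ 2) k <= 8 * / (INR k + 1) ^ 2.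
Proof.
assert (P := pos_INR k).
assert (Q : 0 < (INR k + 1) ^ 2) by (apply pow_lt; lra).
apply Rle_trans with (sum_f_R0 (fun i => (/ (INR i + 1) ^ 2 + / (INR (k - i) + 1) ^ 2) * (2 * / (INR k + 1) ^ 2)) k).
- apply sum_Rle; intros i Hi.
  rewrite minus_INR by auto; apply le_INR in Hi; assert (Pi := pos_INR i).
  set (a := INR i + 1); set (b := INR k - INR i + 1).
  assert (a0 : 1 <= a) by (unfold a; lra). assert (b0 : 1 <= b) by (unfold b; lra).
  assert (ab : a + b = INR k + 2) by (unfold a, b; ring).
  apply Rle_trans with ((/ a ^ 2 + / b ^ 2) * (2 * / (INR k + 2) ^ 2)).
  + rewrite <- ab.
    replace (/ a ^ 2 * / b ^ 2) with ((/ a + / b) ^ 2 * / (a + b) ^ 2) by (field; lra).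
    assert (0 < / (a + b) ^ 2) by (apply Rinv_0_lt_compat, pow_lt; lra).
    replace (/ a ^ 2) with ((/ a) ^ 2) by (field; lra).
    replace (/ b ^ 2) with ((/ b) ^ 2) by (field; lra).
    assert (H1 := Rle_0_sqr (/ a - / b)); unfold Rsqr in H1; nra.
  + apply Rmult_le_compat_l.
      assert (0 < / a ^ 2) by (apply Rinv_0_lt_compat, pow_lt; lra).
      assert (0 < / b ^ 2) by (apply Rinv_0_lt_compat, pow_lt; lra). lra.
    apply Rmult_le_compat_l; [lra|]; apply Rinv_le_contravar; auto; nra.
- rewrite <- scal_sum, plus_sum.
  rewrite (sum_f_R0_reverse (fun j => / (INR j + 1) ^ 2) k).
  assert (S1 := sum_inv_sq k).
  assert (0 < / (INR k + 1)) by (apply Rinv_0_lt_compat; lra).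
  assert (0 < / (INR k + 1) ^ 2) by (now apply Rinv_0_lt_compat). nra.
Qed.

Lemma majorized_mult K n A B a b : 0 < K -> 0 <= A -> 0 <= B ->
  majorized K n A a -> majorized K n B b -> majorized K n (8 * (A * B)) (PS_mult a b).
Proof.
intros HK A0 B0 Ha Hb k Hk; unfold PS_mult.
eapply Rle_trans; [apply sum_f_R0_triangle|].
apply Rle_trans with (sum_f_R0 (fun i => / (INR i + 1) ^ 2 * / (INR (k - i) + 1) ^ 2 * (A * B * K ^ k)) k).
- apply sum_Rle; intros i Hi.
  assert (H1 := Ha i ltac:(lia)); assert (H2 := Hb (k - i)%nat ltac:(lia)).
  rewrite Rabs_mult; eapply Rle_trans; [apply Rmult_le_compat; eauto using Rabs_pos|].
  right; unfold weight; replace (K ^ k) with (K ^ i * K ^ (k - i)) by (rewrite <- pow_add; f_equal; lia).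
  unfold Rdiv; ring.
- rewrite <- scal_sum; assert (S := sum_inv_sq_conv k).
  assert (0 <= A * B * K ^ k) by (apply Rmult_le_pos; [now apply Rmult_le_pos|left; now apply pow_lt]).
  unfold weight, Rdiv.
  replace (8 * (A * B) * (K ^ k * / (INR k + 1) ^ 2)) with (A * B * K ^ k * (8 * / (INR k + 1) ^ 2)) by ring.
  now apply Rmult_le_compat_l.
Qed.

(** Since [(k + 1)^2 <= 4^k], a base four times larger absorbs the denominator of the weight. *)
Lemma majorized_of_geom K K0 M c n : 0 <= M -> 0 < K0 -> 4 * K0 <= K ->
  (forall k, Rabs (c k) <= M * K0 ^ k) -> majorized K n M c.
Proof.
intros M0 K00 HK H k _; eapply Rle_trans; [apply H|].
apply Rmult_le_compat_l; auto; unfold weight.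
assert (P := pos_INR k).
apply Rle_div_r; [apply pow_lt; lra|].
apply Rle_trans with (4 ^ k * K0 ^ k).
- rewrite Rmult_comm; apply Rmult_le_compat_r; [left; now apply pow_lt|].
  replace 4 with (2 ^ 2) by ring; rewrite <- pow_mult, Nat.mul_comm, pow_mult.
  apply pow_incr; split; [lra|].
  clear; induction k as [|k IH]; [simpl; lra|]; rewrite S_INR; simpl pow.
  assert (1 <= 2 ^ k) by (apply pow_R1_Rle; lra); lra.
- rewrite <- Rpow_mult_distr; apply pow_incr; lra.
Qed.

Lemma is_pseries_plusR a b x la lb : is_pseries a x la -> is_pseries b x lb ->
  is_pseries (fun n => a n + b n) x (la + lb).
Proof. apply (@is_pseries_plus R_AbsRing R_NormedModule). Qed.

Lemma is_pseries_scalR c a x l : is_pseries a x l ->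
  is_pseries (fun n => c * a n) x (c * l).
Proof. intros H; apply (@is_pseries_scal R_AbsRing R_NormedModule); auto; apply Rmult_comm. Qed.

Lemma is_pseries_shiftR a x l : is_pseries a x l ->
  is_pseries (shift a) x (x * l).
Proof.
intros H; apply is_pseries_ext with (PS_incr_1 a); [now intros [|n]|].
now apply (@is_pseries_incr_1 R_AbsRing R_NormedModule).
Qed.

Lemma is_pseries_delta c x : is_pseries (fun n => match n with O => c | S _ => 0 end) x c.
Proof.
apply is_pseries_R; apply (is_series_ext (fun n => match n with O => c | S _ => 0 end)).
  intros [|n]; symmetry; [apply Rmult_1_r|apply Rmult_0_l].
apply is_series_Reals; intros e He; exists 0%nat; intros n _.
replace (sum_f_R0 _ n) with c; [unfold Rdist; rewrite Rminus_diag, Rabs_R0; auto|].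
clear; induction n as [|n IH]; [reflexivity|]; rewrite tech5, <- IH; symmetry; apply Rplus_0_r.
Qed.

Lemma majorized_radius K A a x : 0 < K -> 0 <= A -> (forall n, majorized K n A a) ->
  Rabs x < / K -> Rbar_lt (Rabs x) (CV_radius a).
Proof.
intros HK A0 H; apply (CV_radius_geom a A K); auto.
intros n; apply (majorized_geom K (S n)); auto.
Qed.

(** * The singular initial value problem *)

Lemma majorized_weaken K m n A a : (m <= n)%nat -> majorized K n A a -> majorized K m A a.
Proof. intros H Ha k Hk; apply Ha; lia. Qed.

Definition delta0 (c : R) (n : nat) : R := match n with O => c | S _ => 0 end.

Lemma majorized_delta0 K n c : 0 < K -> 0 <= c -> majorized K n c (delta0 c).
Proof.
intros HK c0 [|k] _; simpl.
- unfold weight; simpl; rewrite Rabs_pos_eq; lra.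
- rewrite Rabs_R0; apply Rmult_le_pos; auto; left; now apply weight_pos.
Qed.

(* Put eta = 1/3 + u z and G = 1 - u p. Then G^2 = 1 - u eta^2 and the equation
   for eta become
     p = 1/18 + u/2 (2/3 z + u z^2 + p^2),
     u z' + 5/4 z = -3/4 (u (z^2 + 2/3 z th + u z^2 th) + th/9),  th = beta g - p,
   which determine the coefficients of p and z recursively. *)
Definition prof_rhs (z p : nat -> R) (n : nat) : R :=
  2 / 3 * z n + (shift (PS_mult z z) n + PS_mult p p n).

Definition prof_step (z p : nat -> R) (n : nat) : R :=
  delta0 (1 / 18) n + / 2 * shift (prof_rhs z p) n.

Definition curv_rhs (beta : R) (c z p : nat -> R) (n : nat) : R :=
  let th := fun n => beta * c n + -1 * p n in
  PS_mult z z n + (2 / 3 * PS_mult z th n + shift (PS_mult (PS_mult z z) th) n).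

(** The term [th/9] involves [p n] itself; writing [prof_step z p n] for it leaves only earlier
    coefficients, so that the joint recursion is causal. *)
Definition curv_inner (beta : R) (c z p : nat -> R) (n : nat) : R :=
  shift (curv_rhs beta c z p) n + / 9 * (beta * c n + -1 * prof_step z p n).

(** [INR n + 5 / 4] is the multiplier of [z n] in [u z' + 5/4 z]. It never vanishes: there is no
    resonance. *)
Definition curv_step (beta : R) (c z p : nat -> R) (n : nat) : R :=
  - (3 / 4) / (INR n + 5 / 4) * curv_inner beta c z p n.

Lemma PS_mult_ext a b a' b' n :
  (forall k, (k <= n)%nat -> a k = a' k) -> (forall k, (k <= n)%nat -> b k = b' k) ->
  PS_mult a b n = PS_mult a' b' n.
Proof.
intros Ha Hb; apply sum_eq; intros i Hi; rewrite Ha, Hb; auto; lia.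
Qed.

Lemma shift_ext a b n : (forall k, (k < n)%nat -> a k = b k) -> shift a n = shift b n.
Proof. destruct n; simpl; auto. Qed.

Lemma prof_step_causal z p z' p' n :
  (forall k, (k < n)%nat -> z k = z' k) -> (forall k, (k < n)%nat -> p k = p' k) ->
  prof_step z p n = prof_step z' p' n.
Proof.
intros Hz Hp; unfold prof_step; f_equal; f_equal; apply shift_ext; intros k Hk.
unfold prof_rhs; rewrite Hz by auto; f_equal; f_equal.
- apply shift_ext; intros j Hj; apply PS_mult_ext; intros i Hi; apply Hz; lia.
- apply PS_mult_ext; intros i Hi; apply Hp; lia.
Qed.

Lemma curv_step_causal beta c z p z' p' n :
  (forall k, (k < n)%nat -> z k = z' k) -> (forall k, (k < n)%nat -> p k = p' k) ->
  curv_step beta c z p n = curv_step beta c z' p' n.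
Proof.
intros Hz Hp; unfold curv_step; f_equal; unfold curv_inner; f_equal.
- apply shift_ext; intros k Hk; unfold curv_rhs; f_equal; [|f_equal; [f_equal|]].
  + apply PS_mult_ext; intros i Hi; apply Hz; lia.
  + apply PS_mult_ext; intros i Hi; [apply Hz|f_equal; f_equal; apply Hp]; lia.
  + apply shift_ext; intros j Hj; apply PS_mult_ext; intros i Hi.
    * apply PS_mult_ext; intros l Hl; apply Hz; lia.
    * f_equal; f_equal; apply Hp; lia.
- now rewrite (prof_step_causal z p z' p').
Qed.

Lemma coefficients_exist beta c : exists z p,
  (forall n, z n = curv_step beta c z p n) /\ (forall n, p n = prof_step z p n).
Proof.
destruct (causal_fixpoint (R * R) (0, 0)
  (fun X n => (curv_step beta c (fun k => fst (X k)) (fun k => snd (X k)) n,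
               prof_step (fun k => fst (X k)) (fun k => snd (X k)) n))) as [X HX].
- intros X Y n H; f_equal; [apply curv_step_causal|apply prof_step_causal]; intros k Hk; now rewrite H.
- exists (fun k => fst (X k)), (fun k => snd (X k)); split; intros n; now rewrite HX at 1.
Qed.

(** Every nonlinear term carries a shift, hence a factor [/ K]. Only [1/18] and [th/9] do not, and
    they lie well below the claimed bounds 1 and [B * M + 1]; the constant 2400 leaves room for all
    the products. *)
Lemma coefficients_majorized B M K0 K c beta z p :
  0 <= beta <= B -> 0 < M -> 0 < K0 ->
  (forall n, Rabs (c n) <= M * K0 ^ n) -> 4 * K0 <= K -> 2400 * (B * M + 1) ^ 2 <= K ->
  (forall n, z n = curv_step beta c z p n) -> (forall n, p n = prof_step z p n) ->
  forall n, majorized K n (B * M + 1) z /\ majorized K n 1 p.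
Proof.
intros Hb M0 K00 Hc HK1 HK2 Ez Ep; set (N := B * M + 1) in *.
assert (N1 : 1 <= N) by (unfold N; nra).
assert (HK : 0 < K) by nra.
assert (NK : N ^ 2 / K <= / 2400) by (apply Rle_div_l; lra).
assert (N1' : 1 <= N ^ 2) by nra.
assert (iK : 0 < / K) by now apply Rinv_0_lt_compat.
assert (K1 : / K <= / 2400) by (apply Rinv_le_contravar; lra).
assert (Tc : forall n, majorized K n (B * M) (fun k => beta * c k)).
{ intros n; apply majorized_le with (Rabs beta * M); auto.
    rewrite Rabs_pos_eq; nra.
  apply majorized_scal; apply (majorized_of_geom K K0); auto; lra. }
induction n as [|n [Iz Ip]].
  split; intros k Hk; lia.
assert (Zz : majorized K n (8 * (N * N)) (PS_mult z z)) by (apply majorized_mult; auto; lra).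
assert (Pp : majorized K n (8 * (1 * 1)) (PS_mult p p)) by (apply majorized_mult; auto; lra).
(* [p] comes first, because [z n] depends on [prof_step z p n], that is on [p n]. *)
assert (Hp : majorized K (S n) 1 p).
{ assert (Q : majorized K n (9 * N ^ 2) (prof_rhs z p)).
  { apply majorized_le with (Rabs (2 / 3) * N + (4 * (8 * (N * N)) / K + 8 * (1 * 1))); auto.
    - rewrite Rabs_pos_eq by lra.
      replace (4 * (8 * (N * N)) / K) with (32 * (N ^ 2 / K)) by (field; lra). nra.
    - apply majorized_plus; [now apply majorized_scal|apply majorized_plus; auto].
      apply (majorized_weaken K n (S n)); [lia|]; apply majorized_shift; auto; nra. }
  assert (T : majorized K (S n) 1 (prof_step z p)).
  { apply majorized_le with (1 / 18 + Rabs (/ 2) * (4 * (9 * N ^ 2) / K)); auto.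
    - rewrite Rabs_pos_eq by lra.
      replace (4 * (9 * N ^ 2) / K) with (36 * (N ^ 2 / K)) by (field; lra). lra.
    - apply majorized_plus; [apply majorized_delta0; lra|].
      apply majorized_scal, majorized_shift; auto; nra. }
  intros k Hk; rewrite Ep; now apply T. }
split; auto.
set (th := fun k => beta * c k + -1 * p k).
assert (Th : majorized K n N th).
{ apply majorized_le with (B * M + Rabs (-1) * 1); auto.
    rewrite Rabs_left; unfold N; lra.
  apply majorized_plus; [apply Tc|now apply majorized_scal]. }
assert (Q : majorized K n (15 * N ^ 2) (curv_rhs beta c z p)).
{ apply majorized_le with (8 * (N * N) + (Rabs (2 / 3) * (8 * (N * N)) + 4 * (8 * (8 * (N * N) * N)) / K)); auto.
  - rewrite Rabs_pos_eq by lra.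
    replace (4 * (8 * (8 * (N * N) * N)) / K) with (256 * N * (N ^ 2 / K)) by (field; lra). nra.
  - apply majorized_plus; auto; apply majorized_plus.
      apply majorized_scal, majorized_mult; auto; lra.
    apply (majorized_weaken K n (S n)); [lia|]; apply majorized_shift; auto; [nra|].
    apply majorized_mult; auto; nra. }
assert (T : majorized K (S n) N (curv_inner beta c z p)).
{ apply majorized_le with (4 * (15 * N ^ 2) / K + Rabs (/ 9) * (B * M + Rabs (-1) * 1)); auto.
  - rewrite Rabs_pos_eq by lra. rewrite (Rabs_left (-1)) by lra.
    replace (4 * (15 * N ^ 2) / K) with (60 * (N ^ 2 / K)) by (field; lra). unfold N in *; lra.
  - apply majorized_plus; [apply majorized_shift; auto; nra|].
    apply majorized_scal, majorized_plus; [apply Tc|].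
    apply majorized_scal; intros k Hk; rewrite <- Ep; now apply Hp. }
intros k Hk; rewrite Ez; unfold curv_step; rewrite Rabs_mult.
specialize (T k Hk); assert (Pk := pos_INR k).
assert (Rabs (- (3 / 4) / (INR k + 5 / 4)) <= 1).
{ unfold Rdiv at 1; rewrite Rabs_mult, (Rabs_left (- (3 / 4))) by lra.
  rewrite Rabs_pos_eq by (left; apply Rinv_0_lt_compat; lra).
  apply Rle_div_l; lra. }
assert (P1 := Rabs_pos (curv_inner beta c z p k)). nra.
Qed.

(* In terms of [u = r^2], [G] is rho and [W] is w. *)
Definition local_solution (g : R -> R) (beta eps : R) (G W : R -> R) : Prop :=
  analytic_on G (- eps) eps /\ W 0 = 3 /\
  forall u, Rabs u < eps ->
    1 / 2 < G u /\ 2 < W u < 4 /\ G u ^ 2 = 1 - u / W u ^ 2 /\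
    beta * u * g u + G u < W u /\
    derivable_pt_lim G u (3 / 4 / (G u * W u ^ 2) * (-1 + (beta * u * g u + G u) / W u)) /\
    exists w', derivable_pt_lim W u w' /\
      u * w' = - W u / 4 + 3 / 4 * (beta * u * g u + G u).

Lemma local_solution_of_coefficients g c K0 M d B beta K z p :
  0 < M -> 0 < K0 -> / K0 < d -> (forall n, Rabs (c n) <= M * K0 ^ n) ->
  (forall u, Rabs u < d -> Pser c u (g u)) ->
  0 <= beta <= B -> 4 * K0 <= K -> 2400 * (B * M + 1) ^ 2 <= K ->
  (forall n, z n = curv_step beta c z p n) -> (forall n, p n = prof_step z p n) ->
  exists G W, local_solution g beta (/ (48 * (B * M + 1) * K)) G W.
Proof.
intros M0 K00 Kd Hc Hg Hb HK1 HK2 Ez Ep.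
assert (Mj := coefficients_majorized B M K0 K c beta z p Hb M0 K00 Hc HK1 HK2 Ez Ep).
set (N := B * M + 1) in *.
assert (N1 : 1 <= N) by (unfold N; nra).
assert (HK : 0 < K) by nra.
(* The sums of [z], [p] and [c] are at most [2 N], 2 and [2 M] in absolute value, so for [|u| < eps]
   each of [u z], [u p], [beta u g] is at most 1/24. This puts eta between 7/24 and 9/24, hence [W]
   between 2 and 4. *)
set (eps := / (48 * N * K)).
assert (NK : 1 <= N * K) by nra.
assert (e0 : 0 < eps) by (apply Rinv_0_lt_compat; nra).
assert (eN : eps * (48 * N) <= 1).
{ unfold eps; replace (/ (48 * N * K) * (48 * N)) with (/ K) by (field; nra).
  rewrite <- Rinv_1; apply Rinv_le_contravar; nra. }
assert (eK : eps <= / (4 * K)) by (apply Rinv_le_contravar; nra).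
assert (eK2 : / (4 * K) < / (2 * K)) by (apply Rinv_lt_contravar; nra).
assert (eK1 : / (2 * K) < / K) by (apply Rinv_lt_contravar; nra).
assert (eK0 : / (2 * K) <= / (2 * K0)) by (apply Rinv_le_contravar; nra).
assert (eK0' : / (2 * K0) < / K0) by (apply Rinv_lt_contravar; nra).
assert (Mz : forall n, majorized K n N z) by (intros n; apply Mj).
assert (Mp : forall n, majorized K n 1 p) by (intros n; apply Mj).
set (s := fun n => delta0 1 n + -1 * shift p n).
assert (Ms : forall n, majorized K (S n) (1 + Rabs (-1) * (4 * 1 / K)) s).
{ intros n; apply majorized_plus; [apply majorized_delta0; lra|].
  apply majorized_scal, majorized_shift; auto; lra. }
assert (As : 0 <= 1 + Rabs (-1) * (4 * 1 / K)).
{ assert (0 < 4 * 1 / K) by (apply Rdiv_lt_0_compat; lra). rewrite Rabs_left by lra; nra. }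
assert (Gs : forall n, Rabs (s n) <= (1 + Rabs (-1) * (4 * 1 / K)) * K ^ n).
{ intros n; apply (majorized_geom K (S n)); auto. }
assert (Gz : forall n, Rabs (z n) <= N * K ^ n) by (intros n; apply (majorized_geom K (S n)); auto; lra).
assert (Gp : forall n, Rabs (p n) <= 1 * K ^ n) by (intros n; apply (majorized_geom K (S n)); auto; lra).
set (zf := PSeries z); set (pf := PSeries p); set (G := PSeries s).
assert (Sz : forall u, Rabs u < / K -> is_pseries z u (zf u)).
{ intros u Hu; apply PSeries_correct, CV_radius_inside, (CV_radius_geom z N K); auto. }
assert (Sp : forall u, Rabs u < / K -> is_pseries p u (pf u)).
{ intros u Hu; apply PSeries_correct, CV_radius_inside, (CV_radius_geom p 1 K); auto. }
assert (EG : forall u, Rabs u < / K -> G u = 1 - u * pf u).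
{ intros u Hu; apply is_pseries_unique.
  replace (1 - u * pf u) with (1 + -1 * (u * pf u)) by ring.
  apply is_pseries_plusR; [apply is_pseries_delta|].
  apply is_pseries_scalR, is_pseries_shiftR; auto. }
set (W := fun u => / (1 / 3 + u * zf u)).
assert (Sg : forall u, Rabs u < / K -> is_pseries c u (g u)).
{ intros u Hu; apply is_pseries_Reals, Hg. assert (/ K <= / K0) by (apply Rinv_le_contravar; nra). lra. }
assert (Rz : forall u, Rabs u < / K -> Rbar_lt (Rabs u) (CV_radius z))
  by (intros u Hu; apply (CV_radius_geom z N K); auto).
assert (Rp : forall u, Rabs u < / K -> Rbar_lt (Rabs u) (CV_radius p))
  by (intros u Hu; apply (CV_radius_geom p 1 K); auto).
assert (Rzz : forall u, Rabs u < / K -> Rbar_lt (Rabs u) (CV_radius (PS_mult z z))).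
{ intros u Hu; apply (majorized_radius K (8 * (N * N))); auto; [nra|].
  intros n; apply majorized_mult; auto; lra. }
assert (Szz : forall u, Rabs u < / K -> is_pseries (PS_mult z z) u (zf u * zf u))
  by (intros u Hu; apply is_pseries_mult; auto).
(* p = eta^2/2 + u p^2/2, i.e. G^2 = 1 - u eta^2 *)
assert (Qp : forall u, Rabs u < / K ->
  pf u = 1 / 18 + / 2 * (u * (2 / 3 * zf u + (u * (zf u * zf u) + pf u * pf u)))).
{ intros u Hu; apply is_pseries_unique.
  apply is_pseries_ext with (prof_step z p); [intros n; now rewrite <- Ep|].
  apply is_pseries_plusR; [apply is_pseries_delta|].
  apply is_pseries_scalR, is_pseries_shiftR, is_pseries_plusR; [now apply is_pseries_scalR, Sz|].
  apply is_pseries_plusR; [now apply is_pseries_shiftR, Szz|].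
  apply is_pseries_mult; auto. }
set (th := fun n => beta * c n + -1 * p n).
assert (Mth : forall n, majorized K n N th).
{ intros n; apply majorized_le with (Rabs beta * M + Rabs (-1) * 1); auto.
    rewrite (Rabs_left (-1)), Rabs_pos_eq; unfold N; nra.
  apply majorized_plus; apply majorized_scal; auto.
  apply (majorized_of_geom K K0); auto; lra. }
assert (Rth : forall u, Rabs u < / K -> Rbar_lt (Rabs u) (CV_radius th)).
{ intros u Hu; apply (majorized_radius K N); auto; lra. }
set (tf := fun u => beta * g u + -1 * pf u).
assert (Sth : forall u, Rabs u < / K -> is_pseries th u (tf u)).
{ intros u Hu; apply is_pseries_plusR; apply is_pseries_scalR; auto. }
set (zd := PSeries (PS_derive z)).
assert (Dz : forall u, Rabs u < / K -> derivable_pt_lim zf u (zd u)).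
{ intros u Hu; apply is_derive_Reals, is_derive_PSeries; auto. }
assert (Qz : forall u, Rabs u < / K ->
  u * zd u + 5 / 4 * zf u = - (3 / 4) * (u * (zf u * zf u + (2 / 3 * (zf u * tf u)
     + u * (zf u * zf u * tf u))) + / 9 * tf u)).
{ intros u Hu.
  (* The left side has the coefficients [(n + 5/4) z n], which the recursion prescribes. *)
  assert (L : is_pseries (fun n => - (3 / 4) * curv_inner beta c z p n) u (u * zd u + 5 / 4 * zf u)).
  { apply is_pseries_ext with (fun n => shift (PS_derive z) n + 5 / 4 * z n).
    - intros n; assert (Pn := pos_INR n).
      assert (E : shift (PS_derive z) n = INR n * z n).
      { destruct n as [|n]; simpl shift; [simpl; ring|reflexivity]. }
      rewrite E; enough (F : - (3 / 4) * curv_inner beta c z p n = INR n * z n + 5 / 4 * z n) by (symmetry; exact F).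
      rewrite Ez; unfold curv_step; field; lra.
    - apply is_pseries_plusR; [apply is_pseries_shiftR|now apply is_pseries_scalR, Sz].
      apply PSeries_correct, CV_radius_inside; rewrite CV_radius_derive; auto. }
  apply is_pseries_unique in L; rewrite <- L; apply is_pseries_unique, is_pseries_scalR.
  apply is_pseries_plusR.
  - apply is_pseries_shiftR, is_pseries_plusR; auto.
    apply is_pseries_plusR; [apply is_pseries_scalR; apply is_pseries_mult; auto|].
    apply is_pseries_shiftR; apply is_pseries_mult; auto.
  - apply is_pseries_scalR; apply is_pseries_ext with th; auto.
    intros n; unfold th; now rewrite (Ep n) at 1. }
exists G, W; split; [|split].
- intros x Hx; apply (PSeries_analytic_at s _ K _ HK Gs).
  apply Rlt_le_trans with eps; auto; apply Rabs_def1; lra.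
- unfold W; rewrite Rmult_0_l; field.
- intros u Hu.
  assert (HuK : Rabs u < / K) by lra.
  assert (Bz : Rabs (zf u) <= 2 * N) by (apply (PSeries_geom_bound z N K); auto; lra).
  assert (Bp : Rabs (pf u) <= 2 * 1) by (apply (PSeries_geom_bound p 1 K); auto; lra).
  assert (Bg : Rabs (g u) <= 2 * M).
  { rewrite <- (is_pseries_unique _ _ _ (Sg u HuK)); apply (PSeries_geom_bound c M K0); auto; lra. }
  assert (Pu := Rabs_pos u).
  assert (Buz : Rabs (u * zf u) <= 1 / 24).
  { rewrite Rabs_mult; assert (Q := Rabs_pos (zf u)). nra. }
  assert (Bup : Rabs (u * pf u) <= 1 / 24).
  { rewrite Rabs_mult; assert (Q := Rabs_pos (pf u)). nra. }
  assert (Bug : Rabs (beta * u * g u) <= 1 / 24).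
  { rewrite !Rabs_mult, (Rabs_pos_eq beta) by lra; assert (Q := Rabs_pos (g u)).
    apply Rle_trans with (beta * eps * (2 * M)).
    - apply Rmult_le_compat; auto; [apply Rmult_le_pos; lra|].
      apply Rmult_le_compat_l; lra.
    - assert (beta * M <= N) by (unfold N; nra). nra. }
  apply Rabs_le_between in Buz; apply Rabs_le_between in Bup; apply Rabs_le_between in Bug.
  assert (GE := EG u HuK).
  set (eta := 1 / 3 + u * zf u) in *.
  assert (He : 7 / 24 <= eta <= 9 / 24) by (unfold eta; lra).
  assert (WE : W u = / eta) by reflexivity.
  assert (HW : 2 < W u < 4).
  { rewrite WE; split.
    - apply Rlt_le_trans with (/ (9 / 24)); [lra|apply Rinv_le_contravar; lra].
    - apply Rle_lt_trans with (/ (7 / 24)); [apply Rinv_le_contravar; lra|lra]. }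
  assert (G2 : forall v, Rabs v < eps -> G v ^ 2 = 1 - v * (1 / 3 + v * zf v) ^ 2).
  { intros v Hv; rewrite EG by lra; assert (Q := Qp v); specialize (Q ltac:(lra)).
    assert (Q2 : 2 * pf v = (1 / 3 + v * zf v) ^ 2 + v * pf v ^ 2) by lra.
    replace ((1 - v * pf v) ^ 2) with (1 - v * (2 * pf v - v * pf v ^ 2)) by ring.
    do 2 f_equal; lra. }
  assert (Hd : derivable_pt_lim (fun v => 1 / 3 + v * zf v) u (zf u + u * zd u)).
  { assert (Dzu := Dz u HuK); eapply dl_eq; [dl|cbv beta; ring]. }
  set (w' := - (zf u + u * zd u) / eta ^ 2).
  assert (HDW : derivable_pt_lim W u w').
  { apply (dl_inv (fun v => 1 / 3 + v * zf v)); auto; fold eta; lra. }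
  assert (HW' : u * w' = - W u / 4 + 3 / 4 * (beta * u * g u + G u)).
  { rewrite WE, GE; unfold w'.
    assert (Q := Qz u HuK); unfold tf in Q.
    assert (Q' : u * (zf u + u * zd u) = eta / 4 - 3 / 4 * eta ^ 2 * (beta * u * g u + (1 - u * pf u))).
    { replace (u * (zf u + u * zd u)) with (u * (u * zd u + 5 / 4 * zf u) - u * zf u / 4) by field.
      rewrite Q; unfold eta; field. }
    replace (u * (- (zf u + u * zd u) / eta ^ 2)) with (- (u * (zf u + u * zd u)) / eta ^ 2) by (field; lra).
    rewrite Q'; field; lra. }
  assert (EGu : G u ^ 2 = 1 - u / W u ^ 2).
  { rewrite G2, WE by auto; fold eta; field; lra. }
  split; [rewrite GE; lra|]; split; auto; split; auto; split; [rewrite GE; lra|].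
  split; [|now exists w'].
  (* The value of the derivative comes from differentiating [G^2 = 1 - u eta^2], with [u eta'] taken
     from the equation for [W]. Nothing is divided by [u], so the formula holds at [u = 0] too. *)
  assert (DG : exists l, derivable_pt_lim G u l).
  { exists (PSeries (PS_derive s) u); apply is_derive_Reals, is_derive_PSeries.
    apply (CV_radius_geom s _ K u HK Gs); auto. }
  destruct DG as [l Hl]; apply (dl_eq _ _ _ _ Hl).
  assert (A1 : derivable_pt_lim (fun v => G v ^ 2) u (2 * G u * l)).
  { eapply dl_eq; [dl|simpl; ring]. }
  assert (A2 : derivable_pt_lim (fun v => 1 - v * (1 / 3 + v * zf v) ^ 2) u
                 (- (eta ^ 2 + 2 * u * eta * (zf u + u * zd u)))).
  { eapply dl_eq; [apply dl_minus; [apply dl_const|apply dl_mult; [apply dl_id|apply dl_pow; exact Hd]]|].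
    simpl; fold eta; ring. }
  assert (A3 : 2 * G u * l = - (eta ^ 2 + 2 * u * eta * (zf u + u * zd u))).
  { apply (dl_unique (fun v => 1 - v * (1 / 3 + v * zf v) ^ 2) u); auto.
    apply (dl_ext_loc (fun v => G v ^ 2) _ u _ (eps - Rabs u)); auto; [lra|].
    intros y Hy; apply G2; replace y with ((y - u) + u) by ring.
    eapply Rle_lt_trans; [apply Rabs_triang|]; lra. }
  assert (A4 : u * (zf u + u * zd u) = - eta ^ 2 * (u * w')) by (unfold w'; field; lra).
  rewrite HW', WE in A4.
  assert (G0 : G u <> 0) by (rewrite GE; lra).
  assert (A5 : l = - (eta ^ 2 + 2 * eta * (u * (zf u + u * zd u))) / (2 * G u)).
  { rewrite <- (Rmult_1_l l), <- (Rinv_l (2 * G u)), Rmult_assoc by lra.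
    rewrite A3; field; auto. }
  rewrite A5, A4, WE; field; repeat split; auto; lra.
Qed.

(** [K], and with it [eps], depends on [beta] only through its bound [B]; one interval serves all
    parameters. *)
Theorem local_solution_exists g B : analytic g -> 0 <= B ->
  exists eps, 0 < eps <= / 48 /\
    forall beta, 0 <= beta <= B -> exists G W, local_solution g beta eps G W.
Proof.
intros Hg B0; destruct (Hg 0) as (c & d & d0 & H).
assert (H' : forall u, Rabs u < d -> Pser c u (g u)).
{ intros u Hu; specialize (H u); rewrite Rminus_0_r in H; auto. }
destruct (Pser_coef_geom_bound c d g d0 H') as (M & K0 & M0 & K00 & Kd & Hc).
set (K := Rmax (4 * K0) (2400 * (B * M + 1) ^ 2)).
assert (HK1 : 4 * K0 <= K) by apply Rmax_l.
assert (HK2 : 2400 * (B * M + 1) ^ 2 <= K) by apply Rmax_r.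
assert (N1 : 1 <= B * M + 1) by nra.
assert (1 <= (B * M + 1) * K) by nra.
exists (/ (48 * (B * M + 1) * K)); split.
- split; [apply Rinv_0_lt_compat; nra|apply Rinv_le_contravar; lra].
- intros beta Hb; destruct (coefficients_exist beta c) as (z & p & Ez & Ep).
  apply (local_solution_of_coefficients g c K0 M d B beta K z p); auto.
Qed.

(** * The regularised planar flow *)

Definition clamp (a b x : R) : R := Rmax a (Rmin b x).

Lemma clamp_bounds a b x : a <= b -> a <= clamp a b x <= b.
Proof.
intros ab; split; [apply Rmax_l|]; apply Rmax_lub; auto; apply Rmin_l.
Qed.

Lemma clamp_id a b x : a <= x <= b -> clamp a b x = x.
Proof. intros H; unfold clamp; rewrite Rmin_right, Rmax_right; lra. Qed.

Lemma clamp_above a b x : a <= b -> b <= x -> clamp a b x = b.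
Proof. intros H H'; unfold clamp; rewrite Rmin_left, Rmax_right; lra. Qed.

Lemma clamp_lip a b x y : Rabs (clamp a b x - clamp a b y) <= Rabs (x - y).
Proof.
unfold clamp, Rmax, Rmin.
repeat destruct Rle_dec; unfold Rabs; repeat destruct Rcase_abs; lra.
Qed.

(* The quantity E of the header; it has the sign of [rho']. *)
Definition excess (g : R -> R) (beta rho r : R) : R :=
  -1 + sqrt (1 - rho ^ 2) * (beta * r ^ 2 * g (r ^ 2) + rho) / r.

Lemma rho_rhs_excess g beta rho r :
  rho_rhs g beta rho r = 3 / 2 * ((1 - rho ^ 2) / r) * excess g beta rho r.
Proof. reflexivity. Qed.

(** * Lipschitz estimates on a box *)

Section BoundedLipschitz.

Variables (B c r0 R1 : R).

Definition in_box (b x r : R) : Prop := 0 <= b <= B /\ - c <= x <= c /\ r0 <= r <= R1.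

(** One constant bounds both the values and the Lipschitz quotient, which makes the class closed
    under products. The parameter counts as a variable, in view of the dependence on [beta]. *)
Definition bounded_lipschitz (M : R) (h : R -> R -> R -> R) : Prop :=
  0 <= M /\ (forall b x r, in_box b x r -> Rabs (h b x r) <= M) /\
  (forall b x r b' x' r', in_box b x r -> in_box b' x' r' ->
    Rabs (h b x r - h b' x' r') <= M * (Rabs (b - b') + Rabs (x - x') + Rabs (r - r'))).

Lemma bl_const k : bounded_lipschitz (Rabs k) (fun _ _ _ => k).
Proof.
split; [apply Rabs_pos|split]; intros; [lra|].
rewrite Rminus_diag, Rabs_R0; apply Rmult_le_pos; [apply Rabs_pos|].
assert (A1 := Rabs_pos (b - b')); assert (A2 := Rabs_pos (x - x')); assert (A3 := Rabs_pos (r - r')); lra.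
Qed.

Lemma bl_plus M N f h : bounded_lipschitz M f -> bounded_lipschitz N h ->
  bounded_lipschitz (M + N) (fun b x r => f b x r + h b x r).
Proof.
intros (M0 & B1 & L1) (N0 & B2 & L2); split; [lra|split].
- intros b x r H; eapply Rle_trans; [apply Rabs_triang|]; specialize (B1 _ _ _ H); specialize (B2 _ _ _ H); lra.
- intros b x r b' x' r' H H'; specialize (L1 _ _ _ _ _ _ H H'); specialize (L2 _ _ _ _ _ _ H H').
  replace (_ - _) with ((f b x r - f b' x' r') + (h b x r - h b' x' r')) by ring.
  eapply Rle_trans; [apply Rabs_triang|]; lra.
Qed.

Lemma bl_mult M N f h : bounded_lipschitz M f -> bounded_lipschitz N h ->
  bounded_lipschitz (2 * (M * N) + M * N) (fun b x r => f b x r * h b x r).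
Proof.
intros (M0 & B1 & L1) (N0 & B2 & L2).
assert (MN : 0 <= M * N) by now apply Rmult_le_pos.
split; [lra|split].
- intros b x r H; rewrite Rabs_mult; apply Rle_trans with (M * N); [|lra].
  apply Rmult_le_compat; auto using Rabs_pos.
- intros b x r b' x' r' H H'; specialize (L1 _ _ _ _ _ _ H H'); specialize (L2 _ _ _ _ _ _ H H').
  specialize (B1 _ _ _ H'); specialize (B2 _ _ _ H).
  replace (_ - _) with ((f b x r - f b' x' r') * h b x r + f b' x' r' * (h b x r - h b' x' r')) by ring.
  set (d := Rabs (b - b') + Rabs (x - x') + Rabs (r - r')) in *.
  assert (d0 : 0 <= d).
  { unfold d; assert (A1 := Rabs_pos (b - b')); assert (A2 := Rabs_pos (x - x')); assert (A3 := Rabs_pos (r - r')); lra. }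
  eapply Rle_trans; [apply Rabs_triang|]; rewrite !Rabs_mult.
  assert (Rabs (f b x r - f b' x' r') * Rabs (h b x r) <= M * d * N) by (apply Rmult_le_compat; auto using Rabs_pos).
  assert (Rabs (f b' x' r') * Rabs (h b x r - h b' x' r') <= M * (N * d)) by (apply Rmult_le_compat; auto using Rabs_pos).
  assert (0 <= M * N * d) by now apply Rmult_le_pos. nra.
Qed.

Lemma bl_param : 0 <= B -> bounded_lipschitz (B + 1) (fun b _ _ => b).
Proof.
intros B0; split; [lra|split]; intros.
- destruct H as (H & _); rewrite Rabs_pos_eq; lra.
- assert (A1 := Rabs_pos (b - b')); assert (A2 := Rabs_pos (x - x')); assert (A3 := Rabs_pos (r - r')); nra.
Qed.

Lemma bl_fst f M N : 0 <= M -> 0 <= N -> (forall x, - c <= x <= c -> Rabs (f x) <= M) ->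
  (forall x y, - c <= x <= c -> - c <= y <= c -> Rabs (f x - f y) <= N * Rabs (x - y)) ->
  bounded_lipschitz (M + N) (fun _ x _ => f x).
Proof.
intros M0 N0 HM HN; split; [lra|split].
- intros b x r (_ & H & _); specialize (HM x H); lra.
- intros b x r b' x' r' (_ & H & _) (_ & H' & _); specialize (HN x x' H H').
  assert (A1 := Rabs_pos (b - b')); assert (A2 := Rabs_pos (x - x')); assert (A3 := Rabs_pos (r - r')); nra.
Qed.

Lemma bl_snd f M N : 0 <= M -> 0 <= N -> (forall x, r0 <= x <= R1 -> Rabs (f x) <= M) ->
  (forall x y, r0 <= x <= R1 -> r0 <= y <= R1 -> Rabs (f x - f y) <= N * Rabs (x - y)) ->
  bounded_lipschitz (M + N) (fun _ _ r => f r).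
Proof.
intros M0 N0 HM HN; split; [lra|split].
- intros b x r (_ & _ & H); specialize (HM r H); lra.
- intros b x r b' x' r' (_ & _ & H) (_ & _ & H'); specialize (HN r r' H H').
  assert (A1 := Rabs_pos (b - b')); assert (A2 := Rabs_pos (x - x')); assert (A3 := Rabs_pos (r - r')); nra.
Qed.

End BoundedLipschitz.

Lemma continuous_bound f a b : a <= b -> (forall x, a <= x <= b -> continuity_pt f x) ->
  exists M, 0 <= M /\ forall x, a <= x <= b -> Rabs (f x) <= M.
Proof.
intros ab H; destruct (continuity_ab_maj (fun x => Rabs (f x)) a b ab) as [m [Hm _]].
- intros x Hx; apply (continuity_pt_comp f Rabs); auto; apply Rcontinuity_abs.
- exists (Rabs (f m)); split; auto using Rabs_pos.
Qed.

(** The box keeps away from [|x| = 1] and [r = 0], where the square root and [/ r] fail to be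
    Lipschitz; the rest is sums and products. *)
Lemma excess_lipschitz g g1 B c r0 R1 : 0 <= B -> 0 <= c < 1 -> 0 < r0 <= R1 ->
  (forall x, derivable_pt_lim g x (g1 x)) -> (forall x, continuity_pt g1 x) ->
  exists M, bounded_lipschitz B c r0 R1 M (excess g) /\
            bounded_lipschitz B c r0 R1 M (rho_rhs g).
Proof.
intros B0 Hc Hr Hg Hg1.
assert (HS : exists M, bounded_lipschitz B c r0 R1 M (fun _ x _ => sqrt (1 - x ^ 2))).
{ assert (S0 : 0 < sqrt (1 - c ^ 2)) by (apply sqrt_lt_R0; nra).
  assert (SM : forall x, - c <= x <= c -> sqrt (1 - c ^ 2) <= sqrt (1 - x ^ 2)) by (intros; apply sqrt_le_1_alt; nra).
  exists (1 + c / sqrt (1 - c ^ 2)); apply (bl_fst B c r0 R1 (fun x => sqrt (1 - x ^ 2))).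
  - lra.
  - apply Rdiv_le_0_compat; lra.
  - intros x Hx; rewrite Rabs_pos_eq by apply sqrt_pos.
    rewrite <- sqrt_1 at 2; apply sqrt_le_1_alt; nra.
  - apply (lip_of_deriv (fun x => sqrt (1 - x ^ 2)) (fun x => - x / sqrt (1 - x ^ 2))).
    + intros x Hx; specialize (SM x Hx); eapply dl_eq; [dl; nra|simpl; field; simpl in *; lra].
    + intros x Hx; specialize (SM x Hx); unfold Rdiv; rewrite Rabs_mult, (Rabs_pos_eq (/ _)).
      2: left; apply Rinv_0_lt_compat; lra.
      apply Rmult_le_compat; auto using Rabs_pos.
      * left; apply Rinv_0_lt_compat; lra.
      * apply Rabs_le_between; lra.
      * apply Rinv_le_contravar; lra. }
assert (HV : exists M, bounded_lipschitz B c r0 R1 M (fun _ _ r => / r)).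
{ exists (/ r0 + / r0 ^ 2); apply (bl_snd B c r0 R1 (fun r => / r)).
  - left; apply Rinv_0_lt_compat; lra.
  - left; apply Rinv_0_lt_compat, pow_lt; lra.
  - intros x Hx; rewrite Rabs_pos_eq; [apply Rinv_le_contravar; lra|left; apply Rinv_0_lt_compat; lra].
  - apply (lip_of_deriv (fun x => / x) (fun x => - / x ^ 2)).
    + intros x Hx; eapply dl_eq; [dl; lra|simpl; field; lra].
    + intros x Hx; rewrite Rabs_Ropp, Rabs_pos_eq by (left; apply Rinv_0_lt_compat, pow_lt; lra).
      apply Rinv_le_contravar; [apply pow_lt; lra|apply pow_incr; lra]. }
assert (HQ : exists M, bounded_lipschitz B c r0 R1 M (fun _ _ r => r ^ 2 * g (r ^ 2))).
{ assert (D : forall x, derivable_pt_lim (fun r => r ^ 2 * g (r ^ 2)) x (2 * x * g (x ^ 2) + x ^ 2 * (2 * x * g1 (x ^ 2)))).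
  { intros x; assert (E := Hg (x ^ 2)); eapply dl_eq; [dl|simpl; ring]. }
  assert (C2 : forall x, continuity_pt (fun y => y ^ 2) x).
  { intros x; apply (dl_cont _ _ (2 * x)); eapply dl_eq; [dl|simpl; ring]. }
  destruct (continuous_bound (fun r => r ^ 2 * g (r ^ 2)) r0 R1) as [M [M0 HM]]; [lra| |].
    intros x _; apply (dl_cont _ _ _ (D x)).
  destruct (continuous_bound (fun x => 2 * x * g (x ^ 2) + x ^ 2 * (2 * x * g1 (x ^ 2))) r0 R1) as [N [N0 HN]]; [lra| |].
  { intros x _.
    assert (Ci : continuity_pt (fun y => 2 * y) x) by (apply (dl_cont _ _ 2); eapply dl_eq; [dl|simpl; ring]).
    apply continuity_pt_plus; apply continuity_pt_mult; auto; [|apply continuity_pt_mult; auto].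
    - apply (continuity_pt_comp (fun y => y ^ 2) g); auto. apply (dl_cont _ _ _ (Hg _)).
    - apply (continuity_pt_comp (fun y => y ^ 2) g1); auto. }
  exists (M + N); apply (bl_snd B c r0 R1 (fun r => r ^ 2 * g (r ^ 2))); auto.
  apply (lip_of_deriv _ _ _ _ _ (fun x _ => D x)); auto. }
assert (HX : bounded_lipschitz B c r0 R1 (c + 1) (fun _ x _ => x)).
{ apply (bl_fst B c r0 R1 (fun x => x)); try lra; intros x Hx; [|intros _ _; lra].
  apply Rabs_le_between; lra. }
destruct HS as [MS HS]; destruct HV as [MV HV]; destruct HQ as [MQ HQ].
assert (HE : exists M, bounded_lipschitz B c r0 R1 M (excess g)).
{ eexists.
  assert (T := bl_plus _ _ _ _ _ _ _ _ (bl_const B c r0 R1 (-1))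
    (bl_mult _ _ _ _ _ _ _ _ (bl_mult _ _ _ _ _ _ _ _ HS
      (bl_plus _ _ _ _ _ _ _ _ (bl_mult _ _ _ _ _ _ _ _ (bl_param B c r0 R1 B0) HQ) HX)) HV)).
  cbv beta in T.
  assert (E : forall b x r, excess g b x r = -1 + sqrt (1 - x ^ 2) * (b * (r ^ 2 * g (r ^ 2)) + x) * / r).
  { intros; unfold excess, Rdiv; rewrite <- Rmult_assoc; reflexivity. }
  destruct T as (T0 & T1 & T2); split; [exact T0|split].
  - intros; rewrite E; now apply T1.
  - intros; rewrite !E; now apply T2. }
destruct HE as [ME HE].
assert (T := bl_mult _ _ _ _ _ _ _ _ (bl_mult _ _ _ _ _ _ _ _ (bl_mult _ _ _ _ _ _ _ _
  (bl_const B c r0 R1 (3 / 2)) (bl_mult _ _ _ _ _ _ _ _ HS HS)) HV) HE); cbv beta in T.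
match type of T with bounded_lipschitz _ _ _ _ ?M _ => set (MF := M) in T end.
exists (ME + MF); destruct HE as (E0 & E1 & E2); destruct T as (T0 & T1 & T2).
(* On the box [1 - x^2] is the square root times itself, so the factors already treated suffice. *)
assert (E : forall b x r, in_box B c r0 R1 b x r -> rho_rhs g b x r = 3 / 2 * (sqrt (1 - x ^ 2) * sqrt (1 - x ^ 2)) * / r * excess g b x r).
{ intros b x r (_ & H & _); rewrite sqrt_sqrt by nra; rewrite rho_rhs_excess; unfold Rdiv; ring. }
assert (P : forall b b' x x' r r', 0 <= Rabs (b - b') + Rabs (x - x') + Rabs (r - r')).
{ intros; assert (A1 := Rabs_pos (b - b')); assert (A2 := Rabs_pos (x - x')); assert (A3 := Rabs_pos (r - r')); lra. }
split; split; [lra|split|lra|split].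
- intros b x r H; specialize (E1 _ _ _ H); lra.
- intros b x r b' x' r' H H'; specialize (E2 _ _ _ _ _ _ H H'); specialize (P b b' x x' r r'); nra.
- intros b x r H; rewrite E by auto; specialize (T1 _ _ _ H); lra.
- intros b x r b' x' r' H H'; rewrite !E by auto; specialize (T2 _ _ _ _ _ _ H H'); specialize (P b b' x x' r r'); nra.
Qed.

(** * The flow with clamped arguments *)

Definition clamped_flow (g : R -> R) (c r0 R1 beta : R) (rho r : R -> R) : Prop :=
  forall t, 0 <= t -> derivable_pt_lim r t (rho t) /\
    derivable_pt_lim rho t (rho_rhs g beta (clamp (- c) c (rho t)) (clamp r0 R1 (r t))).

Lemma in_box_clamp B c r0 R1 beta x r : 0 <= beta <= B -> 0 <= c -> r0 <= R1 ->
  in_box B c r0 R1 beta (clamp (- c) c x) (clamp r0 R1 r).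
Proof. intros; split; [auto|split; apply clamp_bounds; lra]. Qed.

Lemma clamped_flow_exists g B c r0 R1 M beta ra xa :
  0 <= beta <= B -> 0 <= c -> r0 <= R1 -> bounded_lipschitz B c r0 R1 M (rho_rhs g) ->
  exists rho r, clamped_flow g c r0 R1 beta rho r /\ r 0 = ra /\ rho 0 = xa.
Proof.
intros Hb Hc Hr (M0 & _ & L).
set (F := fun (i : bool) (a : bool -> R) => if i then a false
  else rho_rhs g beta (clamp (- c) c (a false)) (clamp r0 R1 (a true))).
(* [true] stands for [r] and [false] for [rho]; [2 * M] accounts for the two clamped arguments, 1
   for [r' = rho]. *)
destruct (picard F (2 * M + 1) (fun i : bool => if i then ra else xa)) as [x Hx]; [lra| |].
- intros i a b d Hd; assert (d0 : 0 <= d) by (eapply Rle_trans; [|apply (Hd true)]; apply Rabs_pos).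
  destruct i; simpl.
  + specialize (Hd false); nra.
  + eapply Rle_trans; [apply L; now apply in_box_clamp|].
    rewrite Rminus_diag, Rabs_R0.
    assert (A1 := clamp_lip (- c) c (a false) (b false)).
    assert (A2 := clamp_lip r0 R1 (a true) (b true)).
    assert (D1 := Hd true); assert (D2 := Hd false). nra.
- exists (x false), (x true); repeat split.
  + apply (proj2 (Hx true)); auto.
  + apply (proj2 (Hx false)); auto.
  + apply (proj1 (Hx true)).
  + apply (proj1 (Hx false)).
Qed.

Lemma Rabs_prod_le x y : 2 * (Rabs x * Rabs y) <= x ^ 2 + y ^ 2.
Proof.
rewrite <- (pow2_abs x), <- (pow2_abs y); assert (H := Rle_0_sqr (Rabs x - Rabs y)).
unfold Rsqr in H; nra.
Qed.

(** Gronwall for the squared distance: by [2 M |y| |beta - beta'| <= M^2 y^2 + (beta - beta')^2] the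
    mismatch of the parameters enters as an additive constant. Equal data and parameters give
    uniqueness. *)
Lemma clamped_flow_dependence g B c r0 R1 M beta beta' rho r rho' r' :
  0 <= beta <= B -> 0 <= beta' <= B -> 0 <= c -> r0 <= R1 ->
  bounded_lipschitz B c r0 R1 M (rho_rhs g) ->
  clamped_flow g c r0 R1 beta rho r -> clamped_flow g c r0 R1 beta' rho' r' ->
  forall t, 0 <= t ->
    (r t - r' t) ^ 2 + (rho t - rho' t) ^ 2 <=
    ((r 0 - r' 0) ^ 2 + (rho 0 - rho' 0) ^ 2 + (beta - beta') ^ 2 * t) * exp ((1 + M ^ 2 + 3 * M) * t).
Proof.
intros Hb Hb' Hc Hr (M0 & _ & L) Hf Hf' t Ht.
apply (gronwall (fun t => (r t - r' t) ^ 2 + (rho t - rho' t) ^ 2)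
  (fun t => 2 * (r t - r' t) * (rho t - rho' t) + 2 * (rho t - rho' t) *
    (rho_rhs g beta (clamp (- c) c (rho t)) (clamp r0 R1 (r t)) -
     rho_rhs g beta' (clamp (- c) c (rho' t)) (clamp r0 R1 (r' t)))) (1 + M ^ 2 + 3 * M) ((beta - beta') ^ 2) t);
  [assert (H := pow2_ge_0 M); lra|apply pow2_ge_0| | |lra].
- intros s Hs; destruct (Hf s) as [D1 D2]; [lra|]; destruct (Hf' s) as [D3 D4]; [lra|].
  eapply dl_eq; [dl|simpl; ring].
- intros s Hs.
  assert (Q : forall x, x <= Rabs x) by apply Rle_abs.
  set (x := r s - r' s); set (y := rho s - rho' s).
  set (f := _ - rho_rhs g beta' _ _).
  assert (Ff : Rabs f <= M * (Rabs (beta - beta') + Rabs y + Rabs x)).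
  { eapply Rle_trans; [apply L; now apply in_box_clamp|]; apply Rmult_le_compat_l; auto.
    assert (A1 := clamp_lip (- c) c (rho s) (rho' s)).
    assert (A2 := clamp_lip r0 R1 (r s) (r' s)). unfold x, y; lra. }
  assert (E1 : 2 * x * y <= x ^ 2 + y ^ 2) by (assert (H := Rle_0_sqr (x - y)); unfold Rsqr in H; nra).
  assert (E2 : 2 * y * f <= 2 * (Rabs y * (M * (Rabs (beta - beta') + Rabs y + Rabs x)))).
  { eapply Rle_trans; [apply Q|]; rewrite !Rabs_mult, (Rabs_pos_eq 2), Rmult_assoc by lra.
    apply Rmult_le_compat_l; [lra|]; apply Rmult_le_compat_l; auto using Rabs_pos. }
  assert (E3 := Rabs_prod_le y x).
  assert (E4 : 2 * (M * (Rabs y * Rabs (beta - beta'))) <= M ^ 2 * y ^ 2 + (beta - beta') ^ 2).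
  { rewrite <- (pow2_abs y), <- (pow2_abs (beta - beta')).
    assert (H := Rle_0_sqr (M * Rabs y - Rabs (beta - beta'))); unfold Rsqr in H; nra. }
  assert (E5 : Rabs y * Rabs y = y ^ 2) by (rewrite <- (pow2_abs y); ring).
  assert (E6 : 0 <= x ^ 2) by nra. assert (E7 : 0 <= y ^ 2) by nra.
  assert (E8 : 2 * (Rabs y * (M * (Rabs (beta - beta') + Rabs y + Rabs x))) =
     2 * (M * (Rabs y * Rabs (beta - beta'))) + 2 * M * (Rabs y * Rabs y) + M * (2 * (Rabs y * Rabs x))) by ring.
  assert (E9 : M * (2 * (Rabs y * Rabs x)) <= M * (y ^ 2 + x ^ 2)) by (apply Rmult_le_compat_l; auto).
  assert (0 <= M * x ^ 2) by now apply Rmult_le_pos.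
  assert (0 <= M ^ 2 * x ^ 2) by (apply Rmult_le_pos; nra).
  rewrite E8, E5 in E2. nra.
Qed.

(** In terms of [w] the degenerate factor [1 - rho^2] and the square root cancel; up to the factor
    [rho / r] the equation is linear in [w], [Q] and [rho]. *)
Lemma meridian_deriv g beta rho r s :
  -1 < rho s < 1 -> 0 < r s ->
  derivable_pt_lim rho s (rho_rhs g beta (rho s) (r s)) -> derivable_pt_lim r s (rho s) ->
  derivable_pt_lim (fun t => r t / sqrt (1 - rho t ^ 2)) s
    (rho s / r s * (- (r s / sqrt (1 - rho s ^ 2)) / 2 +
       3 / 2 * (beta * r s ^ 2 * g (r s ^ 2) + rho s))).
Proof.
intros Hx Hr D1 D2.
assert (P : 0 < 1 - rho s ^ 2) by nra.
assert (S0 : 0 < sqrt (1 - rho s ^ 2)) by now apply sqrt_lt_R0.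
assert (S2 : 1 - rho s ^ 2 = sqrt (1 - rho s ^ 2) ^ 2) by (rewrite pow2_sqrt; lra).
eapply dl_eq; [dl; simpl in *; lra|].
unfold rho_rhs; set (S := sqrt (1 - rho s ^ 2)) in *; rewrite S2.
simpl; fold S. set (q := g _). simpl in S; fold S. field. lra.
Qed.

(** * Shooting *)

Lemma local_solution_Derive g beta eps G W u : local_solution g beta eps G W ->
  Rabs u < eps -> derivable_pt_lim W u (Derive W u) /\
    u * Derive W u = - W u / 4 + 3 / 4 * (beta * u * g u + G u).
Proof.
intros (_ & _ & H) Hu; destruct (H u Hu) as (_ & _ & _ & _ & _ & w' & D & E).
assert (F : Derive W u = w') by now apply is_derive_unique, is_derive_Reals.
now rewrite F.
Qed.

Lemma local_solution_0 g beta eps G W : 0 < eps -> local_solution g beta eps G W -> G 0 = 1.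
Proof.
intros He (_ & W0 & H); destruct (H 0) as (G1 & _ & G2 & _); [rewrite Rabs_R0; auto|].
rewrite W0 in G2; nra.
Qed.

Lemma local_solution_G_le1 g beta eps G W u : local_solution g beta eps G W ->
  0 <= u < eps -> G u <= 1.
Proof.
intros (_ & W0 & H) Hu; destruct (H u) as (G1 & W1 & G2 & _); [rewrite Rabs_pos_eq; lra|].
assert (0 <= u / W u ^ 2) by (apply Rdiv_le_0_compat; [lra|apply pow_lt; lra]). nra.
Qed.

(** [G^2 = 1 - u / W^2] makes [G] Lipschitz in [W] with a constant of order [u]. With 1/6 the
    feedback [3/4 k] is at most 1/8, half of the damping coefficient 1/4 of [W]. *)
Lemma local_solution_G_diff g beta beta' eps G W G' W' u : eps <= / 48 ->
  local_solution g beta eps G W -> local_solution g beta' eps G' W' -> 0 <= u < eps ->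
  exists k, 0 <= k <= / 6 /\ G u - G' u = k * (W u - W' u).
Proof.
intros He (_ & _ & H) (_ & _ & H') Hu.
destruct (H u) as (G1 & W1 & G2 & _); [rewrite Rabs_pos_eq; lra|].
destruct (H' u) as (G1' & W1' & G2' & _); [rewrite Rabs_pos_eq; lra|].
exists (u * (W u + W' u) / (W u ^ 2 * W' u ^ 2 * (G u + G' u))).
assert (P2 : 4 < W u ^ 2) by nra. assert (P2' : 4 < W' u ^ 2) by nra.
assert (P4 : 16 < W u ^ 2 * W' u ^ 2) by nra.
assert (P : 16 < W u ^ 2 * W' u ^ 2 * (G u + G' u)) by nra.
split; [split|].
- apply Rdiv_le_0_compat; [|lra]; apply Rmult_le_pos; lra.
- apply Rle_div_l; [lra|]; nra.
- assert (E : (G u - G' u) * (G u + G' u) = u * (W u - W' u) * (W u + W' u) / (W u ^ 2 * W' u ^ 2)).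
  { replace ((G u - G' u) * (G u + G' u)) with (G u ^ 2 - G' u ^ 2) by ring.
    rewrite G2, G2'; field; lra. }
  apply (Rmult_eq_reg_r (G u + G' u)); [|lra]; rewrite E; field; lra.
Qed.

(** Energy estimate for [d = W - W']: with the forcing [y = (beta - beta') u g],
    [u (d^2)' <= - d^2/4 + 3/2 d y <= 9/4 y^2]. As [y^2] carries a factor [u], the singular [u]
    cancels, and [d] starts from 0. *)
Lemma local_solution_dependence g gm beta beta' eps G W G' W' u :
  (forall v, 0 <= v <= 1 -> 0 <= g v <= gm) -> eps <= / 48 ->
  local_solution g beta eps G W -> local_solution g beta' eps G' W' -> 0 <= u < eps ->
  (W u - W' u) ^ 2 <= 9 / 4 * gm ^ 2 * (beta - beta') ^ 2.
Proof.
intros Hg He H H' Hu.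
set (C := 9 / 4 * gm ^ 2 * (beta - beta') ^ 2).
assert (C0 : 0 <= C) by (apply Rmult_le_pos; [nra|apply pow2_ge_0]).
set (Z := fun v => C * v - (W v - W' v) ^ 2).
assert (A : Z 0 <= Z u).
{ apply (dl_nonneg_incr Z (fun v => C - 2 * (W v - W' v) * (Derive W v - Derive W' v))); [lra| |].
  - intros v Hv; destruct (local_solution_Derive _ _ _ _ _ v H) as [D _]; [rewrite Rabs_pos_eq; lra|].
    destruct (local_solution_Derive _ _ _ _ _ v H') as [D' _]; [rewrite Rabs_pos_eq; lra|].
    unfold Z; eapply dl_eq; [dl|simpl; ring].
  - intros v [[v0|v0] Hv].
    + destruct (local_solution_Derive _ _ _ _ _ v H) as [_ D]; [rewrite Rabs_pos_eq; lra|].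
      destruct (local_solution_Derive _ _ _ _ _ v H') as [_ D']; [rewrite Rabs_pos_eq; lra|].
      destruct (local_solution_G_diff _ _ _ _ _ _ _ _ v He H H') as (k & Hk & E); [lra|].
      set (d := W v - W' v) in *.
      assert (E' : v * (Derive W v - Derive W' v) = - d / 4 + 3 / 4 * ((beta - beta') * v * g v + k * d)).
      { unfold d in *; rewrite <- E; lra. }
      assert (F : 2 * d * (v * (Derive W v - Derive W' v)) <= v * C).
      { rewrite E'; specialize (Hg v ltac:(lra)).
        set (y := (beta - beta') * v * g v).
        assert (Y : y ^ 2 <= v * (gm ^ 2 * (beta - beta') ^ 2)).
        { unfold y; replace (((beta - beta') * v * g v) ^ 2) with (v * v * g v ^ 2 * (beta - beta') ^ 2) by ring.
          rewrite <- Rmult_assoc; apply Rmult_le_compat_r; [apply pow2_ge_0|].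
          assert (g v ^ 2 <= gm ^ 2) by (apply pow_incr; lra).
          assert (0 <= gm ^ 2) by apply pow2_ge_0.
          assert (0 <= g v ^ 2) by apply pow2_ge_0.
          apply Rle_trans with (v * g v ^ 2); nra. }
        assert (S := Rle_0_sqr (d / 2 - 3 / 2 * y)); unfold Rsqr in S.
        assert (k * d ^ 2 <= / 6 * d ^ 2) by (apply Rmult_le_compat_r; [apply pow2_ge_0|lra]).
        unfold C. nra. }
      nra.
    + subst v; destruct H as (_ & W0 & _); destruct H' as (_ & W0' & _); rewrite W0, W0'; lra. }
unfold Z in A; destruct H as (_ & W0 & _); destruct H' as (_ & W0' & _); rewrite W0, W0' in A; nra.
Qed.

(** Where [W < 3 G] the equation gives [W' > 0], while [G] does not increase because [Q + G < W]. *)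
Lemma local_solution_W_ge g beta eps G W u : 0 <= beta -> 0 < eps ->
  (forall v, 0 <= v -> 0 <= g v) ->
  local_solution g beta eps G W -> 0 <= u < eps -> 3 * G u <= W u.
Proof.
intros Hb He Hg H Hu.
enough (0 <= W u - 3 * G u) by lra.
assert (G0 := local_solution_0 _ _ _ _ _ He H).
apply (barrier (fun v => W v - 3 * G v)
  (fun v => Derive W v - 3 * (3 / 4 / (G v * W v ^ 2) * (-1 + (beta * v * g v + G v) / W v))) 0 u); [lra| | | |lra].
- intros v Hv; destruct (local_solution_Derive _ _ _ _ _ v H) as [D _]; [rewrite Rabs_pos_eq; lra|].
  destruct H as (_ & W0 & H); destruct (H v) as (_ & _ & _ & _ & DG & _); [rewrite Rabs_pos_eq; lra|].
  eapply dl_eq; [apply dl_minus; [exact D|apply dl_mult; [apply dl_const|exact DG]]|simpl; ring].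
- rewrite G0; destruct H as (_ & W0 & _); rewrite W0; lra.
- intros v Hv N; destruct (local_solution_Derive _ _ _ _ _ v H) as [_ D]; [rewrite Rabs_pos_eq; lra|].
  destruct H as (_ & W0 & H); destruct (H v) as (G1 & W1 & _ & E & _); [rewrite Rabs_pos_eq; lra|].
  set (f := 3 / 4 / (G v * W v ^ 2) * _).
  assert (f <= 0).
  { assert (0 < 3 / 4 / (G v * W v ^ 2)) by (apply Rdiv_lt_0_compat; [lra|apply Rmult_lt_0_compat; [lra|apply pow_lt; lra]]).
    assert ((beta * v * g v + G v) / W v <= 1) by (apply Rle_div_l; lra).
    unfold f; nra. }
  assert (0 <= beta * v * g v) by (apply Rmult_le_pos; [apply Rmult_le_pos; lra|apply Hg; lra]).
  assert (0 < v * Derive W v) by lra. nra.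
Qed.

(** 3/5 is the borderline: where [W > 3 + 3/5 Q], [G <= 1] and the monotonicity of [g] give [u (3/5
    Q - W)' > (3/5 + 3/20 - 3/4) Q = 0]. *)
Lemma local_solution_W_le g g1 beta eps G W u : 0 <= beta -> 0 < eps ->
  (forall x, derivable_pt_lim g x (g1 x)) -> (forall v, 0 < v -> 0 <= g1 v) ->
  local_solution g beta eps G W -> 0 <= u < eps -> W u <= 3 + 3 / 5 * (beta * u * g u).
Proof.
intros Hb He Hg Hg1 H Hu.
enough (0 <= 3 + 3 / 5 * (beta * u * g u) - W u) by lra.
apply (barrier (fun v => 3 + 3 / 5 * (beta * v * g v) - W v)
  (fun v => 3 / 5 * (beta * g v + beta * v * g1 v) - Derive W v) 0 u); [lra| | | |lra].
- intros v Hv; destruct (local_solution_Derive _ _ _ _ _ v H) as [D _]; [rewrite Rabs_pos_eq; lra|].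
  assert (D1 := Hg v); eapply dl_eq; [dl|simpl; ring].
- destruct H as (_ & W0 & _); rewrite W0; lra.
- intros v Hv N; destruct (local_solution_Derive _ _ _ _ _ v H) as [_ D]; [rewrite Rabs_pos_eq; lra|].
  assert (GE := local_solution_G_le1 _ _ _ _ _ v H); specialize (GE ltac:(lra)).
  assert (0 <= beta * v * v * g1 v) by (apply Rmult_le_pos; [repeat apply Rmult_le_pos; lra|apply Hg1; lra]).
  assert (0 < v * (3 / 5 * (beta * g v + beta * v * g1 v) - Derive W v)) by nra. nra.
Qed.

Lemma one_minus_sq_pos x : -1 < x < 1 -> 0 < 1 - x ^ 2.
Proof. nra. Qed.

Section Shooting.

Variables (g g1 g2 : R -> R) (b B eps r0 R1 c M : R).
Hypothesis Hg1 : forall x, derivable_pt_lim g x (g1 x).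
Hypothesis Hg2 : forall x, derivable_pt_lim g1 x (g2 x).
Hypothesis g_pos : forall v, 0 < v -> 0 < g v.
Hypothesis g1_nonneg : forall v, 0 < v -> 0 <= g1 v.
Hypothesis g_incr : forall u v, 0 <= u <= v -> g u <= g v.
Hypothesis convex : forall v, 0 < v ->
  0 < 2 * g (v ^ 2) + 10 * v ^ 2 * g1 (v ^ 2) + 4 * v ^ 4 * g2 (v ^ 2).
Hypothesis b_pos : 0 < b.
Hypothesis b_le_B : b <= B.
(** [b_def] and [B_def] serve the barriers [r < 4] at the low end and [r < 1/2] at the high end. The
    bounds [c] and [r0 / 2] of the box leave room around the starting point; [R1_large] will make E
    positive at [r = R1]. *)
Hypothesis b_def : b * 16 * g 16 = 1.
Hypothesis B_def : B / 4 * g (1 / 4) = 8.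
Hypothesis eps_small : 0 < eps <= / 48.
Hypothesis local_ex : forall beta, 0 <= beta <= B -> exists G W, local_solution g beta eps G W.
Hypothesis r0_small : 0 < r0 < 1 / 48.
Hypothesis r0_eps : r0 ^ 2 < eps.
Hypothesis c_range : 0 <= c < 1.
Hypothesis c_def : 1 - c ^ 2 = r0 ^ 2 / 64.
Hypothesis R1_gt : r0 < R1.
Hypothesis R1_large : 1 < r0 / 4 * (b * R1 * g (R1 ^ 2)).
Hypothesis BLE : bounded_lipschitz B c (r0 / 2) R1 M (excess g).
Hypothesis BLF : bounded_lipschitz B c (r0 / 2) R1 M (rho_rhs g).

Let cx := clamp (- c) c.
Let cr := clamp (r0 / 2) R1.

(** Every parameter starts at the radius [r0], but on its own curve: [beta] enters through [G] as
    well as through the field. *)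
Definition trajectory (beta : R) (rho r : R -> R) : Prop :=
  exists G W, local_solution g beta eps G W /\
    clamped_flow g c (r0 / 2) R1 beta rho r /\ r 0 = r0 /\ rho 0 = G (r0 ^ 2).

(** Thanks to the clamps E remains defined and continuous after a trajectory has left the region of
    interest. *)
Definition exc (beta : R) (rho r : R -> R) (t : R) : R :=
  excess g beta (cx (rho t)) (cr (r t)).

Lemma trajectory_exists beta : 0 <= beta <= B -> exists rho r, trajectory beta rho r.
Proof.
intros Hb; destruct (local_ex beta Hb) as (G & W & H).
destruct (clamped_flow_exists g B c (r0 / 2) R1 M beta r0 (G (r0 ^ 2))) as (rho & r & F & E1 & E2); auto; try lra.
exists rho, r, G, W; auto.
Qed.

(** The starting point and the field both contribute terms quadratic in [beta - beta']. At
    [beta = beta'] the bound vanishes: the trajectory is unique, although [G] and [W] are only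
    asserted to exist. *)
Lemma trajectory_dependence : exists C k, 0 < C /\ 0 <= k /\
  forall beta beta' rho r rho' r', 0 <= beta <= B -> 0 <= beta' <= B ->
    trajectory beta rho r -> trajectory beta' rho' r' ->
    forall t, 0 <= t -> (r t - r' t) ^ 2 + (rho t - rho' t) ^ 2 <=
      (beta - beta') ^ 2 * ((C + t) * exp (k * t)).
Proof.
exists (9 / 4 * g 1 ^ 2 + 1), (1 + M ^ 2 + 3 * M).
assert (M0 : 0 <= M) by apply BLF.
split; [assert (H := pow2_ge_0 (g 1)); lra|split; [assert (H := pow2_ge_0 M); lra|]].
intros beta beta' rho r rho' r' Hb Hb' (G & W & H & F & E1 & E2) (G' & W' & H' & F' & E1' & E2') t Ht.
eapply Rle_trans; [apply (clamped_flow_dependence g B c (r0 / 2) R1 M beta beta'); auto; lra|].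
rewrite <- Rmult_assoc; apply Rmult_le_compat_r; [left; apply exp_pos|].
rewrite E1, E1', E2, E2'.
assert (0 <= r0 ^ 2) by nra.
assert (D : (W (r0 ^ 2) - W' (r0 ^ 2)) ^ 2 <= 9 / 4 * g 1 ^ 2 * (beta - beta') ^ 2).
{ apply (local_solution_dependence g (g 1) beta beta' eps G W G' W'); auto; try lra.
  intros v Hv; split; [|apply g_incr; lra].
  apply (cont_nonneg_at_0 g); [apply (dl_cont _ _ _ (Hg1 0))| |lra].
  intros x Hx; left; auto. }
destruct (local_solution_G_diff g beta beta' eps G W G' W' (r0 ^ 2)) as (k & Hk & E); auto; try lra.
rewrite E; assert (P := pow2_ge_0 (W (r0 ^ 2) - W' (r0 ^ 2))).
assert ((k * (W (r0 ^ 2) - W' (r0 ^ 2))) ^ 2 <= (W (r0 ^ 2) - W' (r0 ^ 2)) ^ 2).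
{ rewrite Rpow_mult_distr; assert (k ^ 2 <= 1) by nra; nra. }
assert (0 <= (beta - beta') ^ 2) by apply pow2_ge_0. nra.
Qed.

Lemma exc_close beta beta' rho r rho' r' t s : 0 <= beta <= B -> 0 <= beta' <= B ->
  Rabs (exc beta rho r t - exc beta' rho' r' s) <=
  M * (Rabs (beta - beta') + Rabs (rho t - rho' s) + Rabs (r t - r' s)).
Proof.
intros Hb Hb'; destruct BLE as (M0 & _ & L).
eapply Rle_trans; [apply L; apply in_box_clamp; auto; lra|].
apply Rmult_le_compat_l; auto.
assert (A1 := clamp_lip (- c) c (rho t) (rho' s)).
assert (A2 := clamp_lip (r0 / 2) R1 (r t) (r' s)); fold cx in A1; fold cr in A2; lra.
Qed.

(** * A priori estimates along one trajectory *)

Section OneTrajectory.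

Variables (beta : R) (rho r : R -> R).
Hypothesis beta_range : b <= beta <= B.
Hypothesis Htraj : trajectory beta rho r.

Let E := exc beta rho r.
Let Q t := beta * r t ^ 2 * g (r t ^ 2).
Let Sn t := sqrt (1 - rho t ^ 2).
Let w t := r t / Sn t.

Lemma traj_deriv t : 0 <= t -> derivable_pt_lim r t (rho t) /\
  derivable_pt_lim rho t (rho_rhs g beta (cx (rho t)) (cr (r t))).
Proof. destruct Htraj as (G & W & H & F & _); apply F. Qed.

Lemma traj_cont t : 0 <= t -> continuity_pt r t /\ continuity_pt rho t.
Proof. intros Ht; destruct (traj_deriv t Ht) as [D1 D2]; split; eapply dl_cont; eauto. Qed.

Lemma exc_cont t : 0 <= t -> continuity_pt E t.
Proof.
intros Ht; destruct (traj_cont t Ht) as [C1 C2]; intros e He.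
assert (M0 : 0 <= M) by apply BLE.
assert (P : 0 < e / (2 * M + 1)) by (apply Rdiv_lt_0_compat; lra).
destruct (cont_eps _ _ _ C1 P) as [d1 [d10 H1]]; destruct (cont_eps _ _ _ C2 P) as [d2 [d20 H2]].
exists (Rmin d1 d2); split; [now apply Rmin_glb_lt|]; intros s [_ Hs]; simpl in *; unfold Rdist in *.
assert (k1 := Rlt_le_trans _ _ _ Hs (Rmin_l _ _)); assert (k2 := Rlt_le_trans _ _ _ Hs (Rmin_r _ _)).
eapply Rle_lt_trans; [apply exc_close; lra|].
rewrite Rminus_diag, Rabs_R0; specialize (H1 s k1); specialize (H2 s k2).
apply Rle_lt_trans with (2 * M * (e / (2 * M + 1))); [nra|].
replace e with ((2 * M + 1) * (e / (2 * M + 1))) at 2 by (field; lra). lra.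
Qed.

(** All bounds come from the curve. [W0 < 4] gives [1 - rho^2 > r0^2 / 16], above
    [1 - c^2 = r0^2 / 64], so the start is strictly inside the box. *)
Lemma traj_init : exists W0, 2 < W0 < 4 /\ 1 / 2 < rho 0 < c /\ r 0 = r0 /\
  rho 0 ^ 2 = 1 - r0 ^ 2 / W0 ^ 2 /\ E 0 < 0 /\ w 0 = W0 /\ 3 * rho 0 <= W0 /\
  W0 <= 3 + 3 / 5 * Q 0.
Proof.
destruct Htraj as (G & W & H & _ & E1 & E2).
assert (Hr : 0 <= r0 ^ 2 < eps) by (split; [apply pow2_ge_0|auto]).
assert (Hr' : Rabs (r0 ^ 2) < eps) by (rewrite Rabs_pos_eq; lra).
destruct (proj2 (proj2 H) _ Hr') as (G1 & W1 & G2 & Ex & _).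
assert (gn : forall v, 0 <= v -> 0 <= g v).
{ apply (cont_nonneg_at_0 g); [apply (dl_cont _ _ _ (Hg1 0))|].
  intros x Hx; left; auto. }
assert (L1 : 3 * G (r0 ^ 2) <= W (r0 ^ 2)) by (apply (local_solution_W_ge g beta eps); auto; lra).
assert (L2 : W (r0 ^ 2) <= 3 + 3 / 5 * (beta * r0 ^ 2 * g (r0 ^ 2)))
  by (apply (local_solution_W_le g g1 beta eps G); auto; lra).
set (W0 := W (r0 ^ 2)) in *; exists W0.
assert (SE : sqrt (1 - rho 0 ^ 2) = r0 / W0).
{ rewrite E2, G2; replace (1 - (1 - r0 ^ 2 / W0 ^ 2)) with ((r0 / W0) ^ 2) by (field; lra).
  apply sqrt_pow2; apply Rdiv_le_0_compat; lra. }
assert (wE : w 0 = W0) by (unfold w, Sn; rewrite SE, E1; field; lra).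
assert (Hc : rho 0 < c).
{ assert (r0 ^ 2 / 64 < r0 ^ 2 / W0 ^ 2).
  { apply Rmult_lt_compat_l; [nra|]; apply Rinv_lt_contravar; nra. }
  rewrite E2; nra. }
assert (Q 0 = beta * r0 ^ 2 * g (r0 ^ 2)) by (unfold Q; now rewrite E1).
repeat split; try lra; auto.
- rewrite E2; exact G2.
- unfold E, exc, cx, cr; rewrite E1, !clamp_id by lra; unfold excess; rewrite SE, E2.
  replace (r0 / W0 * (beta * r0 ^ 2 * g (r0 ^ 2) + G (r0 ^ 2)) / r0)
    with ((beta * r0 ^ 2 * g (r0 ^ 2) + G (r0 ^ 2)) / W0) by (field; lra).
  assert ((beta * r0 ^ 2 * g (r0 ^ 2) + G (r0 ^ 2)) / W0 < 1) by (apply Rlt_div_l; lra). lra.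
Qed.

(** In this phase [r] does not decrease and [rho] does not increase, so [Sn] stays above [r0 / 4];
    with this bound, [r >= R1] would force E > 0. Hence the clamps are inactive and the true
    equation holds. *)
Lemma traj_closed_phase T : 0 <= T ->
  (forall t, 0 <= t <= T -> 0 <= rho t /\ E t <= 0) ->
  forall t, 0 <= t <= T -> r0 <= r t < R1 /\ 0 <= rho t <= rho 0 /\
    cx (rho t) = rho t /\ cr (r t) = r t /\ r0 / 4 <= Sn t <= 1 /\ 0 < w t /\ r t <= w t /\
    0 < Q t /\ E t = -1 + (Q t + rho t) / w t /\
    derivable_pt_lim rho t (rho_rhs g beta (rho t) (r t)).
Proof.
intros T0 Hph t Ht.
destruct traj_init as (W0 & HW0 & Hr0 & r0E & rhoE & _).
assert (Hr : r 0 <= r t).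
{ apply (dl_nonneg_incr r rho); [lra| |]; intros x Hx; [apply traj_deriv|apply Hph]; lra. }
assert (Hx : rho t <= rho 0).
{ apply (dl_nonpos_decr rho (fun x => rho_rhs g beta (cx (rho x)) (cr (r x)))); [lra| |].
  - intros x Hx; apply traj_deriv; lra.
  - intros x Hx; rewrite rho_rhs_excess; destruct (Hph x) as [_ HE]; [lra|].
    unfold E, exc in HE.
    assert (A1 := clamp_bounds (- c) c (rho x)); assert (A2 := clamp_bounds (r0 / 2) R1 (r x)).
    fold cx in A1; fold cr in A2.
    assert (0 <= 3 / 2 * ((1 - cx (rho x) ^ 2) / cr (r x))).
    { apply Rmult_le_pos; [lra|]; apply Rdiv_le_0_compat; [left; apply one_minus_sq_pos; lra|lra]. }
    nra. }
destruct (Hph t Ht) as [rho_ge HE].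
assert (cxE : cx (rho t) = rho t) by (apply clamp_id; lra).
assert (HS : r0 / 4 <= Sn t <= 1).
{ unfold Sn; split.
  - rewrite <- (sqrt_pow2 (r0 / 4)) by lra; apply sqrt_le_1_alt.
    assert (r0 ^ 2 / 16 <= r0 ^ 2 / W0 ^ 2).
    { apply Rmult_le_compat_l; [nra|]; apply Rinv_le_contravar; nra. }
    nra.
  - apply Rle_trans with (sqrt 1); [apply sqrt_le_1_alt; nra|rewrite sqrt_1; lra]. }
assert (HR : r t < R1).
{ destruct (Rlt_or_le (r t) R1) as [|n]; auto; exfalso.
  unfold E, exc in HE; rewrite cxE in HE; unfold cr in HE; rewrite clamp_above in HE by lra.
  unfold excess in HE; fold (Sn t) in HE.
  assert (gp : 0 < g (R1 ^ 2)) by (apply g_pos; nra).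
  assert (r0 / 4 * (b * R1 * g (R1 ^ 2)) <= Sn t * (beta * R1 ^ 2 * g (R1 ^ 2) + rho t) / R1).
  { replace (Sn t * (beta * R1 ^ 2 * g (R1 ^ 2) + rho t) / R1)
      with (Sn t * (beta * R1 * g (R1 ^ 2) + rho t / R1)) by (field; lra).
    assert (0 <= rho t / R1) by (apply Rdiv_le_0_compat; lra).
    assert (0 < b * R1 * g (R1 ^ 2)) by (apply Rmult_lt_0_compat; [nra|auto]).
    apply Rmult_le_compat; try lra.
    assert (b * R1 * g (R1 ^ 2) <= beta * R1 * g (R1 ^ 2)).
    { apply Rmult_le_compat_r; [lra|]; nra. }
    lra. }
  lra. }
assert (crE : cr (r t) = r t) by (apply clamp_id; lra).
assert (w0 : 0 < w t) by (apply Rdiv_lt_0_compat; lra).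
assert (gp : 0 < g (r t ^ 2)) by (apply g_pos; nra).
split; [lra|]. split; [lra|]. split; [exact cxE|]. split; [exact crE|]. split; [exact HS|].
split; [exact w0|]. split.
  unfold w; apply Rle_div_r; nra.
split.
  unfold Q; apply Rmult_lt_0_compat; [apply Rmult_lt_0_compat; [lra|apply pow_lt; lra]|auto].
split.
- unfold E, exc; rewrite cxE, crE; unfold excess, w, Q; fold (Sn t); field; repeat split; lra.
- destruct (traj_deriv t) as [_ D]; [lra|]; rewrite cxE, crE in D; exact D.
Qed.

Lemma Q_deriv t : 0 <= t -> derivable_pt_lim Q t
  (beta * (2 * r t * g (r t ^ 2) + 2 * r t ^ 3 * g1 (r t ^ 2)) * rho t).
Proof.
intros Ht; destruct (traj_deriv t Ht) as [D _]; assert (D1 := Hg1 (r t ^ 2)).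
unfold Q; eapply dl_eq; [apply dl_mult|].
- apply dl_mult; [apply dl_const|apply dl_pow; exact D].
- apply (dl_comp (fun y => r y ^ 2) g); [apply dl_pow; exact D|exact D1].
- simpl; ring.
Qed.

Lemma w_deriv T t : (forall t, 0 <= t <= T -> 0 <= rho t /\ E t <= 0) -> 0 <= t <= T ->
  derivable_pt_lim w t (rho t / r t * (- w t / 2 + 3 / 2 * (Q t + rho t))).
Proof.
intros Hph Ht.
destruct (traj_closed_phase T ltac:(lra) Hph t Ht) as (A1 & A2 & _ & _ & _ & _ & _ & _ & _ & D).
destruct traj_init as (W0 & _ & B1 & _).
apply (meridian_deriv g beta); auto; try lra.
apply traj_deriv; lra.
Qed.

(** The two bounds on [W] near the axis, carried along the flow by the same barriers; both ends of
    the shooting rely on them. *)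
Lemma traj_open_phase T : 0 <= T ->
  (forall t, 0 <= t <= T -> 0 < rho t /\ E t < 0) ->
  3 * rho T <= w T /\ w T <= 3 + 3 / 5 * Q T.
Proof.
intros T0 Hop.
assert (Hph : forall t, 0 <= t <= T -> 0 <= rho t /\ E t <= 0) by (intros t Ht; specialize (Hop t Ht); lra).
assert (Cl := traj_closed_phase T T0 Hph).
destruct traj_init as (W0 & HW0 & Hr0 & r0E & rhoE & _ & wE & I1 & I2).
split.
- enough (0 <= w T - 3 * rho T) by lra.
  apply (barrier (fun t => w t - 3 * rho t) (fun t => rho t / r t * (- w t / 2 + 3 / 2 * (Q t + rho t)) -
    3 * rho_rhs g beta (rho t) (r t)) 0 T); [lra| |lra| |lra].
  + intros t Ht; assert (D := w_deriv T t Hph Ht); assert (D' := Cl t Ht).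
    eapply dl_eq; [apply dl_minus; [exact D|apply dl_mult; [apply dl_const|apply D']]|simpl; ring].
  + intros t Ht N; destruct (Cl t) as (A1 & A2 & A3 & A4 & A5 & A6 & A7 & A8 & A9 & _); [lra|].
    destruct (Hop t) as [P1 P2]; [lra|].
    assert (0 < rho t / r t) by (apply Rdiv_lt_0_compat; lra).
    assert (rho_rhs g beta (rho t) (r t) <= 0).
    { rewrite rho_rhs_excess; unfold E, exc in P2; rewrite A3, A4 in P2.
      assert (0 <= 3 / 2 * ((1 - rho t ^ 2) / r t)); [|nra].
      apply Rmult_le_pos; [lra|]; apply Rdiv_le_0_compat; [left; apply one_minus_sq_pos; lra|lra]. }
    assert (0 < - w t / 2 + 3 / 2 * (Q t + rho t)) by lra. nra.
- enough (0 <= 3 + 3 / 5 * Q T - w T) by lra.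
  apply (barrier (fun t => 3 + 3 / 5 * Q t - w t)
    (fun t => 3 / 5 * (beta * (2 * r t * g (r t ^ 2) + 2 * r t ^ 3 * g1 (r t ^ 2)) * rho t) -
      rho t / r t * (- w t / 2 + 3 / 2 * (Q t + rho t))) 0 T); [lra| |lra| |lra].
  + intros t Ht; assert (D := w_deriv T t Hph Ht); assert (D' := Q_deriv t ltac:(lra)).
    eapply dl_eq; [apply dl_minus; [apply dl_plus; [apply dl_const|apply dl_mult; [apply dl_const|exact D']]|exact D]|simpl; ring].
  + intros t Ht N; destruct (Cl t) as (A1 & A2 & A3 & A4 & A5 & A6 & A7 & A8 & A9 & _); [lra|].
    destruct (Hop t) as [P1 P2]; [lra|].
    assert (P3 : 0 < rho t / r t) by (apply Rdiv_lt_0_compat; lra).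
    assert (P4 : 0 <= g1 (r t ^ 2)) by (apply g1_nonneg, pow_lt; lra).
    assert (P5 : 0 <= beta * r t ^ 4 * g1 (r t ^ 2)).
    { apply Rmult_le_pos; auto; apply Rmult_le_pos; [lra|apply pow_le; lra]. }
    replace (3 / 5 * (beta * (2 * r t * g (r t ^ 2) + 2 * r t ^ 3 * g1 (r t ^ 2)) * rho t))
      with (rho t / r t * (6 / 5 * Q t + 6 / 5 * (beta * r t ^ 4 * g1 (r t ^ 2)))) by (unfold Q; field; lra).
    rewrite <- Rmult_minus_distr_l; apply Rmult_lt_0_compat; auto; lra.
Qed.

Lemma open_phase_extends t1 : 0 < t1 ->
  (forall t, 0 <= t < t1 -> 0 < rho t /\ E t < 0) -> 0 <= rho t1 /\ E t1 <= 0.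
Proof.
intros Ht1 H; split.
- apply (cont_nonneg_left rho 0 t1); [lra|apply traj_cont; lra|]; intros t Ht; left; now apply H.
- enough (0 <= - E t1) by lra.
  apply (cont_nonneg_left (fun t => - E t) 0 t1); [lra| |].
  + apply continuity_pt_opp, exc_cont; lra.
  + intros t Ht; specialize (H t Ht); lra.
Qed.

Lemma unclamped_near t : 0 <= t -> r0 / 2 < r t < R1 -> - c < rho t < c ->
  exists d, 0 < d /\ forall s, Rabs (s - t) < d -> cx (rho s) = rho s /\ cr (r s) = r s.
Proof.
intros Ht Hr Hx; destruct (traj_cont t Ht) as [C1 C2].
destruct (cont_eps r t (Rmin (r t - r0 / 2) (R1 - r t)) C1) as [d1 [d10 H1]]; [apply Rmin_glb_lt; lra|].
destruct (cont_eps rho t (Rmin (rho t + c) (c - rho t)) C2) as [d2 [d20 H2]]; [apply Rmin_glb_lt; lra|].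
exists (Rmin d1 d2); split; [now apply Rmin_glb_lt|]; intros s Hs.
specialize (H1 s (Rlt_le_trans _ _ _ Hs (Rmin_l _ _))).
specialize (H2 s (Rlt_le_trans _ _ _ Hs (Rmin_r _ _))).
assert (A1 := Rlt_le_trans _ _ _ H1 (Rmin_l _ _)); assert (A2 := Rlt_le_trans _ _ _ H1 (Rmin_r _ _)).
assert (A3 := Rlt_le_trans _ _ _ H2 (Rmin_l _ _)); assert (A4 := Rlt_le_trans _ _ _ H2 (Rmin_r _ _)).
apply Rabs_def2 in A1; apply Rabs_def2 in A2; apply Rabs_def2 in A3; apply Rabs_def2 in A4.
split; apply clamp_id; lra.
Qed.

(** Where the clamps are inactive [N = - w E]; [J] is the partial derivative of [N] in [r] at fixed
    [rho]. *)
Let N t := w t - Q t - rho t.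
Let J t := / Sn t - beta * (2 * r t * g (r t ^ 2) + 2 * r t ^ 3 * g1 (r t ^ 2)).

(** Where [N = 0], [rho] is stationary and [N] changes at the rate [rho J] only; all other terms are
    proportional to [N]. *)
Lemma N_deriv T t : (forall t, 0 <= t <= T -> 0 <= rho t /\ E t <= 0) -> 0 <= t <= T ->
  derivable_pt_lim N t
    (rho t * J t + 3 / 2 * (Sn t ^ 2 / (r t * w t) - rho t / r t) * N t).
Proof.
intros Hph Ht.
destruct (traj_closed_phase T ltac:(lra) Hph t Ht) as (A1 & A2 & A3 & A4 & A5 & A6 & A7 & A8 & A9 & D).
assert (Dw := w_deriv T t Hph Ht); assert (DQ := Q_deriv t ltac:(lra)).
assert (S2 : 1 - rho t ^ 2 = Sn t ^ 2).
{ destruct traj_init as (W0 & _ & B1 & _).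
  unfold Sn; rewrite pow2_sqrt; auto; left; apply one_minus_sq_pos; lra. }
eapply dl_eq; [apply dl_minus; [apply dl_minus; [exact Dw|exact DQ]|exact D]|].
rewrite rho_rhs_excess; replace (excess g beta (rho t) (r t)) with (E t)
  by (unfold E, exc; now rewrite A3, A4).
rewrite A9, S2; unfold J, N; set (q := Q t); set (hr := 2 * r t * g (r t ^ 2) + _).
unfold w; field; lra.
Qed.

(* While [E < 0] one has [N > 0]. If [N] vanishes together with [rho > 0], then
   [N' = rho J <= 0] there. The case [J = 0] is excluded by the convexity
   hypothesis, which makes [J] decreasing at that point, hence positive just
   before, and then [N exp (K t)] is increasing there. *)
Lemma crossing_transversal t1 : 0 < t1 ->
  (forall t, 0 <= t < t1 -> 0 < rho t /\ E t < 0) -> 0 < rho t1 -> E t1 = 0 ->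
  N t1 = 0 /\ J t1 < 0.
Proof.
intros Ht1 Hop Hx HE.
assert (Hph : forall t, 0 <= t <= t1 -> 0 <= rho t /\ E t <= 0).
{ intros t Ht; destruct (Req_dec t t1) as [->|n]; [lra|]; specialize (Hop t); lra. }
assert (Cl := traj_closed_phase t1 (Rlt_le _ _ Ht1) Hph).
assert (EN : forall t, 0 <= t <= t1 -> N t = - E t * w t).
{ intros t Ht; destruct (Cl t Ht) as (A1 & A2 & A3 & A4 & A5 & A6 & A7 & A8 & A9 & D).
  rewrite A9; unfold N; field; lra. }
assert (N1 : N t1 = 0) by (rewrite EN, HE by lra; ring).
assert (Npos : forall t, 0 <= t < t1 -> 0 < N t).
{ intros t Ht; rewrite EN by lra; destruct (Cl t) as (A1 & A2 & A3 & A4 & A5 & A6 & _); [lra|].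
  specialize (Hop t Ht); apply Rmult_lt_0_compat; lra. }
split; auto.
assert (DN := N_deriv t1 t1 Hph (conj (Rlt_le _ _ Ht1) (Rle_refl _))); rewrite N1 in DN.
destruct (Cl t1) as (A1 & A2 & A3 & A4 & A5 & A6 & A7 & A8 & A9 & D); [lra|].
destruct traj_init as (W0 & _ & B1 & _).
destruct (Rtotal_order (J t1) 0) as [|[J0|Jp]]; auto; exfalso.
- assert (rho' : rho_rhs g beta (rho t1) (r t1) = 0).
  { rewrite rho_rhs_excess; replace (excess g beta (rho t1) (r t1)) with (E t1)
      by (unfold E, exc; now rewrite A3, A4). rewrite HE; ring. }
  rewrite rho' in D.
  (* As [rho' = 0] here, only the second derivative of [Q] in [r] survives, which is [beta] times
     the quantity in [convex]. *)
  assert (DJ : derivable_pt_lim J t1 (- (beta * (2 * g (r t1 ^ 2) + 10 * r t1 ^ 2 * g1 (r t1 ^ 2)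
                + 4 * r t1 ^ 4 * g2 (r t1 ^ 2)) * rho t1))).
  { destruct (traj_deriv t1) as [Dr _]; [lra|].
    assert (D1 := Hg1 (r t1 ^ 2)); assert (D2 := Hg2 (r t1 ^ 2)).
    assert (P : 0 < 1 - rho t1 ^ 2) by (apply one_minus_sq_pos; lra).
    assert (PS : 0 < sqrt (1 - rho t1 ^ 2)) by now apply sqrt_lt_R0.
    unfold J, Sn; eapply dl_eq; [apply dl_minus|].
    - apply (dl_inv (fun t => sqrt (1 - rho t ^ 2))); [dl; exact P|lra].
    - apply dl_mult; [apply dl_const|]; apply dl_plus; apply dl_mult.
      + apply dl_mult; [apply dl_const|exact Dr].
      + apply (dl_comp (fun y => r y ^ 2) g); [apply dl_pow; exact Dr|exact D1].
      + apply dl_mult; [apply dl_const|apply dl_pow; exact Dr].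
      + apply (dl_comp (fun y => r y ^ 2) g1); [apply dl_pow; exact Dr|exact D2].
    - simpl; field; simpl in PS; lra. }
  assert (cv := convex (r t1) ltac:(lra)).
  assert (neg : - (beta * (2 * g (r t1 ^ 2) + 10 * r t1 ^ 2 * g1 (r t1 ^ 2)
                + 4 * r t1 ^ 4 * g2 (r t1 ^ 2)) * rho t1) < 0).
  { apply Ropp_lt_gt_0_contravar; repeat apply Rmult_lt_0_compat; lra. }
  destruct (dl_neg_left J t1 _ DJ neg) as [d [d0 Hd]].
  set (a := Rmax (t1 / 2) (t1 - d / 2)).
  assert (a1 : t1 / 2 <= a) by apply Rmax_l. assert (a2 : t1 - d / 2 <= a) by apply Rmax_r.
  assert (a3 : a < t1) by (apply Rmax_lub_lt; lra).
  (* [K] dominates [3/2 rho / r], the negative part of the coefficient of [N], since [rho <= 1] and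
     [r >= r0]. *)
  set (K := 3 / 2 / r0).
  assert (K0 : 0 < K) by (apply Rdiv_lt_0_compat; lra).
  assert (A : N a * exp (K * a) <= N t1 * exp (K * t1)).
  { apply (dl_nonneg_incr (fun t => N t * exp (K * t))
      (fun t => (rho t * J t + 3 / 2 * (Sn t ^ 2 / (r t * w t) - rho t / r t) * N t) * exp (K * t) +
                N t * (exp (K * t) * K))); [lra| |].
    - intros t Ht; assert (Dt := N_deriv t1 t Hph ltac:(lra)).
      eapply dl_eq; [apply dl_mult; [exact Dt|apply (dl_exp (fun t => K * t)); dl]|simpl; ring].
    - intros t Ht; destruct (Cl t) as (C1 & C2 & _ & _ & C5 & C6 & _); [lra|].
      assert (Jt : 0 <= J t).
      { destruct (Req_dec t t1) as [->|n]; [lra|].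
        specialize (Hd (t1 - t) ltac:(lra)); replace (t1 - (t1 - t)) with t in Hd by ring; lra. }
      assert (Nt : 0 <= N t).
      { destruct (Req_dec t t1) as [->|n]; [lra|]; left; apply Npos; lra. }
      assert (k1 : 0 <= Sn t ^ 2 / (r t * w t)).
      { apply Rdiv_le_0_compat; [apply pow2_ge_0|apply Rmult_lt_0_compat; lra]. }
      assert (k2 : 3 / 2 * (rho t / r t) <= K).
      { unfold K; replace (3 / 2 / r0) with (3 / 2 * (1 / r0)) by (field; lra).
        apply Rmult_le_compat_l; [lra|]; apply Rmult_le_compat; try lra.
        - left; apply Rinv_0_lt_compat; lra.
        - apply Rinv_le_contravar; lra. }
      assert (ex := exp_pos (K * t)).
      replace (_ + _) with ((rho t * J t + (3 / 2 * (Sn t ^ 2 / (r t * w t)) + (K - 3 / 2 * (rho t / r t))) * N t) * exp (K * t)) by ring.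
      apply Rmult_le_pos; [|lra]; apply Rplus_le_le_0_compat; apply Rmult_le_pos; lra. }
  rewrite N1, Rmult_0_l in A.
  assert (0 < N a) by (apply Npos; lra). assert (ex := exp_pos (K * a)). nra.
- assert (P : 0 < rho t1 * J t1) by now apply Rmult_lt_0_compat.
  destruct (dl_neg_left (fun t => - N t) t1 (- (rho t1 * J t1))) as [d [d0 Hd]].
  + apply dl_opp; eapply dl_eq; [exact DN|ring].
  + lra.
  + set (h := Rmin (d / 2) (t1 / 2)).
    assert (h <= d / 2) by apply Rmin_l. assert (h <= t1 / 2) by apply Rmin_r.
    assert (0 < h) by (apply Rmin_glb_lt; lra).
    specialize (Hd h); specialize (Npos (t1 - h)); lra.
Qed.

(** [N' = rho J < 0] pushes E above 0 just after the crossing, within a time in which [rho] stays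
    positive and the clamps stay inactive. *)
Lemma crossing_escapes t1 : 0 < t1 ->
  (forall t, 0 <= t < t1 -> 0 < rho t /\ E t < 0) -> 0 < rho t1 -> E t1 = 0 ->
  exists t, 0 <= t /\ 0 < E t /\ forall s, 0 <= s <= t -> 0 < rho s.
Proof.
intros Ht1 Hop Hx HE.
destruct (crossing_transversal t1 Ht1 Hop Hx HE) as [N1 J1].
assert (Hph : forall t, 0 <= t <= t1 -> 0 <= rho t /\ E t <= 0).
{ intros t Ht; destruct (Req_dec t t1) as [->|n]; [lra|]; specialize (Hop t); lra. }
destruct (traj_closed_phase t1 (Rlt_le _ _ Ht1) Hph t1) as (A1 & A2 & A3 & A4 & A5 & A6 & A7 & A8 & A9 & D); [lra|].
destruct traj_init as (W0 & _ & B1 & _).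
assert (DN := N_deriv t1 t1 Hph (conj (Rlt_le _ _ Ht1) (Rle_refl _))); rewrite N1, Rmult_0_r, Rplus_0_r in DN.
destruct (dl_neg_right N t1 _ DN) as [d1 [d10 H1]]; [nra|].
destruct (unclamped_near t1) as [d2 [d20 H2]]; try lra.
destruct (traj_cont t1) as [Cr Cx]; [lra|].
destruct (cont_eps rho t1 (Rmin (rho t1) (c - rho t1)) Cx) as [d3 [d30 H3]]; [apply Rmin_glb_lt; lra|].
destruct (cont_eps r t1 (r t1) Cr) as [d4 [d40 H4]]; [lra|].
set (h := Rmin (Rmin d1 d2) (Rmin d3 d4) / 2).
assert (hh : 0 < Rmin (Rmin d1 d2) (Rmin d3 d4)) by (repeat apply Rmin_glb_lt; auto).
assert (h1 : h < d1).
{ assert (X1 := Rmin_l (Rmin d1 d2) (Rmin d3 d4)); assert (X2 := Rmin_l d1 d2); unfold h; lra. }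
assert (h2 : h < d2).
{ assert (X1 := Rmin_l (Rmin d1 d2) (Rmin d3 d4)); assert (X2 := Rmin_r d1 d2); unfold h; lra. }
assert (h3 : h < d3).
{ assert (X1 := Rmin_r (Rmin d1 d2) (Rmin d3 d4)); assert (X2 := Rmin_l d3 d4); unfold h; lra. }
assert (h4 : h < d4).
{ assert (X1 := Rmin_r (Rmin d1 d2) (Rmin d3 d4)); assert (X2 := Rmin_r d3 d4); unfold h; lra. }
assert (h0 : 0 < h) by (unfold h; lra). clearbody h; clear hh.
assert (Rx : forall s, t1 <= s <= t1 + h -> 0 < rho s < c).
{ intros s Hs; specialize (H3 s); rewrite Rabs_pos_eq in H3 by lra; specialize (H3 ltac:(lra)).
  assert (X1 := Rlt_le_trans _ _ _ H3 (Rmin_l _ _)); assert (X2 := Rlt_le_trans _ _ _ H3 (Rmin_r _ _)).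
  apply Rabs_def2 in X1; apply Rabs_def2 in X2; lra. }
exists (t1 + h); split; [lra|split].
- specialize (H1 h ltac:(lra)); rewrite N1 in H1.
  destruct (H2 (t1 + h)) as [U1 U2]; [rewrite Rabs_pos_eq; lra|].
  specialize (H4 (t1 + h)); rewrite Rabs_pos_eq in H4 by lra; specialize (H4 ltac:(lra)).
  apply Rabs_def2 in H4; specialize (Rx (t1 + h) ltac:(lra)).
  assert (PS : 0 < Sn (t1 + h)) by (apply sqrt_lt_R0, one_minus_sq_pos; lra).
  assert (w0 : 0 < w (t1 + h)) by (apply Rdiv_lt_0_compat; lra).
  replace (E (t1 + h)) with (- N (t1 + h) / w (t1 + h)); [apply Rdiv_lt_0_compat; lra|].
  unfold E, exc; rewrite U1, U2; unfold excess, N, w, Q; fold (Sn (t1 + h)); field; lra.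
- intros s Hs; destruct (Rlt_or_le s t1); [apply Hop; lra|apply Rx; lra].
Qed.

(** The state at [t1] would be an equilibrium of a Lipschitz field, reached in finite time; the
    squared distance from it decays at most exponentially and is positive at time 0. *)
Lemma equilibrium_excluded t1 : 0 < t1 ->
  (forall t, 0 <= t < t1 -> 0 < rho t /\ E t < 0) -> rho t1 = 0 -> E t1 = 0 -> False.
Proof.
intros Ht1 Hop Hx HE.
destruct traj_init as (W0 & _ & B1 & _).
assert (M0 : 0 <= M) by apply BLF.
assert (F0 : rho_rhs g beta (cx (rho t1)) (cr (r t1)) = 0).
{ rewrite rho_rhs_excess; fold (exc beta rho r t1); fold (E t1); rewrite HE; ring. }
assert (A : (r 0 - r t1) ^ 2 + rho 0 ^ 2 <= 0).
{ apply (backward_zero (fun t => (r t - r t1) ^ 2 + rho t ^ 2)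
    (fun t => 2 * (r t - r t1) * rho t + 2 * rho t * rho_rhs g beta (cx (rho t)) (cr (r t)))
    (1 + 3 * M) 0 t1); [lra| | |].
  - intros t Ht; destruct (traj_deriv t) as [D1 D2]; [lra|].
    eapply dl_eq; [dl|simpl; ring].
  - intros t Ht; set (x := r t - r t1); set (y := rho t); set (f := rho_rhs _ _ _ _).
    assert (Ff : Rabs f <= M * (Rabs y + Rabs x)).
    { replace f with (f - rho_rhs g beta (cx (rho t1)) (cr (r t1))) by (rewrite F0; ring).
      destruct BLF as (_ & _ & L); eapply Rle_trans; [apply L; apply in_box_clamp; auto; lra|].
      apply Rmult_le_compat_l; auto; rewrite Rminus_diag, Rabs_R0.
      assert (X1 := clamp_lip (- c) c (rho t) (rho t1)).
      assert (X2 := clamp_lip (r0 / 2) R1 (r t) (r t1)).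
      rewrite Hx, Rminus_0_r in X1; rewrite Hx; fold cx in X1; fold cr in X2; unfold x, y; lra. }
    assert (E2 : Rabs (2 * y * f) <= 2 * (Rabs y * (M * (Rabs y + Rabs x)))).
    { rewrite !Rabs_mult, (Rabs_pos_eq 2), Rmult_assoc by lra.
      apply Rmult_le_compat_l; [lra|]; apply Rmult_le_compat_l; auto using Rabs_pos. }
    apply Rabs_le_between in E2.
    assert (E3 := Rabs_prod_le y x).
    assert (E5 : Rabs y * Rabs y = y ^ 2) by (rewrite <- (pow2_abs y); ring).
    assert (E6 := pow2_ge_0 x); assert (E7 := pow2_ge_0 y).
    assert (E1 : - (x ^ 2 + y ^ 2) <= 2 * x * y) by (assert (H := Rle_0_sqr (x + y)); unfold Rsqr in H; nra).
    assert (E8 : 2 * (Rabs y * (M * (Rabs y + Rabs x))) =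
       2 * M * (Rabs y * Rabs y) + M * (2 * (Rabs y * Rabs x))) by ring.
    assert (E9 : M * (2 * (Rabs y * Rabs x)) <= M * (y ^ 2 + x ^ 2)) by (apply Rmult_le_compat_l; auto).
    assert (0 <= M * x ^ 2) by now apply Rmult_le_pos.
    rewrite E8, E5 in E2. lra.
  - rewrite Hx, Rminus_diag; simpl; lra. }
assert (X := pow2_ge_0 (r 0 - r t1)). nra.
Qed.

(** [t1] is the first zero of the minimum of [rho] and [- E]. *)
Lemma exit_time T : 0 <= T -> ~ (0 < rho T /\ E T < 0) ->
  exists t1, 0 < t1 <= T /\ (forall t, 0 <= t < t1 -> 0 < rho t /\ E t < 0) /\
    ((rho t1 = 0 /\ E t1 <= 0) \/ (0 < rho t1 /\ E t1 = 0)).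
Proof.
intros T0 HT; destruct traj_init as (W0 & _ & B1 & _ & _ & E0 & _).
destruct (first_zero (fun t => Rmin (rho t) (- E t)) 0 T) as (t1 & Ht1 & Z & P); auto.
- intros t Ht; apply Rmin_cont; [apply traj_cont; lra|apply continuity_pt_opp, exc_cont; lra].
- apply Rmin_glb_lt; lra.
- destruct (Rle_or_lt (Rmin (rho T) (- E T)) 0) as [|n]; auto; exfalso; apply HT.
  assert (X1 := Rmin_l (rho T) (- E T)); assert (X2 := Rmin_r (rho T) (- E T)); lra.
- assert (Hop : forall t, 0 <= t < t1 -> 0 < rho t /\ E t < 0).
  { intros t Ht; specialize (P t Ht).
    assert (X1 := Rmin_l (rho t) (- E t)); assert (X2 := Rmin_r (rho t) (- E t)); lra. }
  exists t1; split; [lra|]; split; auto.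
  destruct (open_phase_extends t1) as [Y1 Y2]; auto; [lra|].
  unfold Rmin in Z; destruct Rle_dec; [left; lra|right; lra].
Qed.

(** If [rho] vanishes first, then [rho' < 0] there and [rho] becomes negative. The strict
    inequalities in the last two cases are what makes them open in [beta]. *)
Lemma trajectory_trichotomy :
  (forall t, 0 <= t -> 0 < rho t /\ E t < 0) \/
  (exists t, 0 <= t /\ rho t < 0 /\ forall s, 0 <= s <= t -> E s < 0) \/
  (exists t, 0 <= t /\ 0 < E t /\ forall s, 0 <= s <= t -> 0 < rho s).
Proof.
destruct (Classical_Prop.classic (exists T, 0 <= T /\ ~ (0 < rho T /\ E T < 0))) as [(T & T0 & HT)|n].
2: { left; intros t Ht; apply Classical_Prop.NNPP; intros H; apply n; now exists t. }
right; destruct (exit_time T T0 HT) as (t1 & Ht1 & Hop & [[Z1 [Z2|Z2]]|[Z1 Z2]]).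
- left; destruct (traj_deriv t1) as [_ D]; [lra|].
  rewrite rho_rhs_excess in D; fold (exc beta rho r t1) in D; fold (E t1) in D.
  assert (X1 := clamp_bounds (- c) c (rho t1)); assert (X2 := clamp_bounds (r0 / 2) R1 (r t1)).
  fold cx in X1; fold cr in X2.
  assert (P : 0 < 3 / 2 * ((1 - cx (rho t1) ^ 2) / cr (r t1))).
  { apply Rmult_lt_0_compat; [lra|]; apply Rdiv_lt_0_compat; [apply one_minus_sq_pos; lra|lra]. }
  destruct (dl_neg_right rho t1 _ D) as [d1 [d10 H1]]; [nra|].
  destruct (cont_eps E t1 (- E t1)) as [d2 [d20 H2]]; [apply exc_cont; lra|lra|].
  set (h := Rmin d1 d2 / 2).
  assert (hh : 0 < Rmin d1 d2) by (apply Rmin_glb_lt; lra).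
  assert (X3 := Rmin_l d1 d2); assert (X4 := Rmin_r d1 d2).
  exists (t1 + h); split; [unfold h; lra|split].
  + specialize (H1 h); unfold h in *; lra.
  + intros s Hs; destruct (Rlt_or_le s t1); [apply Hop; lra|].
    specialize (H2 s); rewrite Rabs_pos_eq in H2 by lra.
    specialize (H2 ltac:(unfold h in *; lra)); apply Rabs_def2 in H2; lra.
- exfalso; apply (equilibrium_excluded t1); auto; lra.
- right; apply (crossing_escapes t1); auto; lra.
Qed.

(** At [r = 4] one has [Q = 1], so [w <= 18/5], against [r <= w]. For [r < 4], [Q <= r/4 <= w/4] and
    [rho <= w/3] give [(Q + rho) / w <= 7/12]. *)
Lemma low_phase T : beta = b -> 0 <= T ->
  (forall t, 0 <= t <= T -> 0 < rho t /\ E t < 0) -> r T < 4 /\ E T <= - (5 / 12).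
Proof.
intros Hb T0 Hop.
assert (Hph : forall t, 0 <= t <= T -> 0 <= rho t /\ E t <= 0) by (intros t Ht; specialize (Hop t Ht); lra).
assert (Cl := traj_closed_phase T T0 Hph).
destruct traj_init as (W0 & _ & _ & r0E & _).
assert (rT : r T < 4).
{ destruct (Rlt_or_le (r T) 4) as [|n]; auto; exfalso.
  destruct (first_zero (fun t => 4 - r t) 0 T) as (t1 & Ht1 & Z & _); auto; try lra.
    intros t Ht; apply continuity_pt_minus; [apply continuity_pt_const; now intros ? ?|apply traj_cont; lra].
  destruct (traj_open_phase t1) as [_ Y]; [lra|intros t Ht; apply Hop; lra|].
  destruct (Cl t1) as (_ & _ & _ & _ & _ & _ & A7 & _); [lra|].
  assert (r4 : r t1 = 4) by lra.
  unfold Q in Y; rewrite r4, Hb in Y; replace (4 ^ 2) with 16 in Y by ring. lra. }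
split; auto.
destruct (Cl T) as (A1 & A2 & A3 & A4 & A5 & A6 & A7 & A8 & A9 & D); [lra|].
destruct (traj_open_phase T T0 Hop) as [Y1 Y2].
assert (Q4 : Q T <= r T / 4).
{ unfold Q; rewrite Hb.
  assert (gl : g (r T ^ 2) <= g 16) by (apply g_incr; split; [apply pow2_ge_0|nra]).
  apply Rle_trans with (b * r T ^ 2 * g 16).
  - apply Rmult_le_compat_l; auto; apply Rmult_le_pos; [lra|apply pow2_ge_0].
  - replace (b * r T ^ 2 * g 16) with (b * 16 * g 16 * (r T ^ 2 / 16)) by field.
    rewrite b_def; nra. }
assert ((Q T + rho T) / w T <= 7 / 12) by (apply Rle_div_l; lra).
lra.
Qed.

Lemma low_end : beta = b ->
  exists t, 0 <= t /\ rho t < 0 /\ forall s, 0 <= s <= t -> E s < 0.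
Proof.
intros Hb; destruct trajectory_trichotomy as [H|[H|(t & t0 & Et & H)]]; auto; exfalso.
- destruct traj_init as (W0 & _ & B1 & _).
  (* [m] bounds [- rho'] from below, by [1 - rho^2 >= (r0 / 4)^2], [r < 4] and E <= - 5/12; up to
     time [/ m], [rho] would drop by 1, below zero. *)
  set (m := 3 / 2 * (r0 ^ 2 / 16 / 4) * (5 / 12)).
  assert (r2 : 0 < r0 ^ 2) by (apply pow_lt; lra).
  assert (m0 : 0 < m) by (unfold m; lra).
  assert (im : 0 < / m) by now apply Rinv_0_lt_compat.
  assert (A : rho (/ m) + m * / m <= rho 0 + m * 0).
  { apply (dl_nonpos_decr (fun t => rho t + m * t) (fun t => rho_rhs g beta (rho t) (r t) + m)); [lra| |].
    - intros t Ht; destruct (traj_closed_phase t) with (t := t) as (_ & _ & _ & _ & _ & _ & _ & _ & _ & D); [lra| |lra|].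
        intros s Hs; specialize (H s); lra.
      eapply dl_eq; [dl|simpl; ring].
    - intros t Ht.
      destruct (low_phase t Hb) as [Y1 Y2]; [lra|intros s Hs; apply H; lra|].
      destruct (traj_closed_phase t) with (t := t) as (A1 & A2 & A3 & A4 & A5 & _); [lra| |lra|].
        intros s Hs; specialize (H s); lra.
      rewrite rho_rhs_excess; replace (excess g beta (rho t) (r t)) with (E t)
        by (unfold E, exc; now rewrite A3, A4).
      assert (S2 : 1 - rho t ^ 2 = Sn t ^ 2).
      { unfold Sn; rewrite pow2_sqrt; auto; left; apply one_minus_sq_pos; lra. }
      assert (S3 : r0 ^ 2 / 16 / 4 <= (1 - rho t ^ 2) / r t).
      { rewrite S2; apply (Rle_div_r (r0 ^ 2 / 16 / 4) (Sn t ^ 2) (r t)); [lra|].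
        assert ((r0 / 4) ^ 2 <= Sn t ^ 2) by (apply pow_incr; lra).
        apply Rle_trans with (r0 ^ 2 / 16 / 4 * 4); [apply Rmult_le_compat_l; lra|].
        replace (r0 ^ 2 / 16 / 4 * 4) with ((r0 / 4) ^ 2) by field; auto. }
      assert ((1 - rho t ^ 2) / r t * E t <= (1 - rho t ^ 2) / r t * - (5 / 12))
        by (apply Rmult_le_compat_l; lra).
      unfold m; lra. }
  rewrite Rinv_r in A by lra. assert (P := H (/ m) ltac:(lra)). lra.
- destruct (exit_time t t0) as (t1 & Ht1 & Hop & [[Z1 Z2]|[Z1 Z2]]); [lra| |].
    specialize (H t1); lra.
  assert (0 <= - (5 / 12) - E t1); [|lra].
  apply (cont_nonneg_left (fun s => - (5 / 12) - E s) 0 t1); [lra| |].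
  + apply continuity_pt_minus; [apply continuity_pt_const; now intros ? ?|apply exc_cont; lra].
  + intros s Hs; destruct (low_phase s Hb) as [_ Y]; [lra|intros u Hu; apply Hop; lra|lra].
Qed.

(** At [r >= 1/2] one has [Q >= 8], whereas [Q < w <= 3 + 3/5 Q] forces [Q < 15/2]. With [r < 1/2],
    [w >= 2] gives [Sn <= 1/4] and so [rho >= 9/10]; hence [w' > 0] wherever [w = 2], and [w] stays
    above 2. *)
Lemma high_phase T : beta = B -> 0 <= T ->
  (forall t, 0 <= t <= T -> 0 < rho t /\ E t < 0) -> r T < 1 / 2 /\ 9 / 10 <= rho T.
Proof.
intros Hb T0 Hop.
assert (Hph : forall t, 0 <= t <= T -> 0 <= rho t /\ E t <= 0) by (intros t Ht; specialize (Hop t Ht); lra).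
assert (Cl := traj_closed_phase T T0 Hph).
destruct traj_init as (W0 & HW0 & B1 & r0E & _ & _ & wE & _).
assert (rho_of_w : forall t, 0 <= t <= T -> 2 <= w t -> r t < 1 / 2 -> 9 / 10 <= rho t).
{ intros t Ht wt rt; destruct (Cl t Ht) as (A1 & A2 & A3 & A4 & A5 & A6 & A7 & A8 & A9 & D).
  assert (S2 : 1 - rho t ^ 2 = Sn t ^ 2).
  { unfold Sn; rewrite pow2_sqrt; auto; left; apply one_minus_sq_pos; lra. }
  assert (SE : Sn t * w t = r t) by (unfold w; field; lra).
  assert (Sn t <= 1 / 4) by nra.
  assert (Sn t ^ 2 <= (1 / 4) ^ 2) by (apply pow_incr; lra).
  nra. }
assert (rlt : forall t, 0 <= t <= T -> r t < 1 / 2).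
{ intros t Ht; destruct (Cl t Ht) as (A1 & A2 & A3 & A4 & A5 & A6 & A7 & A8 & A9 & D).
  destruct (traj_open_phase t) as [_ Y]; [lra|intros s Hs; apply Hop; lra|].
  destruct (Hop t Ht) as [P1 P2].
  assert (Qw : Q t + rho t < w t).
  { assert (X : (Q t + rho t) / w t < 1) by lra.
    apply (Rmult_lt_compat_r (w t)) in X; [|lra].
    replace ((Q t + rho t) / w t * w t) with (Q t + rho t) in X by (field; lra); lra. }
  destruct (Rlt_or_le (r t) (1 / 2)) as [|n]; auto; exfalso.
  assert (r2 : 1 / 4 <= r t ^ 2) by (replace (1 / 4) with ((1 / 2) ^ 2) by field; apply pow_incr; lra).
  assert (gl : g (1 / 4) <= g (r t ^ 2)) by (apply g_incr; lra).
  assert (gp := g_pos (1 / 4) ltac:(lra)).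
  assert (8 <= Q t); [|lra].
  rewrite <- B_def; unfold Q; rewrite Hb; apply Rmult_le_compat; try lra; nra. }
assert (wge : forall t, 0 <= t <= T -> 0 < w t - 2).
{ apply (barrier_strict (fun t => w t - 2) (fun t => rho t / r t * (- w t / 2 + 3 / 2 * (Q t + rho t)) - 0) 0 T); auto; [|lra|].
  - intros t Ht; apply dl_minus; [now apply (w_deriv T)|apply dl_const].
  - intros t Ht Z.
    destruct (Cl t) as (A1 & A2 & A3 & A4 & A5 & A6 & A7 & A8 & A9 & D); [lra|].
    assert (9 / 10 <= rho t) by (apply rho_of_w; [lra|lra|apply rlt; lra]).
    rewrite Rminus_0_r; apply Rmult_lt_0_compat; [apply Rdiv_lt_0_compat; lra|lra]. }
split; [apply rlt; lra|].
apply rho_of_w; [lra| |apply rlt; lra]. specialize (wge T); lra.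
Qed.

Lemma high_end : beta = B ->
  exists t, 0 <= t /\ 0 < E t /\ forall s, 0 <= s <= t -> 0 < rho s.
Proof.
intros Hb; destruct trajectory_trichotomy as [H|[(t & t0 & xt & H)|H]]; auto; exfalso.
(* In unit time [r] would grow by 9/10, beyond 1/2. *)
- destruct (high_phase 1 Hb) as [Y _]; [lra|intros t Ht; apply H; lra|].
  destruct traj_init as (W0 & _ & _ & r0E & _).
  assert (A : r 0 - 9 / 10 * 0 <= r 1 - 9 / 10 * 1).
  { apply (dl_nonneg_incr (fun t => r t - 9 / 10 * t) (fun t => rho t - 9 / 10)); [lra| |].
    - intros t Ht; destruct (traj_deriv t) as [D _]; [lra|].
      eapply dl_eq; [dl|simpl; ring].
    - intros t Ht; destruct (high_phase t Hb) as [_ Z]; [lra|intros s Hs; apply H; lra|lra]. }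
  lra.
- destruct (exit_time t t0) as (t1 & Ht1 & Hop & [[Z1 Z2]|[Z1 Z2]]); [lra| |].
  2: { specialize (H t1); lra. }
  assert (0 <= rho t1 - 9 / 10); [|lra].
  apply (cont_nonneg_left (fun s => rho s - 9 / 10) 0 t1); [lra| |].
  + apply continuity_pt_minus; [apply traj_cont; lra|apply continuity_pt_const; now intros ? ?].
  + intros s Hs; destruct (high_phase s Hb) as [_ Y]; [lra|intros u Hu; apply Hop; lra|lra].
Qed.

End OneTrajectory.

(** * The two exits as open conditions on [beta] *)

Definition falls (beta : R) : Prop := exists rho r, trajectory beta rho r /\
  exists t, 0 <= t /\ rho t < 0 /\ forall s, 0 <= s <= t -> exc beta rho r s < 0.

Definition escapes (beta : R) : Prop := exists rho r, trajectory beta rho r /\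
  exists t, 0 <= t /\ 0 < exc beta rho r t /\ forall s, 0 <= s <= t -> 0 < rho s.

Lemma trajectory_near beta rho r T e : 0 <= beta <= B -> 0 <= T -> 0 < e ->
  trajectory beta rho r ->
  exists d, 0 < d /\ forall beta' rho' r', 0 <= beta' <= B -> Rabs (beta' - beta) < d ->
    trajectory beta' rho' r' -> forall t, 0 <= t <= T ->
    Rabs (rho' t - rho t) < e /\ Rabs (exc beta' rho' r' t - exc beta rho r t) < e.
Proof.
intros Hb T0 e0 Ht; destruct trajectory_dependence as (C & k & C0 & k0 & Dep).
assert (M0 : 0 <= M) by apply BLF.
set (K := (C + T) * exp (k * T)).
assert (K0 : 0 < K) by (apply Rmult_lt_0_compat; [lra|apply exp_pos]).
(* [exc] is [M]-Lipschitz in each of [beta], [rho] and [r], which accounts for [3 * M]. *)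
set (e' := e / (3 * M + 1)).
assert (e'0 : 0 < e') by (apply Rdiv_lt_0_compat; lra).
assert (e'e : (3 * M + 1) * e' = e) by (unfold e'; field; lra).
exists (e' / (1 + K)); split; [apply Rdiv_lt_0_compat; lra|].
intros beta' rho' r' Hb' Hd Ht' t Ht2.
assert (D := Dep beta' beta rho' r' rho r Hb' Hb Ht' Ht t (proj1 Ht2)).
assert (KT : (C + t) * exp (k * t) <= K).
{ apply Rmult_le_compat; try lra; [left; apply exp_pos|].
  destruct (Req_dec (k * t) (k * T)) as [->|n]; [lra|]; left; apply exp_increasing.
  assert (k * t <= k * T) by (apply Rmult_le_compat_l; lra). lra. }
assert (dK : e' / (1 + K) <= e').
{ apply Rle_div_l; nra. }
assert (Bd : (beta' - beta) ^ 2 * ((C + t) * exp (k * t)) < e' ^ 2).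
{ apply Rle_lt_trans with ((beta' - beta) ^ 2 * K).
    apply Rmult_le_compat_l; auto using pow2_ge_0.
  apply Rle_lt_trans with ((e' / (1 + K)) ^ 2 * K).
  - apply Rmult_le_compat_r; [lra|]; rewrite <- pow2_abs; apply pow_incr; split; [apply Rabs_pos|lra].
  - replace ((e' / (1 + K)) ^ 2 * K) with (e' ^ 2 * (K / (1 + K) ^ 2)) by (field; lra).
    assert (K / (1 + K) ^ 2 < 1) by (apply Rlt_div_l; nra).
    assert (0 < e' ^ 2) by (now apply pow_lt). nra. }
assert (sq : forall x, x ^ 2 < e' ^ 2 -> Rabs x < e').
{ intros x Hx; rewrite <- (pow2_abs x) in Hx; assert (P := Rabs_pos x); nra. }
assert (X1 : Rabs (rho' t - rho t) < e').
{ apply sq; assert (P := pow2_ge_0 (r' t - r t)); lra. }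
assert (X2 : Rabs (r' t - r t) < e').
{ apply sq; assert (P := pow2_ge_0 (rho' t - rho t)); lra. }
split; [nra|].
eapply Rle_lt_trans; [apply exc_close; auto|].
rewrite <- e'e; nra.
Qed.

(** E attains a negative maximum on the compact [[0, t]], so both strict inequalities survive a
    uniformly small perturbation. *)
Lemma falls_open beta : b <= beta <= B -> falls beta ->
  exists d, 0 < d /\ forall beta', b <= beta' <= B -> Rabs (beta' - beta) < d -> falls beta'.
Proof.
intros Hb (rho & r & Ht & t & t0 & xt & HE).
destruct (continuity_ab_maj (exc beta rho r) 0 t t0) as (m & Hm & Im).
  intros s Hs; apply exc_cont; auto; lra.
assert (HE' := HE m Im).
destruct (trajectory_near beta rho r t (Rmin (- rho t) (- exc beta rho r m))) as (d & d0 & Hd); auto; try lra.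
  apply Rmin_glb_lt; lra.
exists d; split; auto; intros beta' Hb' Hbd.
destruct (trajectory_exists beta') as (rho' & r' & Ht'); [lra|].
exists rho', r'; split; auto; exists t; split; auto.
assert (Hd' := Hd beta' rho' r' ltac:(lra) Hbd Ht').
assert (X1 := Rmin_l (- rho t) (- exc beta rho r m)); assert (X2 := Rmin_r (- rho t) (- exc beta rho r m)).
split.
- destruct (Hd' t) as [Y _]; [lra|]; apply Rabs_def2 in Y; lra.
- intros s Hs; destruct (Hd' s Hs) as [_ Y]; apply Rabs_def2 in Y; specialize (Hm s Hs); lra.
Qed.

Lemma escapes_open beta : b <= beta <= B -> escapes beta ->
  exists d, 0 < d /\ forall beta', b <= beta' <= B -> Rabs (beta' - beta) < d -> escapes beta'.
Proof.
intros Hb (rho & r & Ht & t & t0 & Et & Hx).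
destruct (continuity_ab_min rho 0 t t0) as (m & Hm & Im).
  intros s Hs; apply (traj_cont beta rho r); auto; lra.
assert (Hx' := Hx m Im).
destruct (trajectory_near beta rho r t (Rmin (rho m) (exc beta rho r t))) as (d & d0 & Hd); auto; try lra.
  apply Rmin_glb_lt; lra.
exists d; split; auto; intros beta' Hb' Hbd.
destruct (trajectory_exists beta') as (rho' & r' & Ht'); [lra|].
exists rho', r'; split; auto; exists t; split; auto.
assert (Hd' := Hd beta' rho' r' ltac:(lra) Hbd Ht').
assert (X1 := Rmin_l (rho m) (exc beta rho r t)); assert (X2 := Rmin_r (rho m) (exc beta rho r t)).
split.
- destruct (Hd' t) as [_ Y]; [lra|]; apply Rabs_def2 in Y; lra.
- intros s Hs; destruct (Hd' s Hs) as [Y _]; apply Rabs_def2 in Y; specialize (Hm s Hs); lra.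
Qed.

(** By uniqueness both conditions concern one trajectory; at the earlier of the two times their
    signs clash. *)
Lemma falls_escapes_disjoint beta : b <= beta <= B -> falls beta -> escapes beta -> False.
Proof.
intros Hb (rho & r & Ht & t & t0 & xt & HE) (rho' & r' & Ht' & t' & t0' & Et' & Hx').
destruct trajectory_dependence as (C & k & _ & _ & Dep).
assert (Eq : forall s, 0 <= s -> rho s = rho' s /\ r s = r' s).
{ intros s Hs; assert (D := Dep beta beta rho r rho' r' ltac:(lra) ltac:(lra) Ht Ht' s Hs).
  rewrite Rminus_diag, pow_i, Rmult_0_l in D by lia.
  assert (P1 := pow2_ge_0 (r s - r' s)); assert (P2 := pow2_ge_0 (rho s - rho' s)).
  assert ((r s - r' s) ^ 2 = 0) by lra. assert ((rho s - rho' s) ^ 2 = 0) by lra.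
  split; nra. }
destruct (Rle_or_lt t t') as [l|l].
- specialize (Hx' t); destruct (Eq t t0); lra.
- specialize (HE t' ltac:(lra)); unfold exc in *; destruct (Eq t' t0') as [E1 E2].
  rewrite E1, E2 in HE; lra.
Qed.

(** The parameter is the supremum of those that fall. If it fell, so would slightly larger ones (it
    is not [B], which escapes); if it escaped, so would slightly smaller ones. *)
Theorem shooting : exists beta rho r, b <= beta <= B /\ trajectory beta rho r /\
  forall t, 0 <= t -> 0 < rho t /\ exc beta rho r t < 0.
Proof.
destruct (trajectory_exists b) as (xb & rb & Tb); [lra|].
assert (Fb : falls b).
{ exists xb, rb; split; auto; apply (low_end b xb rb); auto; lra. }
destruct (trajectory_exists B) as (xB & rB & TB); [lra|].
assert (EB : escapes B).
{ exists xB, rB; split; auto; apply (high_end B xB rB); auto; lra. }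
destruct (completeness (fun beta => b <= beta <= B /\ falls beta)) as [m [ub lub]].
  exists B; intros x [Hx _]; lra. exists b; split; auto; lra.
assert (m1 : b <= m) by (apply ub; split; auto; lra).
assert (m2 : m <= B) by (apply lub; intros x [Hx _]; lra).
destruct (trajectory_exists m) as (rho & r & Tm); [lra|].
destruct (trajectory_trichotomy m rho r ltac:(lra) Tm) as [H|[H|H]]; [exists m, rho, r; auto|exfalso..].
- assert (Fm : falls m) by (exists rho, r; auto).
  destruct (falls_open m) as (d & d0 & Hd); auto.
  destruct (Req_dec m B) as [e|n].
    subst m; apply (falls_escapes_disjoint B); auto; lra.
  set (m' := Rmin B (m + d / 2)).
  assert (X1 : m' <= B) by apply Rmin_l. assert (X2 : m' <= m + d / 2) by apply Rmin_r.
  assert (X3 : m < m') by (apply Rmin_glb_lt; lra).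
  assert (m' <= m); [|lra]. apply ub; split; [lra|]; apply Hd; [lra|rewrite Rabs_pos_eq; lra].
- assert (Em : escapes m) by (exists rho, r; auto).
  destruct (escapes_open m) as (d & d0 & Hd); auto.
  assert (m <= m - d); [|lra]. apply lub; intros x [Hx Fx].
  destruct (Rle_or_lt x (m - d)) as [|l]; auto; exfalso.
  assert (x <= m) by (apply ub; auto).
  apply (falls_escapes_disjoint x); auto; apply Hd; auto; apply Rabs_def1; lra.
Qed.

Theorem shooting_solution : exists beta rho r G W, b <= beta <= B /\
  local_solution g beta eps G W /\ r 0 = r0 /\ rho 0 = G (r0 ^ 2) /\
  forall t, 0 <= t -> 0 < rho t < 1 /\ 0 < r t < R1 /\
    derivable_pt_lim r t (rho t) /\ derivable_pt_lim rho t (rho_rhs g beta (rho t) (r t)) /\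
    excess g beta (rho t) (r t) < 0.
Proof.
destruct shooting as (beta & rho & r & Hb & Ht & H).
destruct (traj_init beta rho r Hb Ht) as (W0 & _ & B1 & _).
destruct (Ht) as (G & W & HL & _ & E1 & E2).
exists beta, rho, r, G, W; do 4 (split; [assumption|]); intros t t0.
destruct (traj_closed_phase beta rho r Hb Ht t t0) with (t := t)
  as (A1 & A2 & A3 & A4 & _ & _ & _ & _ & _ & D); [|lra|].
  intros s Hs; specialize (H s ltac:(lra)); lra.
destruct (H t t0) as [H1 H2]; unfold exc in H2; rewrite A3, A4 in H2.
split; [lra|split; [lra|split; [|split; auto]]].
now apply (traj_deriv beta rho r Ht).
Qed.

End Shooting.

(** * Existence *)

(** Dividing [rho'] by [G = r'] gives the slope [d rho / d r] of the curve. *)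
Lemma local_solution_curve g beta eps G W x : local_solution g beta eps G W ->
  0 < x -> x ^ 2 < eps ->
  1 / 2 < G (x ^ 2) < 1 /\ sqrt (1 - G (x ^ 2) ^ 2) = x / W (x ^ 2) /\
  excess g beta (G (x ^ 2)) x < 0 /\
  derivable_pt_lim (fun y => G (y ^ 2)) x (rho_rhs g beta (G (x ^ 2)) x / G (x ^ 2)).
Proof.
intros (_ & _ & H) x0 Hx; assert (x2 : 0 < x ^ 2) by now apply pow_lt.
destruct (H (x ^ 2)) as (G1 & W1 & G2 & Ex & DG & _); [rewrite Rabs_pos_eq; lra|].
set (Gx := G (x ^ 2)) in *; set (Wx := W (x ^ 2)) in *.
assert (W2 : 0 < Wx ^ 2) by (apply pow_lt; lra).
assert (q0 : 0 < x ^ 2 / Wx ^ 2) by now apply Rdiv_lt_0_compat.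
assert (SE : sqrt (1 - Gx ^ 2) = x / Wx).
{ rewrite G2; replace (1 - (1 - x ^ 2 / Wx ^ 2)) with ((x / Wx) ^ 2) by (field; lra).
  apply sqrt_pow2; apply Rdiv_le_0_compat; lra. }
assert (EE : excess g beta Gx x = -1 + (beta * x ^ 2 * g (x ^ 2) + Gx) / Wx).
{ unfold excess; rewrite SE; field; lra. }
split; [split; [lra|nra]|split; [exact SE|split]].
- rewrite EE; assert ((beta * x ^ 2 * g (x ^ 2) + Gx) / Wx < 1) by (apply Rlt_div_l; lra); lra.
- eapply dl_eq; [apply (dl_comp (fun y => y ^ 2) G); [dl|exact DG]|].
  rewrite rho_rhs_excess, EE, G2; simpl; field; lra.
Qed.

Lemma local_solution_G_decr g beta eps G W u v : local_solution g beta eps G W ->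
  0 <= u <= v -> v < eps -> G v <= G u.
Proof.
intros (_ & _ & H) Huv Hv.
apply (dl_nonpos_decr G (fun u => 3 / 4 / (G u * W u ^ 2) * (-1 + (beta * u * g u + G u) / W u))); [lra| |].
- intros x Hx; apply H; rewrite Rabs_pos_eq; lra.
- intros x Hx; destruct (H x) as (G1 & W1 & _ & Ex & _); [rewrite Rabs_pos_eq; lra|].
  assert ((beta * x * g x + G x) / W x <= 1) by (apply Rle_div_l; lra).
  assert (0 < 3 / 4 / (G x * W x ^ 2)).
  { apply Rdiv_lt_0_compat; [lra|]; apply Rmult_lt_0_compat; [lra|apply pow_lt; lra]. }
  nra.
Qed.

(** The parameter [s] is recovered by solving [r' = G (r^2)] from [r = 0], with the argument clamped
    to [[0, r0]]. Since [G > 1/2], the radius [r0] is reached by time [2 r0]. *)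
Lemma local_solution_arc g beta eps G W r0 : 0 <= beta -> eps <= / 48 ->
  (forall v, 0 <= v -> 0 <= g v) -> local_solution g beta eps G W -> 0 < r0 -> r0 ^ 2 < eps ->
  exists r s1, 0 < s1 /\ r 0 = 0 /\ r s1 = r0 /\
    (forall s, 0 <= s <= s1 -> derivable_pt_lim r s (G (r s ^ 2))) /\
    (forall s, 0 < s <= s1 -> 0 < r s) /\ (forall s, 0 <= s < s1 -> r s < r0).
Proof.
intros Hb He Hg HL r00 r0e.
assert (H := proj2 (proj2 HL)).
assert (r2 : r0 ^ 2 <= / 48) by lra.
assert (r1 : r0 <= 1 / 2) by nra.
assert (Dq : forall x, 0 <= x <= r0 -> Rabs (x ^ 2) < eps).
{ intros x Hx; rewrite Rabs_pos_eq by apply pow2_ge_0; assert (x ^ 2 <= r0 ^ 2) by (apply pow_incr; lra); lra. }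
assert (Lip : forall x y, 0 <= x <= r0 -> 0 <= y <= r0 -> Rabs (G (x ^ 2) - G (y ^ 2)) <= 1 * Rabs (x - y)).
{ apply (lip_of_deriv (fun x => G (x ^ 2)) (fun x => 3 / 4 / (G (x ^ 2) * W (x ^ 2) ^ 2) *
     (-1 + (beta * x ^ 2 * g (x ^ 2) + G (x ^ 2)) / W (x ^ 2)) * (2 * x))).
  - intros x Hx; destruct (H (x ^ 2) (Dq x Hx)) as (_ & _ & _ & _ & DG & _).
    eapply dl_eq; [apply (dl_comp (fun y => y ^ 2) G); [dl|exact DG]|simpl; ring].
  - intros x Hx; destruct (H (x ^ 2) (Dq x Hx)) as (G1 & W1 & _ & Ex & _ & _).
    set (u := x ^ 2) in *.
    assert (0 <= beta * u * g u).
    { assert (0 <= u) by apply pow2_ge_0. apply Rmult_le_pos; [now apply Rmult_le_pos|now apply Hg]. }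
    assert (P1 : 0 <= (beta * u * g u + G u) / W u) by (apply Rdiv_le_0_compat; lra).
    assert (P2 : (beta * u * g u + G u) / W u <= 1) by (apply Rle_div_l; lra).
    assert (P3 : 1 <= G u * W u ^ 2) by (assert (4 <= W u ^ 2) by nra; nra).
    assert (P4 : 0 <= 3 / 4 / (G u * W u ^ 2)) by (apply Rdiv_le_0_compat; lra).
    assert (P5 : 3 / 4 / (G u * W u ^ 2) <= 3 / 4) by (apply Rle_div_l; lra).
    rewrite !Rabs_mult, (Rabs_pos_eq (3 / 4 / _)), (Rabs_pos_eq 2), (Rabs_pos_eq x) by lra.
    set (q := (beta * u * g u + G u) / W u) in *.
    assert (P6 : Rabs (-1 + q) <= 1) by (apply Rabs_le_between; lra).
    assert (P7 := Rabs_pos (-1 + q)).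
    apply Rle_trans with (3 / 4 * 1 * (2 * (1 / 2))); [|lra].
    apply Rmult_le_compat; try lra; [now apply Rmult_le_pos|now apply Rmult_le_compat]. }
(* A scalar equation in the planar setting: the second component is constant. *)
set (F := fun (i : bool) (a : bool -> R) => if i then G (clamp 0 r0 (a true) ^ 2) else 0).
destruct (picard F 1 (fun _ => 0)) as [x Hx]; [lra| |].
{ intros [|] a b d Hd; simpl.
  - eapply Rle_trans; [apply Lip; apply clamp_bounds; lra|].
    rewrite !Rmult_1_l; eapply Rle_trans; [apply clamp_lip|apply Hd].
  - rewrite Rminus_diag, Rabs_R0, Rmult_1_l; eapply Rle_trans; [|apply (Hd true)]; apply Rabs_pos. }
destruct (Hx true) as [x00 Dx]; set (r := x true) in *; simpl in Dx.
change (forall t, 0 <= t -> derivable_pt_lim r t (G (clamp 0 r0 (r t) ^ 2))) in Dx.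
assert (Gc : forall t, 1 / 2 < G (clamp 0 r0 (r t) ^ 2)).
{ intros t; apply H, Dq, clamp_bounds; lra. }
assert (grow : forall t, 0 <= t -> t / 2 <= r t).
{ intros t Ht.
  assert (A : r 0 - 1 / 2 * 0 <= r t - 1 / 2 * t).
  { apply (dl_nonneg_incr (fun t => r t - 1 / 2 * t) (fun t => G (clamp 0 r0 (r t) ^ 2) - 1 / 2)); auto.
    - intros s Hs; assert (D := Dx s ltac:(lra)); eapply dl_eq; [dl|simpl; ring].
    - intros s Hs; specialize (Gc s); lra. }
  lra. }
destruct (first_zero (fun t => r0 - r t) 0 (2 * r0)) as (s1 & Hs1 & Z & P).
- lra.
- intros s Hs; apply continuity_pt_minus; [apply continuity_pt_const; now intros ? ?|].
  apply (dl_cont _ _ _ (Dx s ltac:(lra))).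
- lra.
- specialize (grow (2 * r0)); lra.
- exists r, s1; split; [lra|]; split; auto; split; [lra|]; split; [|split].
  + intros s Hs; replace (G (r s ^ 2)) with (G (clamp 0 r0 (r s) ^ 2)); [apply Dx; lra|].
    rewrite clamp_id; auto; specialize (grow s); split; [lra|].
    destruct (Req_dec s s1) as [->|n]; [lra|]; specialize (P s); lra.
  + intros s Hs; specialize (grow s); lra.
  + intros s Hs; specialize (P s Hs); lra.
Qed.

Lemma lim_right0_of_cont f h d : 0 < d -> continuity_pt h 0 ->
  (forall s, 0 < s < d -> f s = h s) -> lim_right0 f (h 0).
Proof.
intros d0 C Hf e He; destruct (cont_eps h 0 e C He) as [d1 [d10 H]].
exists (Rmin d d1); split; [now apply Rmin_glb_lt|]; intros s Hs.
assert (X1 := Rmin_l d d1); assert (X2 := Rmin_r d d1).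
rewrite Hf by lra; apply H; rewrite Rminus_0_r, Rabs_pos_eq; lra.
Qed.

(** [r] is increasing and bounded; a positive lower bound for [rho] would drive it beyond [R1]. *)
Lemma monotone_limits rho r R1 :
  (forall s, 0 < s -> 0 < rho s /\ 0 < r s < R1 /\ derivable_pt_lim r s (rho s) /\
     exists l, derivable_pt_lim rho s l /\ l < 0) ->
  lim_infty rho 0 /\ exists r_inf, 0 < r_inf /\ lim_infty r r_inf.
Proof.
intros H.
assert (ex : exists df, forall s, 0 < s -> derivable_pt_lim rho s (df s) /\ df s < 0).
{ exists (Derive rho); intros s Hs; destruct (H s Hs) as (_ & _ & _ & l & D & Hl).
  replace (Derive rho s) with l; auto; symmetry; now apply is_derive_unique, is_derive_Reals. }
destruct ex as [df Hdf].
assert (decr : forall s t, 0 < s <= t -> rho t <= rho s).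
{ intros s t Hst; apply (dl_nonpos_decr rho df); [lra| |]; intros x Hx; [|left]; apply Hdf; lra. }
assert (incr : forall s t, 0 < s <= t -> r s <= r t).
{ intros s t Hst; apply (dl_nonneg_incr r rho); [lra| |]; intros x Hx; [|left]; apply H; lra. }
split.
- intros e He.
  assert (0 < R1) by (destruct (H 1 ltac:(lra)); lra).
  assert (T0 : 0 < R1 / e) by (apply Rdiv_lt_0_compat; lra).
  exists (1 + R1 / e); intros s Hs; destruct (H s ltac:(lra)) as [P _].
  rewrite Rminus_0_r, Rabs_pos_eq by lra.
  destruct (Rlt_or_le (rho s) e) as [|n]; auto; exfalso.
  assert (A : r 1 - e * 1 <= r s - e * s).
  { apply (dl_nonneg_incr (fun t => r t - e * t) (fun t => rho t - e)); [lra| |].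
    - intros t Ht; destruct (H t ltac:(lra)) as (_ & _ & D & _); eapply dl_eq; [dl|simpl; ring].
    - intros t Ht; specialize (decr t s); lra. }
  destruct (H 1 ltac:(lra)) as (_ & B1 & _); destruct (H s ltac:(lra)) as (_ & B2 & _).
  assert (e * (R1 / e) = R1) by (field; lra). nra.
- destruct (completeness (fun y => exists s, 0 < s /\ y = r s)) as [m [ub lub]].
    exists R1; intros y (s & Hs & ->); destruct (H s Hs); lra.
    exists (r 1), 1; split; auto; lra.
  exists m; split.
  + apply Rlt_le_trans with (r 1); [apply H; lra|apply ub; exists 1; split; auto; lra].
  + intros e He.
    destruct (Classical_Prop.classic (exists s, 0 < s /\ m - e < r s)) as [(s & Hs & Hrs)|n].
    * exists s; intros t Ht; assert (r s <= r t) by (apply incr; lra).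
      assert (r t <= m) by (apply ub; exists t; split; auto; lra).
      apply Rabs_def1; lra.
    * exfalso; assert (m <= m - e); [|lra]; apply lub; intros y (s & Hs & ->).
      destruct (Rle_or_lt (r s) (m - e)) as [|l]; auto; exfalso; apply n; now exists s.
Qed.

(** (S1) and (S2) are read off the arc near the axis, with [eta0 = / W 0 = 1/3]; (S3) and (S4)
    follow from E < 0 on both pieces. *)
Theorem glued_solution g beta eps G W r0 R1 rho r : 0 <= beta -> 0 < eps <= / 48 ->
  (forall v, 0 <= v -> 0 <= g v) -> local_solution g beta eps G W -> 0 < r0 < R1 -> r0 ^ 2 < eps ->
  r 0 = r0 -> rho 0 = G (r0 ^ 2) ->
  (forall t, 0 <= t -> 0 < rho t < 1 /\ 0 < r t < R1 /\
    derivable_pt_lim r t (rho t) /\ derivable_pt_lim rho t (rho_rhs g beta (rho t) (r t)) /\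
    excess g beta (rho t) (r t) < 0) ->
  exists rho' r', toy_steady_tip_growth g beta rho' r'.
Proof.
intros Hb He Hg HL r00 r0e rE rhoE Hflow.
destruct (local_solution_arc g beta eps G W r0) as (q & s1 & s10 & q0 & qs1 & Dq & qpos & qlt); auto; try lra.
set (ro := fun s => if Rle_dec s s1 then G (q s ^ 2) else rho (s - s1)).
set (ra := fun s => if Rle_dec s s1 then q s else r (s - s1)).
assert (qle : forall s, 0 <= s <= s1 -> q s <= r0).
{ intros s Hs; destruct (Req_dec s s1) as [->|n]; [lra|]; left; apply qlt; lra. }
assert (q2 : forall s, 0 < s <= s1 -> q s ^ 2 < eps).
{ intros s Hs; assert (q s ^ 2 <= r0 ^ 2) by (apply pow_incr; split; [left; apply qpos|apply qle]; lra); lra. }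
assert (DG : forall s, 0 < s <= s1 -> derivable_pt_lim (fun t => G (q t ^ 2)) s (rho_rhs g beta (G (q s ^ 2)) (q s))).
{ intros s Hs; destruct (local_solution_curve g beta eps G W (q s)) as (G1 & _ & _ & D); auto.
  eapply dl_eq; [apply (dl_comp q (fun y => G (y ^ 2))); [apply Dq; lra|exact D]|field; lra]. }
assert (Dshift : forall f s l, derivable_pt_lim f (s - s1) l -> derivable_pt_lim (fun t => f (t - s1)) s l).
{ intros f s l D; eapply dl_eq; [apply (dl_comp (fun t => t - s1) f); [dl|exact D]|ring]. }
assert (HS : forall s, 0 < s -> 0 < ro s < 1 /\ 0 < ra s < R1 /\ derivable_pt_lim ra s (ro s) /\
    derivable_pt_lim ro s (rho_rhs g beta (ro s) (ra s)) /\ excess g beta (ro s) (ra s) < 0).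
{ intros s Hs; destruct (Rtotal_order s s1) as [l|[->|l]].
  - destruct (local_solution_curve g beta eps G W (q s)) as (G1 & _ & Ex & D); auto; [apply qpos; lra|apply q2; lra|].
    assert (qp := qpos s ltac:(lra)); assert (ql := qlt s ltac:(lra)).
    assert (ros : ro s = G (q s ^ 2)) by (unfold ro; destruct Rle_dec; lra).
    assert (ras : ra s = q s) by (unfold ra; destruct Rle_dec; lra).
    rewrite ros, ras; split; [lra|]; split; [lra|]; split; [|split; auto].
    + apply (dl_ext_loc q ra s _ (s1 - s)); [lra| |apply Dq; lra].
      intros y Hy; apply Rabs_def2 in Hy; unfold ra; destruct Rle_dec; lra.
    + apply (dl_ext_loc (fun t => G (q t ^ 2)) ro s _ (s1 - s)); [lra| |apply DG; lra].
      intros y Hy; apply Rabs_def2 in Hy; unfold ro; destruct Rle_dec; lra.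
  - destruct (local_solution_curve g beta eps G W (q s1)) as (G1 & _ & Ex & D); auto; [apply qpos; lra|apply q2; lra|].
    destruct (Hflow 0 (Rle_refl _)) as (_ & _ & D1 & D2 & _).
    assert (ros : ro s1 = G (q s1 ^ 2)) by (unfold ro; destruct Rle_dec; lra).
    assert (ras : ra s1 = q s1) by (unfold ra; destruct Rle_dec; lra).
    rewrite rE, rhoE, <- qs1 in D2; rewrite rhoE, <- qs1 in D1.
    rewrite ros, ras; split; [lra|]; split; [lra|]; split; [|split; auto].
    + apply (dl_glue q (fun t => r (t - s1))); [rewrite Rminus_diag; lra|apply Dq; lra|].
      apply Dshift; now rewrite Rminus_diag.
    + apply (dl_glue (fun t => G (q t ^ 2)) (fun t => rho (t - s1))); [rewrite Rminus_diag, qs1; lra|apply DG; lra|].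
      apply Dshift; now rewrite Rminus_diag.
  - destruct (Hflow (s - s1)) as (P1 & P2 & D1 & D2 & Ex); [lra|].
    assert (ros : ro s = rho (s - s1)) by (unfold ro; destruct Rle_dec; lra).
    assert (ras : ra s = r (s - s1)) by (unfold ra; destruct Rle_dec; lra).
    rewrite ros, ras; split; [lra|]; split; [lra|]; split; [|split; auto].
    + apply (dl_ext_loc (fun t => r (t - s1)) ra s _ (s - s1)); [lra| |now apply Dshift].
      intros y Hy; apply Rabs_def2 in Hy; unfold ra; destruct Rle_dec; lra.
    + apply (dl_ext_loc (fun t => rho (t - s1)) ro s _ (s - s1)); [lra| |now apply Dshift].
      intros y Hy; apply Rabs_def2 in Hy; unfold ro; destruct Rle_dec; lra. }
assert (neg : forall s, 0 < s -> rho_rhs g beta (ro s) (ra s) < 0).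
{ intros s Hs; destruct (HS s Hs) as (P1 & P2 & _ & _ & Ex); rewrite rho_rhs_excess.
  assert (0 < 3 / 2 * ((1 - ro s ^ 2) / ra s)); [|nra].
  apply Rmult_lt_0_compat; [lra|]; apply Rdiv_lt_0_compat; [apply one_minus_sq_pos|]; lra. }
assert (Dq0 := Dq 0 ltac:(lra)).
assert (Cq : continuity_pt (fun t => q t ^ 2) 0) by (eapply dl_cont; dl).
assert (q00 : q 0 ^ 2 = 0) by (rewrite q0; ring).
assert (z : Rabs 0 < eps) by (rewrite Rabs_R0; lra).
exists ro, ra; split; [|split; [|split; [|split]]].
- intros s Hs; destruct (HS s Hs) as (P1 & P2 & D1 & D2 & _); repeat split; auto; lra.
- split; [|split].
  + replace 1 with (G (q 0 ^ 2)) by (rewrite q00; apply (local_solution_0 g beta eps G W); auto; lra).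
    apply (lim_right0_of_cont ro (fun t => G (q t ^ 2)) s1); auto.
    * apply (continuity_pt_comp (fun t => q t ^ 2) G); auto; rewrite q00.
      destruct (proj2 (proj2 HL) 0 z) as (_ & _ & _ & _ & D & _); apply (dl_cont _ _ _ D).
    * intros s Hs; unfold ro; destruct Rle_dec; lra.
  + replace 0 with (q 0); apply (lim_right0_of_cont ra q s1); auto.
    * apply (dl_cont _ _ _ Dq0).
    * intros s Hs; unfold ra; destruct Rle_dec; lra.
  + exists (/ W (q 0 ^ 2)); rewrite q00 at 1; split.
      destruct HL as (_ & W0 & _); rewrite W0; lra.
    apply (lim_right0_of_cont _ (fun t => / W (q t ^ 2)) s1); auto.
    * apply continuity_pt_inv.
      -- apply (continuity_pt_comp (fun t => q t ^ 2) W); auto; rewrite q00.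
         destruct (local_solution_Derive g beta eps G W 0 HL z) as [D _]; apply (dl_cont _ _ _ D).
      -- rewrite q00; destruct HL as (_ & W0 & _); rewrite W0; lra.
    * intros s Hs; destruct (local_solution_curve g beta eps G W (q s)) as (_ & SE & _); auto; [apply qpos; lra|apply q2; lra|].
      replace (ro s) with (G (q s ^ 2)) by (unfold ro; destruct Rle_dec; lra).
      replace (ra s) with (q s) by (unfold ra; destruct Rle_dec; lra).
      assert (qp := qpos s ltac:(lra)).
      assert (Wp : 2 < W (q s ^ 2)).
      { apply (proj2 (proj2 HL)); rewrite Rabs_pos_eq by apply pow2_ge_0; apply q2; lra. }
      rewrite SE; field; lra.
(* With [s0 = s1] one has [a = r0^2 < eps], inside the domain of the local solution. *)
- exists s1, G; split; auto.
  assert (ras : ra s1 = r0) by (unfold ra; destruct Rle_dec; lra).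
  cbv zeta; rewrite ras; split; [|split].
  + intros x Hx; apply (proj1 HL); lra.
  + intros x Hx; assert (Xe : Rabs x < eps) by (apply Rabs_def1; lra).
    destruct (proj2 (proj2 HL) x Xe) as (G1 & _); lra.
  + intros s Hs; unfold ro, ra; destruct Rle_dec; lra.
- intros s Hs; destruct (HS s Hs) as (P1 & P2 & D1 & D2 & _); split; [|lra].
  intros l Dl; rewrite (dl_unique _ _ _ _ Dl D2); auto.
- apply (monotone_limits ro ra R1); intros s Hs; destruct (HS s Hs) as (P1 & P2 & D1 & D2 & _).
  split; [lra|]; split; [lra|]; split; auto; eexists; split; [exact D2|auto].
Qed.

(** * Uniqueness *)

(* With [delta = w - W(r^2)], the function [r delta^4] is nonincreasing near 0
   and tends to 0 there. *)
Lemma toy_solution_on_curve g beta eps G W rho r eta0 : 0 < eps <= / 48 ->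
  local_solution g beta eps G W -> toy_solution_on_pos g beta rho r ->
  lim_right0 rho 1 -> lim_right0 r 0 -> 0 < eta0 ->
  lim_right0 (fun s => sqrt (1 - rho s ^ 2) / r s) eta0 ->
  exists s1, 0 < s1 /\ forall s, 0 < s < s1 -> r s ^ 2 < eps /\ rho s = G (r s ^ 2).
Proof.
intros He HL Hsol L1 L2 eta00 L3.
(* [X] bounds [x y^2 + y x^2] for [x = / w < 2 eta0] and [y = / W < 1]; then [r < / (6 (1 + X))]
   brings the factor [k] below 1/6. *)
set (X := 2 * eta0 + (2 * eta0) ^ 2).
assert (X0 : 0 < X) by (unfold X; nra).
set (e2 := Rmin eps (/ (6 * (1 + X)))).
assert (e20 : 0 < e2) by (apply Rmin_glb_lt; [lra|apply Rinv_0_lt_compat; lra]).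
assert (e2a : e2 <= eps) by apply Rmin_l. assert (e2b : e2 <= / (6 * (1 + X))) by apply Rmin_r.
destruct (L1 (1 / 2)) as (d1 & d10 & H1); [lra|].
destruct (L2 e2) as (d2 & d20 & H2); auto.
destruct (L3 (eta0 / 2)) as (d3 & d30 & H3); [lra|].
set (s1 := Rmin d1 (Rmin d2 d3)).
assert (s10 : 0 < s1) by (repeat apply Rmin_glb_lt; auto).
assert (s1a : s1 <= d1) by apply Rmin_l.
assert (s1b : s1 <= d2) by (eapply Rle_trans; [apply Rmin_r|apply Rmin_l]).
assert (s1c : s1 <= d3) by (eapply Rle_trans; [apply Rmin_r|apply Rmin_r]).
set (w := fun s => r s / sqrt (1 - rho s ^ 2)).
assert (Bd : forall s, 0 < s < s1 -> 1 / 2 < rho s < 1 /\ 0 < r s < e2 /\ r s ^ 2 < eps /\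
  0 < w s /\ eta0 / 2 < / w s < 3 / 2 * eta0).
{ intros s Hs; destruct (Hsol s) as (P1 & P2 & _); [lra|].
  specialize (H1 s ltac:(lra)); specialize (H2 s ltac:(lra)); specialize (H3 s ltac:(lra)).
  apply Rabs_def2 in H1; apply Rabs_def2 in H2; apply Rabs_def2 in H3.
  assert (S0 : 0 < sqrt (1 - rho s ^ 2)) by (apply sqrt_lt_R0, one_minus_sq_pos; lra).
  assert (w0 : 0 < w s) by (now apply Rdiv_lt_0_compat).
  assert (wi : / w s = sqrt (1 - rho s ^ 2) / r s) by (unfold w; field; lra).
  rewrite wi; repeat split; try lra; nra. }
assert (Wb : forall s, 0 < s < s1 -> 2 < W (r s ^ 2) < 4 /\ 1 / 2 < G (r s ^ 2) /\
   G (r s ^ 2) ^ 2 = 1 - r s ^ 2 / W (r s ^ 2) ^ 2).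
{ intros s Hs; destruct (Bd s Hs) as (B1 & B2 & B3 & _).
  destruct (proj2 (proj2 HL) (r s ^ 2)) as (G1 & W1 & G2 & _); auto.
  rewrite Rabs_pos_eq; auto using pow2_ge_0. }
set (delta := fun s => w s - W (r s ^ 2)).
assert (Diff : forall s, 0 < s < s1 -> exists k, 0 <= k <= / 6 /\ rho s - G (r s ^ 2) = k * delta s).
{ intros s Hs; destruct (Bd s Hs) as (B1 & B2 & B3 & w0 & B4); destruct (Wb s Hs) as (W1 & G1 & G2).
  set (V := W (r s ^ 2)) in *; set (Gs := G (r s ^ 2)) in *.
  assert (S2 : rho s ^ 2 = 1 - r s ^ 2 / w s ^ 2).
  { assert (S0 : 0 < sqrt (1 - rho s ^ 2)) by (apply sqrt_lt_R0, one_minus_sq_pos; lra).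
    unfold w; replace (r s ^ 2 / (r s / sqrt (1 - rho s ^ 2)) ^ 2) with (sqrt (1 - rho s ^ 2) ^ 2) by (field; lra).
    rewrite pow2_sqrt; [ring|left; apply one_minus_sq_pos; lra]. }
  exists (r s ^ 2 * (/ w s * / V ^ 2 + / V * (/ w s) ^ 2) / (rho s + Gs)).
  assert (iV : 0 < / V < / 2) by (split; [apply Rinv_0_lt_compat; lra|apply Rinv_lt_contravar; lra]).
  set (x := / w s) in *; set (y := / V) in *.
  assert (K : 0 <= x * / V ^ 2 + y * x ^ 2 <= X).
  { replace (/ V ^ 2) with (y ^ 2) by (unfold y; field; lra).
    assert (y ^ 2 <= 1) by nra. assert (0 <= y ^ 2) by apply pow2_ge_0.
    assert (x ^ 2 <= (2 * eta0) ^ 2) by (apply pow_incr; lra). assert (0 <= x ^ 2) by apply pow2_ge_0.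
    unfold X; split; nra. }
  split; [split|].
  - apply Rdiv_le_0_compat; [apply Rmult_le_pos; [apply pow2_ge_0|lra]|lra].
  - apply Rle_div_l; [lra|].
    apply Rle_trans with (r s * X).
    + apply Rmult_le_compat; [apply pow2_ge_0|lra| |lra]; nra.
    + apply Rle_trans with (/ (6 * (1 + X)) * X); [apply Rmult_le_compat_r; lra|].
      apply Rle_trans with (/ 6 * 1); [|lra].
      rewrite Rinv_mult, Rmult_assoc; apply Rmult_le_compat_l; [lra|].
      rewrite Rmult_comm; apply Rle_div_l; lra.
  - assert (E : (rho s - Gs) * (rho s + Gs) = r s ^ 2 * (/ V ^ 2 - / w s ^ 2)).
    { replace ((rho s - Gs) * (rho s + Gs)) with (rho s ^ 2 - Gs ^ 2) by ring.
      rewrite S2, G2; field; lra. }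
    apply (Rmult_eq_reg_r (rho s + Gs)); [|lra]; rewrite E.
    unfold delta, x, y; fold V; field; lra. }
(* For [k = 0], [delta] behaves like [r^(-1/2)]. With [k <= 1/6] the exponent is still at most -1/4,
   which the power 4 balances exactly against the factor [r]. *)
set (Phi := fun s => r s * delta s ^ 4).
assert (Dphi : forall s, 0 < s < s1 -> exists l, derivable_pt_lim Phi s l /\ l <= 0).
{ intros s Hs; destruct (Bd s Hs) as (B1 & B2 & B3 & w0 & B4); destruct (Wb s Hs) as (W1 & G1 & G2).
  destruct (Hsol s) as (P1 & P2 & D1 & D2); [lra|].
  destruct (local_solution_Derive g beta eps G W (r s ^ 2) HL) as [DW EW].
    rewrite Rabs_pos_eq; auto using pow2_ge_0.
  destruct (Diff s Hs) as (k & Hk & Ek).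
  assert (Dw := meridian_deriv g beta rho r s P1 P2 D1 D2).
  fold (w s) in Dw.
  assert (Dd : derivable_pt_lim delta s (rho s / r s * (- (1 / 2) + 3 / 2 * k) * delta s)).
  { eapply dl_eq; [apply dl_minus; [exact Dw|apply (dl_comp (fun t => r t ^ 2) W); [dl|exact DW]]|].
    apply (Rmult_eq_reg_r (r s)); [|lra].
    transitivity (rho s * (- w s / 2 + 3 / 2 * (beta * r s ^ 2 * g (r s ^ 2) + rho s)) -
                  2 * rho s * (r s ^ 2 * Derive W (r s ^ 2))); [simpl; field; lra|].
    rewrite EW.
    replace (rho s / r s * (- (1 / 2) + 3 / 2 * k) * delta s * r s)
      with (rho s * (- (1 / 2) * delta s + 3 / 2 * (k * delta s))) by (field; lra).
    rewrite <- Ek; unfold delta; field. }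
  exists (rho s * (-1 + 6 * k) * delta s ^ 4); split.
  - unfold Phi; eapply dl_eq; [apply dl_mult; [exact D2|apply dl_pow; exact Dd]|simpl; field; lra].
  - assert (0 <= delta s ^ 4) by (replace (delta s ^ 4) with ((delta s ^ 2) ^ 2) by ring; apply pow2_ge_0).
    assert (rho s * (-1 + 6 * k) <= 0) by nra. nra. }
assert (Mono : forall s t, 0 < s <= t -> t < s1 -> Phi t <= Phi s).
{ intros s t Hst Ht; apply (dl_nonpos_decr Phi (Derive Phi)); [lra| |]; intros x Hx;
    destruct (Dphi x) as (l & D & Hl); try lra;
    assert (El : Derive Phi x = l) by (now apply is_derive_unique, is_derive_Reals); now rewrite El. }
(* [|delta| <= D] near 0, from [/ w > eta0 / 2] and [W < 4]; so [Phi] tends to 0 with [r]. *)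
set (D := 2 / eta0 + 4).
assert (D0 : 0 < D) by (assert (0 < 2 / eta0) by (apply Rdiv_lt_0_compat; lra); unfold D; lra).
assert (D4 : 0 < D ^ 4) by now apply pow_lt.
exists s1; split; auto; intros s Hs; destruct (Bd s Hs) as (B1 & B2 & B3 & _).
split; auto.
assert (Pz : Phi s <= 0).
{ destruct (Rle_or_lt (Phi s) 0) as [|n]; auto; exfalso.
  destruct (L2 (Phi s / D ^ 4)) as (d & d0 & Hd); [now apply Rdiv_lt_0_compat|].
  set (t := Rmin d s / 2).
  assert (t0 : 0 < Rmin d s) by (apply Rmin_glb_lt; lra).
  assert (t1 := Rmin_l d s); assert (t2 := Rmin_r d s).
  assert (Ht : 0 < t < s1) by (unfold t; lra).
  specialize (Hd t ltac:(unfold t; lra)); rewrite Rminus_0_r in Hd; apply Rabs_def2 in Hd.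
  destruct (Bd t Ht) as (C1 & C2 & C3 & C4 & C5); destruct (Wb t Ht) as (V1 & _).
  assert (wD : w t <= 2 / eta0).
  { rewrite <- (Rinv_inv (w t)); replace (2 / eta0) with (/ (eta0 / 2)) by (field; lra).
    apply Rinv_le_contravar; lra. }
  assert (dD : delta t ^ 4 <= D ^ 4).
  { assert (A4 : Rabs (delta t) ^ 4 = delta t ^ 4).
    { rewrite RPow_abs; apply Rabs_pos_eq; replace (delta t ^ 4) with ((delta t ^ 2) ^ 2) by ring; apply pow2_ge_0. }
    rewrite <- A4.
    apply pow_incr; split; [apply Rabs_pos|]; apply Rabs_le_between; unfold delta, D.
    assert (0 < 2 / eta0) by (apply Rdiv_lt_0_compat; lra). lra. }
  assert (M := Mono t s ltac:(unfold t; lra) ltac:(lra)).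
  assert (Phi t <= r t * D ^ 4) by (apply Rmult_le_compat_l; lra).
  assert (r t * D ^ 4 < Phi s).
  { replace (Phi s) with (Phi s / D ^ 4 * D ^ 4) by (field; lra). apply Rmult_lt_compat_r; lra. }
  lra. }
assert (dz : delta s = 0).
{ destruct (Req_dec (delta s) 0) as [|n]; auto; exfalso.
  assert (0 < (delta s ^ 2) ^ 2).
  { assert (0 < delta s ^ 2) by (assert (Q := pow2_ge_0 (delta s)); assert (delta s ^ 2 <> 0) by (now apply pow_nonzero); lra).
    now apply pow_lt. }
  assert (Phi s = r s * (delta s ^ 2) ^ 2) by (unfold Phi; ring). nra. }
destruct (Diff s Hs) as (k & _ & Ek); rewrite dz, Rmult_0_r in Ek; lra.
Qed.

Lemma toy_monotone g beta rho r : toy_steady_tip_growth g beta rho r ->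
  (forall s t, 0 < s <= t -> rho t <= rho s) /\ (forall s t, 0 < s <= t -> r s <= r t) /\
  exists R1, forall s, 0 < s -> r s <= R1.
Proof.
intros (Hsol & _ & _ & S3 & _ & r_inf & _ & Lr).
assert (incr : forall s t, 0 < s <= t -> r s <= r t).
{ intros s t Hst; apply (dl_nonneg_incr r rho); [lra| |]; intros x Hx.
  - apply Hsol; lra.
  - left; apply S3; lra. }
split; [|split; auto].
- intros s t Hst.
  apply (dl_nonpos_decr rho (fun x => rho_rhs g beta (rho x) (r x))); [lra| |]; intros x Hx.
  + apply Hsol; lra.
  + left; apply (proj1 (S3 x ltac:(lra))), Hsol; lra.
- destruct (Lr 1 Rlt_0_1) as [S HS]; exists (r_inf + 1); intros s Hs.
  set (t := Rmax s (S + 1)).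
  assert (t1 : s <= t) by apply Rmax_l. assert (t2 : S + 1 <= t) by apply Rmax_r.
  specialize (HS t ltac:(lra)); apply Rabs_def2 in HS; specialize (incr s t); lra.
Qed.

(** Near 0 both radii solve [r' = G (r^2)] with [G] nonincreasing, so [(r1 - r2)^2] does not
    increase; it tends to 0 at [s = 0] and thus vanishes. From then on both are trajectories of one
    clamped flow with equal data. *)
Theorem toy_uniqueness g g1 B beta eps G W rho1 r1 rho2 r2 : 0 <= beta <= B -> 0 < eps <= / 48 ->
  (forall x, derivable_pt_lim g x (g1 x)) -> (forall x, continuity_pt g1 x) ->
  local_solution g beta eps G W ->
  toy_steady_tip_growth g beta rho1 r1 -> toy_steady_tip_growth g beta rho2 r2 ->
  forall s, 0 < s -> rho1 s = rho2 s /\ r1 s = r2 s.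
Proof.
intros Hb He Hg Hg1 HL T1 T2.
destruct (toy_monotone _ _ _ _ T1) as (dec1 & inc1 & R1 & bd1).
destruct (toy_monotone _ _ _ _ T2) as (dec2 & inc2 & R2 & bd2).
destruct T1 as (Hs1 & (A1 & A2 & e1 & e10 & A3) & _ & S31 & _).
destruct T2 as (Hs2 & (B1 & B2 & e2 & e20 & B3) & _ & S32 & _).
destruct (toy_solution_on_curve g beta eps G W rho1 r1 e1) as (s1 & s10 & H1); auto.
destruct (toy_solution_on_curve g beta eps G W rho2 r2 e2) as (s2 & s20 & H2); auto.
set (sm := Rmin s1 s2).
assert (sm0 : 0 < sm) by (now apply Rmin_glb_lt).
assert (sma : sm <= s1) by apply Rmin_l. assert (smb : sm <= s2) by apply Rmin_r.
assert (near : forall s, 0 < s < sm -> rho1 s = rho2 s /\ r1 s = r2 s).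
{ intros s Hs.
  assert (Er : r1 s = r2 s).
  { enough ((r1 s - r2 s) ^ 2 <= 0) by (assert (Q := pow2_ge_0 (r1 s - r2 s)); nra).
    destruct (Rle_or_lt ((r1 s - r2 s) ^ 2) 0) as [|n]; auto; exfalso.
    (* With [e <= 1], radii below [e] differ in square by less than [e^2 <= e]. *)
    set (e := Rmin 1 ((r1 s - r2 s) ^ 2)).
    assert (ea : e <= 1) by apply Rmin_l. assert (eb : e <= (r1 s - r2 s) ^ 2) by apply Rmin_r.
    assert (e0 : 0 < e) by (apply Rmin_glb_lt; lra).
    destruct (A2 e e0) as (d1 & d10 & C1); destruct (B2 e e0) as (d2 & d20 & C2).
    set (t := Rmin s (Rmin d1 d2) / 2).
    assert (t0 : 0 < Rmin s (Rmin d1 d2)) by (repeat apply Rmin_glb_lt; lra).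
    assert (ta : Rmin s (Rmin d1 d2) <= s) by apply Rmin_l.
    assert (tb : Rmin s (Rmin d1 d2) <= d1) by (eapply Rle_trans; [apply Rmin_r|apply Rmin_l]).
    assert (tc : Rmin s (Rmin d1 d2) <= d2) by (eapply Rle_trans; [apply Rmin_r|apply Rmin_r]).
    specialize (C1 t ltac:(unfold t; lra)); specialize (C2 t ltac:(unfold t; lra)).
    rewrite Rminus_0_r in C1, C2; apply Rabs_def2 in C1; apply Rabs_def2 in C2.
    assert (M : (r1 s - r2 s) ^ 2 <= (r1 t - r2 t) ^ 2).
    { apply (dl_nonpos_decr (fun x => (r1 x - r2 x) ^ 2) (fun x => 2 * (r1 x - r2 x) * (rho1 x - rho2 x)));
        [unfold t; lra| |].
      - intros x Hx; assert (x0 : 0 < x) by (unfold t in Hx; lra).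
        destruct (Hs1 x x0) as (_ & _ & _ & D1); destruct (Hs2 x x0) as (_ & _ & _ & D2).
        eapply dl_eq; [dl|simpl; ring].
      - intros x Hx; assert (x0 : 0 < x) by (unfold t in Hx; lra).
        destruct (H1 x ltac:(lra)) as [p1 ->]; destruct (H2 x ltac:(lra)) as [p2 ->].
        destruct (Hs1 x x0) as (_ & q1 & _); destruct (Hs2 x x0) as (_ & q2 & _).
        destruct (Rle_or_lt (r1 x) (r2 x)) as [l|l].
        + assert (G (r2 x ^ 2) <= G (r1 x ^ 2)); [|nra].
          apply (local_solution_G_decr g beta eps G W); auto; split; [apply pow2_ge_0|apply pow_incr; lra].
        + assert (G (r1 x ^ 2) <= G (r2 x ^ 2)); [|nra].
          apply (local_solution_G_decr g beta eps G W); auto; split; [apply pow2_ge_0|apply pow_incr; lra]. }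
    destruct (Hs1 t) as (_ & q1 & _); [unfold t; lra|]; destruct (Hs2 t) as (_ & q2 & _); [unfold t; lra|].
    nra. }
  split; auto; destruct (H1 s) as [_ ->]; [lra|]; destruct (H2 s) as [_ ->]; [lra|]; now rewrite Er. }
intros s Hs; destruct (Rlt_or_le s sm) as [l|l]; [apply near; lra|].
set (a := sm / 2); assert (a0 : 0 < a < sm) by (unfold a; lra).
destruct (near a a0) as [Ex Er].
destruct (Hs1 a) as (p1 & p2 & _); [lra|]; assert (p3 := proj2 (S31 a (proj1 a0))).
set (R := Rmax R1 R2).
assert (Ra : R1 <= R) by apply Rmax_l. assert (Rb : R2 <= R) by apply Rmax_r.
assert (HR : r1 a <= R) by (specialize (bd1 a); lra).
(* By monotonicity both solutions stay in the box spanned by their common state at [a] and by [R],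
   where the clamps do nothing. *)
destruct (excess_lipschitz g g1 B (rho1 a) (r1 a) R) as (M & _ & BL); auto; try lra.
assert (F1 : clamped_flow g (rho1 a) (r1 a) R beta (fun t => rho1 (a + t)) (fun t => r1 (a + t))).
{ intros t Ht; destruct (Hs1 (a + t)) as (_ & q & D1 & D2); [lra|].
  rewrite (clamp_id (- rho1 a) (rho1 a)) by (specialize (dec1 a (a + t)); destruct (S31 (a + t)); lra).
  rewrite (clamp_id (r1 a) R) by (specialize (inc1 a (a + t)); specialize (bd1 (a + t)); lra).
  split; eapply dl_eq.
  - apply (dl_comp (fun t => a + t) r1); [dl|exact D2].
  - ring.
  - apply (dl_comp (fun t => a + t) rho1); [dl|exact D1].
  - ring. }
assert (F2 : clamped_flow g (rho1 a) (r1 a) R beta (fun t => rho2 (a + t)) (fun t => r2 (a + t))).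
{ intros t Ht; destruct (Hs2 (a + t)) as (_ & q & D1 & D2); [lra|].
  rewrite (clamp_id (- rho1 a) (rho1 a)) by (specialize (dec2 a (a + t)); destruct (S32 (a + t)); lra).
  rewrite (clamp_id (r1 a) R) by (specialize (inc2 a (a + t)); specialize (bd2 (a + t)); lra).
  split; eapply dl_eq.
  - apply (dl_comp (fun t => a + t) r2); [dl|exact D2].
  - ring.
  - apply (dl_comp (fun t => a + t) rho2); [dl|exact D1].
  - ring. }
assert (Z := clamped_flow_dependence g B (rho1 a) (r1 a) R M beta beta _ _ _ _ Hb Hb (Rlt_le _ _ p3) HR BL F1 F2
  (s - a) ltac:(lra)).
cbv beta in Z; rewrite Rplus_0_r, Ex, Er, !Rminus_diag in Z.
replace (a + (s - a)) with s in Z by ring.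
replace ((0 ^ 2 + 0 ^ 2 + 0 ^ 2 * (s - a)) * exp ((1 + M ^ 2 + 3 * M) * (s - a))) with 0 in Z by ring.
assert (Q1 := pow2_ge_0 (r1 s - r2 s)); assert (Q2 := pow2_ge_0 (rho1 s - rho2 s)).
assert ((r1 s - r2 s) ^ 2 = 0) by lra. assert ((rho1 s - rho2 s) ^ 2 = 0) by lra.
split; nra.
Qed.

Theorem theorem3p1 (g : R -> R)
  (Hg_an : analytic g)
  (Hg_pos : forall v, 0 < v -> 0 < g v)
  (Hg_mono : forall v l, 0 < v -> derivable_pt_lim g v l -> 0 <= l)
  (Hg_convex : forall v l, 0 < v ->
     second_derivative_at (fun w => w ^ 2 * g (w ^ 2)) v l -> 0 < l)
  (Hg_inf : forall M, exists V, forall v, V < v -> M < v * g (v ^ 2)) :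
  exists beta, 0 < beta /\
    (exists rho r, toy_steady_tip_growth g beta rho r) /\
    (forall rho1 r1 rho2 r2,
       toy_steady_tip_growth g beta rho1 r1 ->
       toy_steady_tip_growth g beta rho2 r2 ->
       forall s, 0 < s -> rho1 s = rho2 s /\ r1 s = r2 s).
Proof.
destruct (analytic_C2 g Hg_an) as (g1 & g2 & D1 & D2).
assert (C1 : forall x, continuity_pt g1 x) by (intros x; apply (dl_cont _ _ _ (D2 x))).
assert (g1n : forall v, 0 < v -> 0 <= g1 v) by (intros v Hv; apply (Hg_mono v); auto).
assert (gn : forall v, 0 <= v -> 0 <= g v).
{ apply (cont_nonneg_at_0 g); [apply (dl_cont _ _ _ (D1 0))|].
  intros x Hx; left; auto. }
assert (g1n0 : forall v, 0 <= v -> 0 <= g1 v) by (now apply cont_nonneg_at_0).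
assert (gi : forall u v, 0 <= u <= v -> g u <= g v).
{ intros u v Huv; apply (dl_nonneg_incr g g1); [lra|auto|]; intros x Hx; apply g1n0; lra. }
assert (cvx : forall v, 0 < v ->
  0 < 2 * g (v ^ 2) + 10 * v ^ 2 * g1 (v ^ 2) + 4 * v ^ 4 * g2 (v ^ 2)).
{ intros v Hv; apply (Hg_convex v); auto.
  exists (fun v => 2 * v * g (v ^ 2) + 2 * v ^ 3 * g1 (v ^ 2)), 1; split; [lra|split].
  - intros x _; assert (E1 := D1 (x ^ 2)); eapply dl_eq; [dl|simpl; ring].
  - assert (E1 := D1 (v ^ 2)); assert (E2 := D2 (v ^ 2)); eapply dl_eq; [dl|simpl; ring]. }
assert (P16 := Hg_pos 16 ltac:(lra)); assert (P4 := Hg_pos (1 / 4) ltac:(lra)).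
(* [b] makes [Q = 1] at [r = 4], and [B] makes [Q = 8] at [r = 1/2]. *)
set (b := / (16 * g 16)); set (B := 32 / g (1 / 4)).
assert (b0 : 0 < b) by (apply Rinv_0_lt_compat; lra).
assert (bB : b <= B).
{ assert (gi' := gi (1 / 4) 16 ltac:(lra)).
  apply Rle_trans with (/ g (1 / 4)); [apply Rinv_le_contravar; lra|].
  unfold B, Rdiv; assert (0 < / g (1 / 4)) by (now apply Rinv_0_lt_compat); lra. }
destruct (local_solution_exists g B) as (eps & He & Hloc); [auto|lra|].
set (r0 := eps / 2).
assert (r00 : 0 < r0 < 1 / 48) by (unfold r0; lra).
assert (r0e : r0 ^ 2 < eps) by (unfold r0; nra).
set (c := sqrt (1 - r0 ^ 2 / 64)).
assert (cc : 1 - c ^ 2 = r0 ^ 2 / 64) by (unfold c; rewrite pow2_sqrt; nra).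
assert (c0 : 0 <= c < 1).
{ assert (0 <= c) by apply sqrt_pos. assert (0 < r0 ^ 2) by (apply pow_lt; lra). split; auto; nra. }
(* The threshold is set for the smallest parameter [b], so that [R1] serves every [beta >= b]. *)
destruct (Hg_inf (4 / (r0 * b))) as [V HV].
set (R1 := Rmax V r0 + 1).
assert (R1a : V < R1) by (assert (X := Rmax_l V r0); unfold R1; lra).
assert (R1b : r0 < R1) by (assert (X := Rmax_r V r0); unfold R1; lra).
assert (R1c : 1 < r0 / 4 * (b * R1 * g (R1 ^ 2))).
{ specialize (HV R1 R1a).
  assert (X : 0 < r0 * b) by (apply Rmult_lt_0_compat; lra).
  apply (Rmult_lt_compat_l (r0 * b / 4)) in HV; [|lra].
  replace (r0 * b / 4 * (4 / (r0 * b))) with 1 in HV by (field; lra).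
  replace (r0 / 4 * (b * R1 * g (R1 ^ 2))) with (r0 * b / 4 * (R1 * g (R1 ^ 2))) by field; auto. }
destruct (excess_lipschitz g g1 B c (r0 / 2) R1) as (M & BLE & BLF); auto; try lra.
destruct (shooting_solution g g1 g2 b B eps r0 R1 c M) as (beta & rho & r & G & W & Hb & HL & rE & xE & Hflow);
  auto; try lra.
- unfold b; field; lra.
- unfold B; field; lra.
- exists beta; split; [lra|split].
  + apply (glued_solution g beta eps G W r0 R1 rho r); auto; lra.
  + intros rho1 r1 rho2 r2; apply (toy_uniqueness g g1 B beta eps G W); auto; lra.
Qed.
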